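(* Let $(\Omega,\mathcal{F},\mathbb{P})$ be a probability space, let $(X_n)_{n\in\mathbb{N}}$ be a sequence of independent random variables on it, taking values in $\{0,1\}$, such that $\mathbb{P}(X_n=1)=n^{-a}$ for some $a\in(0,1/2)$, and let $(a_n(\omega))_{n\in\mathbb{N}}$ be the random sequence of integers generated by $(X_n)_{n\in\mathbb{N}}$. Let $b>0$ be such that $b+2a<1/2$. Then, for $\mathbb{P}$-almost every $\omega\in\Omega$, the following holds: for every measure preserving system $(X,\mathcal{X},\mu,T)$ and every $f,g\in L^\infty(\mu)$, the averages $$\frac1N\sum_{n=1}^N f(T^{a_n(\omega)}x)\,g(T^{\lfloor a_n(\omega)^{1+b}\rfloor}x)$$ converge in $L^2(\mu)$-norm as $N\to\infty$.
   Context: A measure preserving system is a tuple $(X,\mathcal{X},\mu,T)$ with $(X,\mathcal{X},\mu)$ a probability space and $T\colon X\to X$ measurable with $\mu(T^{-1}A)=\mu(A)$ for all $A\in\mathcal{X}$. For $\omega\in\Omega$ such that $X_m(\omega)=1$ for infinitely many $m$ (which holds for almost every $\omega$ here), the random sequence of integers generated by $(X_n)_{n\in\mathbb{N}}$ is $a_n(\omega):=\inf\{k\in\mathbb{N}:\ X_1(\omega)+\cdots+X_k(\omega)=n\}$. *)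

(* Defs.v *)
From HB Require Import structures.
From mathcomp Require Export all_boot all_order all_algebra finmap.
From mathcomp Require Export all_classical all_reals all_analysis.
From mathcomp Require Export complex.

Set Implicit Arguments.
Unset Strict Implicit.
Unset Printing Implicit Defensive.

Import Order.TTheory GRing.Theory Num.Theory.
Import numFieldNormedType.Exports.

Local Open Scope classical_set_scope.
Local Open Scope ring_scope.

Definition independent_RVs {d} {Omega : measurableType d} {R : realType}
    (P : probability Omega R) (K : choiceType) (D : set K)
    (X : K -> {RV P >-> R}) : Prop :=
  forall (J : {fset K}) (B : K -> set R),
    [set` J] `<=` D -> (forall j, measurable (B j)) ->
    P (\bigcap_(j in [set` J]) (X j @^-1` B j)) =
    (\prod_(j <- J) P (X j @^-1` B j))%E.

(* The least k >= 1 with Y 1 + ... + Y k = n.  If there is no such k the value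
   is 0; for a 0-1 sequence Y and n >= 1 this only happens when Y takes the
   value 1 fewer than n times. *)
Definition generated_seq {R : realType} (Y : nat -> R) (n : nat) : nat :=
  let hits := [set k : nat | (1 <= k)%N /\ \sum_(1 <= i < k.+1) Y i = n%:R] in
  xget 0%N [set k | hits k /\ forall j, hits j -> (k <= j)%N].

Definition measure_preserving {d} {X : measurableType d} {R : realType}
    (mu : probability X R) (T : X -> X) : Prop :=
  measurable_fun setT T /\
  forall A, measurable A -> mu (T @^-1` A) = mu A.

Section complex_Lp.
Context {d} {X : measurableType d} {R : realType} (mu : probability X R).

(* Elements of the complex spaces L^p(mu) are represented by functions; the
   definitions below only depend on them up to equality almost everywhere, apart
   from measurability of the representative. *)
Definition complex_Lnorm (p : \bar R) (f : X -> R[i]) : \bar R :=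
  Lnorm mu p (fun x => (ComplexField.Normc.normc (f x))%:E).

(* Borel measurability into C amounts to measurability of the two coordinates. *)
Definition complex_Lfun (p : \bar R) (f : X -> R[i]) : Prop :=
  [/\ measurable_fun setT (fun x => complex.Re (f x)),
      measurable_fun setT (fun x => complex.Im (f x)) &
      (complex_Lnorm p f < +oo)%E].

Definition cvg_in_L2 (F : nat -> X -> R[i]) : Prop :=
  exists h : X -> R[i], complex_Lfun 2%:E h /\
    complex_Lnorm 2%:E (fun x => F N x - h x) @[N --> \oo] --> 0%E.

End complex_Lp.

Definition ergodic_average {X : Type} {R : realType} (T : X -> X)
    (u v : nat -> nat) (f g : X -> R[i]) (N : nat) (x : X) : R[i] :=
  N%:R^-1 * \sum_(1 <= n < N.+1) f (iter (u n) T x) * g (iter (v n) T x).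

(* Main.v *)
(* Since [a_n] is the [n]-th index [m] with [X_m = 1], the average in question
   is a mean of [F_m = T^m f * T^[m^(1+b)] g] with weights [X_m].  Writing
   [X_m = (X_m - m^(-a)) + m^(-a)] splits it into a random and a deterministic
   part.

   Random part: van der Corput's inequality leads to correlations of
   [Y_m = X_m - m^(-a)] at distance [r]; sorting the indices by the gap
   [k = [(m+r)^(1+b)] - [m^(1+b)]] turns them into sums of
   [Y_m * Y_(m+r) * T^(w_m) (g * T^k g)].  Transference to a cyclic group and
   Plancherel bound the L^2 norm of such a sum, uniformly in the system, by the
   exponential sums [sum Y_m * Y_(m+r) * z^(t w_m)], [z] a root of unity.
   Bernstein's inequality and Borel-Cantelli control polynomially many of these
   for almost every [omega], with a power saving when [b + 2 a < 1 / 2].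

   Deterministic part: summation by parts leaves the Cesaro averages of [F_m].
   Replace [f] and [g] by long Birkhoff averages, which are almost invariant.
   The remaining terms are negligible after two applications of van der Corput's
   inequality, because the gaps of [m^(1+b)] grow slowly and its fractional parts
   equidistribute; the rounding is absorbed by a [Z/Q]-suspension on which a
   [Q]-th root of [T] exists.

   All estimates are uniform over the abstract systems below, which only record
   a bounded function algebra, a positive normalised functional and a shift.
   Limits are first produced up to a prescribed error, so that neither a
   conditional expectation nor the invertibility of [T] is needed; completeness
   of L^2 enters at the end. *)

Require Import Defs.
From mathcomp Require Import cyclic separable cyclotomic.
From mathcomp Require Import measurable_realfun ess_sup_inf zify ring lra.

Set Implicit Arguments.
Unset Strict Implicit.
Unset Printing Implicit Defensive.

Import Order.TTheory GRing.Theory Num.Theory.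
Import numFieldNormedType.Exports.

Local Open Scope classical_set_scope.
Local Open Scope ring_scope.


(** * Exponential sums over a cyclic group *)

Local Notation "x %:C" := (real_complex _ x) : ring_scope.

(** The exceptional null set may not depend on the system, so randomness enters only through scalar
    conditions: for each N, polynomially many correlation sums. With van der Corput length N^(a+s)
    there are about N^(a+b+s) gaps, and each may contribute at most u = N^(1-3a-b-2s) if the total
    is to stay a power below N^(2-2a), the squared order of the number of hits. A sum of products of
    two centred variables has variance about N^(1-2a), and Bernstein needs u^2 to exceed this by a
    power: this leaves room for some s > 0 exactly when 4a + 2b < 1. The tails then beat every power
    of N, so no lacunary subsequence is needed. The obstacle in the deterministic part is rounding.
    The gaps of [n^(1+b)] at distance r equal r [(1+b) n^b] only up to a bounded, varying error, and
    composing with a bounded power of T is not a small perturbation. On a tower of height Q it is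
    one, of relative size error/Q, and Q is chosen after all other parameters. Coming back from the
    tower requires that n^(1+b) is rarely just below an integer, which is the same tower estimate
    applied to a finite rotation. *)

Lemma primitive_root_exists (C : numClosedFieldType) n :
  (0 < n)%N -> exists z : C, n.-primitive_root z.
Proof.
move=> n_gt0; pose p : {poly C} := 'X^n - 1.
have [r Dp] := closed_field_poly_normal p.
rewrite (monicP _) ?monicXnsubC // scale1r in Dp.
have rn1 : all n.-unity_root r by apply/allP => z; rewrite -root_prod_XsubC -Dp.
have sz_r : (n < (size r).+1)%N.
  by rewrite -(size_prod_XsubC r id) -Dp size_XnsubC.
have [|z] := hasP (has_prim_root n_gt0 rn1 _ sz_r); last by exists z.
by rewrite -separable_prod_XsubC -Dp separable_Xn_sub_1 // pnatr_eq0 -lt0n.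
Qed.

Section dft.
Variables (C : numClosedFieldType) (L : nat) (z : C).
Hypothesis zP : L.-primitive_root z.

Let L_gt0 : (0 < L)%N := prim_order_gt0 zP.

Lemma norm_prim_root : `|z| = 1.
Proof.
by apply/eqP; rewrite -(pexpr_eq1 L_gt0) // -normrX (prim_expr_order zP) normr1.
Qed.

Lemma conj_prim_root k : (z ^+ k)^* = z ^- k.
Proof.
rewrite rmorphXn /= -exprVn; congr (_ ^+ _).
by rewrite [RHS]invC_norm norm_prim_root expr1n invr1 mul1r.
Qed.

Lemma prim_root_sum k m : (k < L)%N -> (m < L)%N ->
  \sum_(t < L) z ^+ (t * k) * (z ^+ (t * m))^* = (if k == m then L%:R else 0 : C).
Proof.
move=> kL mL.
have -> : \sum_(t < L) z ^+ (t * k) * (z ^+ (t * m))^* =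
          \sum_(t < L) (z ^+ k / z ^+ m) ^+ t.
  by apply: eq_bigr => t _; rewrite conj_prim_root exprMn exprVn -!exprM ![(t * _)%N]mulnC.
have z0 : z != 0 by rewrite -normr_eq0 norm_prim_root oner_eq0.
case: eqVneq => [->|km].
  rewrite divff ?expf_neq0 //; under eq_bigr do rewrite expr1n.
  by rewrite sumr_const card_ord.
set q := _ / _.
have q1 : q != 1.
  rewrite /q; apply: contra km => /eqP e.
  have : z ^+ k = z ^+ m by rewrite -[LHS](mulfVK (expf_neq0 m z0)) e mul1r.
  by move/eqP; rewrite (eq_prim_root_expr zP) !modn_small.
have : (q - 1) * \sum_(t < L) q ^+ t = 0.
  rewrite -subrX1 /q exprMn exprVn -!exprM ![(_ * L)%N]mulnC !exprM.
  by rewrite (prim_expr_order zP) !expr1n invr1 mulr1 subrr.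
by move/eqP; rewrite mulf_eq0 subr_eq0 (negbTE q1) /= => /eqP.
Qed.

Lemma plancherel (x : nat -> C) :
  \sum_(t < L) `|\sum_(m < L) x m * z ^+ (t * m)| ^+ 2 =
  L%:R * \sum_(m < L) `|x m| ^+ 2.
Proof.
transitivity (\sum_(t < L) \sum_(m < L) \sum_(k < L)
   (x m * (x k)^*) * (z ^+ (t * m) * (z ^+ (t * k))^*)).
  apply: eq_bigr => t _; rewrite normCK rmorph_sum /= mulr_suml.
  apply: eq_bigr => m _; rewrite mulr_sumr; apply: eq_bigr => k _.
  by rewrite rmorphM /= mulrACA.
rewrite exchange_big mulr_sumr; apply: eq_bigr => m _.
rewrite exchange_big (bigD1 m) //= [X in _ + X]big1 ?addr0; last first.
  move=> k km; rewrite -mulr_sumr prim_root_sum // eq_sym.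
  by rewrite (negbTE (km : k != m :> nat)) mulr0.
by rewrite -mulr_sumr prim_root_sum // eqxx mulrC normCK.
Qed.

Lemma dft_shift (x : nat -> C) (w t : nat) :
  \sum_(m < L) x ((m + w) %% L)%N * z ^+ (t * m) =
  (z ^+ (t * w))^* * \sum_(m < L) x m * z ^+ (t * m).
Proof.
have z0 : z != 0 by rewrite -normr_eq0 norm_prim_root oner_eq0.
pose h (m : 'I_L) : 'I_L := Ordinal (ltn_pmod (m + w) L_gt0).
have h_inj : injective h.
  move=> m m' /(congr1 val) /= /eqP; rewrite eqn_modDr !modn_small // => /eqP.
  exact: val_inj.
rewrite [in RHS](reindex_inj h_inj) mulr_sumr; apply: eq_bigr => m _ /=.
rewrite mulrCA; congr (_ * _).
have -> : z ^+ (t * ((m + w) %% L)) = z ^+ (t * (m + w)).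
  by apply/eqP; rewrite (eq_prim_root_expr zP) modnMmr.
by rewrite conj_prim_root mulnDr exprD mulrC mulfK // expf_neq0.
Qed.

End dft.

(** The left side is a convolution operator on Z/L applied to [g]. The discrete Fourier transform
    diagonalises it with eigenvalues the conjugates of [K t], so by Plancherel its squared norm is
    at most the largest [|K t| ^+ 2]. Real and imaginary parts are kept apart because Bernstein's
    inequality is applied to each of them. *)
Lemma circulant_bound (R : realType) (L : nat) (z : R[i]) (s : seq nat)
    (c g : nat -> R) (w : nat -> nat) (B : R) :
  L.-primitive_root z ->
  (forall t, (t < L)%N ->
     (\sum_(n <- s) c n * complex.Re (z ^+ (t * w n))) ^+ 2 +
     (\sum_(n <- s) c n * complex.Im (z ^+ (t * w n))) ^+ 2 <= B) ->
  \sum_(m < L) (\sum_(n <- s) c n * g ((m + w n) %% L)%N) ^+ 2 <=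
  B * \sum_(m < L) g m ^+ 2.
Proof.
move=> zP cB; have L_gt0 := prim_order_gt0 zP.
pose G (t : nat) := \sum_(m < L) (g m)%:C * z ^+ (t * m).
pose K (t : nat) := \sum_(n <- s) (c n)%:C * z ^+ (t * w n).
pose h (m : nat) := \sum_(n <- s) c n * g ((m + w n) %% L)%N.
have HE t : \sum_(m < L) (h m)%:C * z ^+ (t * m) = (K t)^* * G t.
  rewrite /K rmorph_sum /= mulr_suml.
  under eq_bigr do rewrite /h raddf_sum /= mulr_suml.
  rewrite exchange_big; apply: eq_bigr => n _.
  rewrite rmorphM /= -mulrA -(dft_shift zP (fun m => (g m)%:C)) mulr_sumr.
  apply: eq_bigr => m _; rewrite rmorphM /= -mulrA; congr (_ * _).
  by rewrite conj_Creal // complex_real.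
have KB t : (t < L)%N -> `|K t| ^+ 2 <= B%:C.
  move=> tL; rewrite -add_Re2_Im2 lecR.
  apply: le_trans (cB t tL); rewrite le_eqVlt; apply/orP; left; apply/eqP.
  rewrite /K !raddf_sum /=; congr (_ ^+ 2 + _ ^+ 2); apply: eq_bigr => n _;
  by case: (z ^+ _) => u v /=; rewrite mul0r ?subr0 ?addr0.
have pE (x : nat -> R) : L%:R * \sum_(m < L) (x m ^+ 2)%:C =
    \sum_(t < L) `|\sum_(m < L) (x m)%:C * z ^+ (t * m)| ^+ 2 :> R[i].
  rewrite (plancherel zP (fun m => (x m)%:C)); congr (_ * _).
  apply: eq_bigr => m _.
  by rewrite -add_Re2_Im2 /= expr0n addr0.
have L0 : (0 : R[i]) < L%:R by rewrite ltr0n.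
suff : (\sum_(m < L) h m ^+ 2)%:C <= (B * \sum_(m < L) g m ^+ 2)%:C.
  by rewrite lecR.
rewrite -(ler_pM2l L0) rmorphM /= !raddf_sum /= pE mulrCA pE mulr_sumr.
apply: ler_sum => t _; rewrite HE normrM norm_conjC exprMn.
by apply: ler_wpM2r; rewrite ?exprn_ge0 // KB.
Qed.

(** * Bernstein's inequality for sums over disjoint pairs *)

(** Both sides are compared after multiplication by 1 - z: the left becomes at most 1 since 1 - z <=
    e^(-z), the right equals 1 + z^2 (1 - 2z), at least 1. *)
Lemma expR_le_quadratic (R : realType) (z : R) :
  `|z| <= 1 / 2 -> expR z <= 1 + z + 2 * z ^+ 2.
Proof.
rewrite ler_norml => /andP[z1 z2].
have h : 1 - z <= expR (- z) by have := expR_ge1Dx (- z); lra.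
have h0 : 0 < expR z by exact: expR_gt0.
have e : expR z * expR (- z) = 1 by rewrite expRN divff // gt_eqF.
have h1 : expR z * (1 - z) <= 1 by apply: le_trans (ler_wpM2l (ltW h0) h) _; rewrite e.
have h2 : 1 <= (1 + z + 2 * z ^+ 2) * (1 - z).
  have -> : (1 + z + 2 * z ^+ 2) * (1 - z) = 1 + z ^+ 2 * (1 - 2 * z) by ring.
  by rewrite lerDl mulr_ge0 ?sqr_ge0 //; lra.
have z0 : 0 < 1 - z by lra.
by rewrite -(ler_pM2r z0); exact: le_trans h1 h2.
Qed.

Section bernoulli_product.
Variables (R : realType) (N : nat) (q : 'I_N -> R).
Hypothesis q01 : forall i, 0 <= q i <= 1.
Implicit Types (e : {ffun 'I_N -> bool}) (F : {ffun 'I_N -> bool} -> R).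

(** The law of N independent 0-1 variables is kept as a finite weighted sum over bit vectors, so
    Bernstein's inequality needs no integration; [hits_law] links it to the probability space. *)
Definition bern (i : 'I_N) (x : bool) : R := if x then q i else 1 - q i.

Definition bern_weight e : R := \prod_i bern i (e i).

Definition bern_mean F : R := \sum_e bern_weight e * F e.

Definition bern_center (i : 'I_N) (x : bool) : R := x%:R - q i.

Definition override e (i : 'I_N) (x : bool) : {ffun 'I_N -> bool} :=
  [ffun j => if j == i then x else e j].

Lemma bern_ge0 i x : 0 <= bern i x.
Proof. by rewrite /bern; have /andP[? ?] := q01 i; case: x => //; rewrite subr_ge0. Qed.

Lemma bern_weight_ge0 e : 0 <= bern_weight e.
Proof. by apply: prodr_ge0 => i _; exact: bern_ge0. Qed.

Lemma le_bern_mean F G : (forall e, F e <= G e) -> bern_mean F <= bern_mean G.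
Proof. by move=> FG; apply: ler_sum => e _; rewrite ler_wpM2l ?bern_weight_ge0. Qed.

Lemma bern_meanZ c F : bern_mean (fun e => c * F e) = c * bern_mean F.
Proof. by rewrite mulr_sumr; apply: eq_bigr => e _; rewrite mulrCA. Qed.

Lemma bern_mean1 : bern_mean (fun=> 1) = 1.
Proof.
rewrite /bern_mean; under eq_bigr do rewrite mulr1.
rewrite /bern_weight -(bigA_distr_bigA bern) /= big1 // => i _.
by rewrite big_bool /bern /= addrC subrK.
Qed.

(** Integrating out one coordinate, in place of Fubini. On pairs of a vector and a fresh bit,
    exchanging the bit with coordinate [i] is an involution that preserves the product weight. *)
Lemma bern_mean_resample i F :
  bern_mean F = bern_mean (fun e => \sum_x bern i x * F (override e i x)).
Proof.
pose W e := \prod_(j | j != i) bern j (e j).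
have WE e : bern_weight e = bern i (e i) * W e by rewrite /bern_weight (bigD1 i).
have Wo e x : W (override e i x) = W e.
  by apply: eq_bigr => j ji; rewrite ffunE (negbTE ji).
have oo e x : override (override e i x) i (e i) = e.
  by apply/ffunP => j; rewrite !ffunE; case: eqP => [->|].
have oi e x : override e i x i = x by rewrite ffunE eqxx.
transitivity (\sum_(p : {ffun 'I_N -> bool} * bool)
   bern i (p.1 i) * W p.1 * bern i p.2 * F (override p.1 i p.2)); last first.
  rewrite /bern_mean; under [RHS]eq_bigr do rewrite mulr_sumr.
  by rewrite pair_bigA; apply: eq_bigr => -[e x] _ /=; rewrite WE !mulrA.
pose h (p : {ffun 'I_N -> bool} * bool) := (override p.1 i p.2, p.1 i).
have hK : involutive h by case=> e x; rewrite /h /= oo oi.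
rewrite (reindex_inj (inv_inj hK)).
rewrite -(pair_bigA _ (fun e x => bern i ((h (e, x)).1 i) * W (h (e, x)).1 *
   bern i (h (e, x)).2 * F (override (h (e, x)).1 i (h (e, x)).2))) /=.
apply: eq_bigr => e _; rewrite big_bool /= !oi !Wo !oo WE /bern; ring.
Qed.

(** The left side is the exponential moment of a product of two independent centred Bernoulli
    variables. After the quadratic bound the linear term averages to zero and the quadratic one to
    the variance a b (1 - a) (1 - b), at most a b. *)
Lemma pair_mgf (a b t : R) : 0 <= a <= 1 -> 0 <= b <= 1 -> `|t| <= 1 / 2 ->
  a * (b * expR (t * ((1 - a) * (1 - b))) + (1 - b) * expR (t * ((1 - a) * (0 - b)))) +
  (1 - a) * (b * expR (t * ((0 - a) * (1 - b))) + (1 - b) * expR (t * ((0 - a) * (0 - b))))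
  <= 1 + 2 * (t ^+ 2 * (a * b)).
Proof.
move=> /andP[a0 a1] /andP[b0 b1] t2.
have H (x y : R) : `|x| <= 1 -> `|y| <= 1 ->
    expR (t * (x * y)) <= 1 + t * (x * y) + 2 * (t * (x * y)) ^+ 2.
  move=> x1 y1; apply: expR_le_quadratic; rewrite !normrM.
  rewrite -[leRHS]mulr1; apply: ler_pM => //; last by rewrite -[leRHS]mulr1; apply: ler_pM.
have na : `|0 - a| <= 1 by rewrite sub0r normrN ger0_norm.
have nb : `|0 - b| <= 1 by rewrite sub0r normrN ger0_norm.
have nA : `|1 - a| <= 1 by rewrite ger0_norm; lra.
have nB : `|1 - b| <= 1 by rewrite ger0_norm; lra.
have A0 : 0 <= 1 - a by lra.
have B0 : 0 <= 1 - b by lra.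
apply: (@le_trans _ _ (a * (b * (1 + t * ((1 - a) * (1 - b)) + 2 * (t * ((1 - a) * (1 - b))) ^+ 2)
    + (1 - b) * (1 + t * ((1 - a) * (0 - b)) + 2 * (t * ((1 - a) * (0 - b))) ^+ 2)) +
  (1 - a) * (b * (1 + t * ((0 - a) * (1 - b)) + 2 * (t * ((0 - a) * (1 - b))) ^+ 2)
   + (1 - b) * (1 + t * ((0 - a) * (0 - b)) + 2 * (t * ((0 - a) * (0 - b))) ^+ 2)))).
  by apply: lerD; apply: ler_wpM2l => //; apply: lerD; apply: ler_wpM2l => //; exact: H.
apply: (@le_trans _ _ (1 + 2 * (t ^+ 2 * (a * b) * ((1 - a) * (1 - b))))).
  by rewrite le_eqVlt; apply/orP; left; apply/eqP; ring.
have ab0 : 0 <= a * b by exact: mulr_ge0.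
have h1 : (1 - a) * (1 - b) <= 1 by rewrite -[leRHS]mulr1; apply: ler_pM => //; lra.
rewrite lerD2l ler_pM2l // -[leRHS]mulr1; apply: ler_wpM2l => //.
by rewrite mulr_ge0 // sqr_ge0.
Qed.

Definition pair_sum (al : 'I_N * 'I_N -> R) (s : seq ('I_N * 'I_N)) e : R :=
  \sum_(p <- s) al p * (bern_center p.1 (e p.1) * bern_center p.2 (e p.2)).

(** Disjoint pairs give independent summands: resampling both indices of the first pair does not
    affect the rest of the sum, so the exponential moment factors and [pair_mgf] is applied pair by
    pair. *)
Lemma pair_sum_mgf (al : 'I_N * 'I_N -> R) (s : seq ('I_N * 'I_N)) (l : R) :
  uniq (flatten [seq [:: p.1; p.2] | p <- s]) ->
  (forall p, `|al p| <= 1) -> 0 <= l <= 1 / 2 ->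
  bern_mean (fun e => expR (l * pair_sum al s e)) <=
  expR (2 * l ^+ 2 * \sum_(p <- s) q p.1 * q p.2).
Proof.
move=> + al1 /andP[l0 l2]; elim: s => [|[i j] s IH] /=.
  move=> _; rewrite big_nil mulr0 expR0 -[leRHS]bern_mean1.
  by apply: le_bern_mean => e; rewrite /pair_sum big_nil mulr0 expR0.
rewrite inE negb_or => /andP[/andP[ij iS] /andP[jS us]].
have fresh e k x : k \notin flatten [seq [:: p.1; p.2] | p <- s] ->
    pair_sum al s (override e k x) = pair_sum al s e.
  move=> kS; rewrite /pair_sum !big_seq; apply: eq_bigr => p ps.
  have h1 : p.1 != k.
    apply: contra kS => /eqP <-; apply/flattenP; exists [:: p.1; p.2]; last by rewrite !inE eqxx.
    by apply/mapP; exists p.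
  have h2 : p.2 != k.
    apply: contra kS => /eqP <-; apply/flattenP; exists [:: p.1; p.2]; last by rewrite !inE eqxx orbT.
    by apply/mapP; exists p.
  by rewrite !ffunE (negbTE h1) (negbTE h2).
rewrite big_cons /=.
pose t := l * al (i, j).
have t2 : `|t| <= 1 / 2.
  by rewrite /t normrM (ger0_norm l0) -[leRHS]mulr1; apply: ler_pM.
have tl : t ^+ 2 <= l ^+ 2.
  rewrite /t exprMn -[leRHS]mulr1; apply: ler_wpM2l; first exact: sqr_ge0.
  by rewrite -real_normK ?num_real // expr_le1.
rewrite (bern_mean_resample i) (bern_mean_resample j).
apply: (@le_trans _ _ (bern_mean (fun e => (1 + 2 * (t ^+ 2 * (q i * q j))) *
    expR (l * pair_sum al s e)))).
  apply: le_bern_mean => e.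
  have E x y : expR (l * pair_sum al ((i, j) :: s) (override (override e j y) i x)) =
      expR (t * ((x%:R - q i) * (y%:R - q j))) * expR (l * pair_sum al s e).
    rewrite -expRD -mulrA -mulrDr; congr (expR (l * _)).
    rewrite /pair_sum big_cons /= -!/(pair_sum _ _ _) !fresh //.
    congr (_ * (_ * _) + _); rewrite /bern_center !ffunE eqxx //.
    by rewrite eq_sym (negbTE ij).
  rewrite !big_bool /= !E.
  apply: le_trans (ler_wpM2r (expR_ge0 _) (pair_mgf (q01 i) (q01 j) t2)).
  by rewrite le_eqVlt; apply/orP; left; apply/eqP; rewrite /bern; ring.
rewrite bern_meanZ mulrDr expRD.
have qij : 0 <= q i * q j by rewrite mulr_ge0 //; [case/andP: (q01 i)|case/andP: (q01 j)].
apply: ler_pM => //.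
- by rewrite addr_ge0 // mulr_ge0 // mulr_ge0 ?sqr_ge0.
- by apply: sumr_ge0 => e _; rewrite mulr_ge0 ?bern_weight_ge0 ?expR_ge0.
- apply: le_trans (expR_ge1Dx _); rewrite lerD2l -mulrA ler_pM2l //.
  exact: ler_wpM2r.
- exact: IH.
Qed.

(** Chernoff's bound for [al] and for [- al], one for each sign of the sum; hence the factor 2. The
    parameter [l] is left free and optimised in [correlation_tail]. *)
Lemma pair_sum_tail (al : 'I_N * 'I_N -> R) (s : seq ('I_N * 'I_N)) (l u V : R) :
  uniq (flatten [seq [:: p.1; p.2] | p <- s]) ->
  (forall p, `|al p| <= 1) -> 0 <= l <= 1 / 2 ->
  \sum_(p <- s) q p.1 * q p.2 <= V ->
  bern_mean (fun e => (u < `|pair_sum al s e|)%R%:R) <=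
  2 * expR (2 * l ^+ 2 * V - l * u).
Proof.
move=> us al1 l12 sV; have /andP[l0 _] := l12.
have one be : (forall p, `|be p| <= 1) ->
    bern_mean (fun e => expR (- (l * u)) * expR (l * pair_sum be s e)) <=
    expR (2 * l ^+ 2 * V - l * u).
  move=> be1; rewrite bern_meanZ addrC expRD ler_wpM2l ?expR_ge0 //.
  apply: le_trans (pair_sum_mgf us be1 l12) _.
  by rewrite ler_expR ler_wpM2l // mulr_ge0 // sqr_ge0.
have N1 p : `|- al p| <= 1 by rewrite normrN.
have := lerD (one _ al1) (one _ N1).
rewrite -mulr2n -[X in _ <= X -> _]mulr_natl; apply: le_trans.
rewrite -big_split /=; apply: ler_sum => e _; rewrite -mulrDr.
apply: ler_wpM2l; first exact: bern_weight_ge0.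
have NE : pair_sum (fun p => - al p) s e = - pair_sum al s e.
  by rewrite /pair_sum -sumrN; apply: eq_bigr => p _; rewrite mulNr.
rewrite NE -!expRD; case: ltP => /= [h|_]; last by rewrite addr_ge0 ?expR_ge0.
have [S0|S0] := leP 0 (pair_sum al s e).
  rewrite ger0_norm // in h.
  apply: (@le_trans _ _ (expR (- (l * u) + l * pair_sum al s e))); last by rewrite lerDl expR_ge0.
  rewrite -[leLHS]expR0 ler_expR addrC subr_ge0 ler_wpM2l //; exact: ltW.
rewrite ltr0_norm // in h.
apply: (@le_trans _ _ (expR (- (l * u) + l * - pair_sum al s e))); last by rewrite lerDr expR_ge0.
rewrite -[leLHS]expR0 ler_expR addrC subr_ge0 ler_wpM2l //; exact: ltW.
Qed.

End bernoulli_product.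

(** * Systems, van der Corput's inequality and transference *)

(** Positivity is required only for pointwise nonnegative functions, so no almost-everywhere
    statements occur inside the estimates. The instances are measure preserving systems, the
    one-point system and suspensions of systems. *)
Record system (R : realType) := System {
  point :> Type;
  adm : (point -> R) -> Prop;
  mean : (point -> R) -> R;
  sh : point -> point;
  adm_cst : forall c, adm (fun=> c);
  admD : forall F G, adm F -> adm G -> adm (fun x => F x + G x);
  admM : forall F G, adm F -> adm G -> adm (fun x => F x * G x);
  adm_sh : forall F, adm F -> adm (fun x => F (sh x));
  meanD : forall F G, adm F -> adm G ->
    mean (fun x => F x + G x) = mean F + mean G;
  meanZ : forall c F, adm F -> mean (fun x => c * F x) = c * mean F;
  mean_ge0 : forall F, adm F -> (forall x, 0 <= F x) -> 0 <= mean F;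
  mean_sh : forall F, adm F -> mean (fun x => F (sh x)) = mean F;
  mean_cst1 : mean (fun=> 1) = 1 }.

Definition koop (R : realType) (S : system R) (k : nat) (F : S -> R) (x : S) : R :=
  F (iter k (@sh R S) x).

Section system_theory.
Variables (R : realType) (S : system R).
Implicit Types F G : S -> R.

Local Notation adm := (@adm R S).
Local Notation mean := (@mean R S).
Local Notation U := (@koop R S).

Lemma adm_koop k F : adm F -> adm (U k F).
Proof.
elim: k F => [//|k IH] F aF.
have -> : U k.+1 F = U k (fun x => F (sh x)) by apply/funext => x; rewrite /koop iterS.
by apply: IH; exact: adm_sh.
Qed.

Lemma mean_koop k F : adm F -> mean (U k F) = mean F.
Proof.
elim: k F => [//|k IH] F aF.
have -> : U k.+1 F = U k (fun x => F (sh x)) by apply/funext => x; rewrite /koop iterS.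
by rewrite IH ?mean_sh //; exact: adm_sh.
Qed.

Lemma koopD j k F : U j (U k F) = U (k + j) F.
Proof. by apply/funext => x; rewrite /koop -iterD. Qed.

Lemma admN F : adm F -> adm (fun x => - F x).
Proof.
move=> aF; have -> : (fun x => - F x) = (fun x => (-1) * F x).
  by apply/funext => x; rewrite mulN1r.
by apply: admM => //; exact: adm_cst.
Qed.

Lemma admX F k : adm F -> adm (fun x => F x ^+ k).
Proof.
move=> aF; elim: k => [|k IH]; first exact: adm_cst.
have -> : (fun x => F x ^+ k.+1) = (fun x => F x * F x ^+ k).
  by apply/funext => x; rewrite exprS.
exact: admM.
Qed.

Lemma adm_sum (I : Type) (r : seq I) (P : pred I) (F : I -> S -> R) :
  (forall i, P i -> adm (F i)) -> adm (fun x => \sum_(i <- r | P i) F i x).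
Proof.
move=> aF; elim: r => [|i r IH].
  by under eq_fun do rewrite big_nil; exact: adm_cst.
case Pi: (P i); under eq_fun do rewrite big_cons Pi; last by [].
by apply: (admD _ IH); exact: aF.
Qed.

Lemma mean_cst c : mean (fun=> c) = c.
Proof.
have -> : (fun=> c) = (fun x : S => c * 1) by apply/funext => x; rewrite mulr1.
by rewrite meanZ ?mean_cst1 ?mulr1 //; exact: adm_cst.
Qed.

Lemma meanN F : adm F -> mean (fun x => - F x) = - mean F.
Proof.
move=> aF; have -> : (fun x => - F x) = (fun x => (-1) * F x).
  by apply/funext => x; rewrite mulN1r.
by rewrite meanZ // mulN1r.
Qed.

Lemma meanB F G : adm F -> adm G -> mean (fun x => F x - G x) = mean F - mean G.
Proof. by move=> aF aG; rewrite meanD ?meanN //; exact: admN. Qed.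

Lemma mean_sum (I : Type) (r : seq I) (P : pred I) (F : I -> S -> R) :
  (forall i, P i -> adm (F i)) ->
  mean (fun x => \sum_(i <- r | P i) F i x) = \sum_(i <- r | P i) mean (F i).
Proof.
move=> aF; elim: r => [|i r IH].
  by under eq_fun do rewrite big_nil; rewrite mean_cst big_nil.
rewrite big_cons; case Pi: (P i); under eq_fun do rewrite big_cons Pi; last by [].
by rewrite meanD ?IH //; [exact: aF|exact: adm_sum].
Qed.

Lemma le_mean F G : adm F -> adm G -> (forall x, F x <= G x) -> mean F <= mean G.
Proof.
move=> aF aG FG; rewrite -subr_ge0 -meanB //; apply: mean_ge0.
  by apply: admD => //; exact: admN.
by move=> x; rewrite subr_ge0.
Qed.

Lemma mean_le_cst F c : adm F -> (forall x, F x <= c) -> mean F <= c.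
Proof. by move=> aF Fc; rewrite -[leRHS]mean_cst; apply: le_mean => //; exact: adm_cst. Qed.

End system_theory.

Ltac admt := repeat (first
  [ assumption
  | lazymatch goal with
    | |- adm (koop _ _) => apply: adm_koop
    | |- adm (fun x => koop _ _ x) => apply: adm_koop
    | |- adm (fun x => (_ + _)%R) => apply: admD
    | |- adm (fun x => (_ * _)%R) => apply: admM
    | |- adm (fun x => (- _)%R) => apply: admN
    | |- adm (fun x => (_ ^+ _)%R) => apply: admX
    end
  | apply: adm_cst
  | (apply: adm_sum => ? ?) ]).

Section inequalities.
Variable R : realType.

Lemma sqr_sum_le (n : nat) (a : nat -> R) :
  (\sum_(i < n) a i) ^+ 2 <= n%:R * \sum_(i < n) a i ^+ 2.
Proof.
have : 0 <= \sum_(i < n) \sum_(j < n) (a i - a j) ^+ 2.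
  by apply: sumr_ge0 => i _; apply: sumr_ge0 => j _; exact: sqr_ge0.
have -> : \sum_(i < n) \sum_(j < n) (a i - a j) ^+ 2 =
    2 * (n%:R * (\sum_(i < n) a i ^+ 2) - (\sum_(i < n) a i) ^+ 2).
  transitivity (\sum_(i < n) (n%:R * a i ^+ 2 + \sum_(j < n) a j ^+ 2
                  - 2 * a i * \sum_(j < n) a j)).
    apply: eq_bigr => i _.
    rewrite mulr_sumr -sumrN -[n in n%:R]card_ord mulr_natl -sumr_const -!big_split /=.
    by apply: eq_bigr => j _; ring.
  rewrite !big_split /= sumr_const card_ord sumrN -mulr_suml -!mulr_sumr -mulr_natl.
  ring.
by lra.
Qed.

Lemma sqrD_le (x y : R) : (x + y) ^+ 2 <= 2 * x ^+ 2 + 2 * y ^+ 2.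
Proof.
rewrite -subr_ge0 (_ : _ - _ = (x - y) ^+ 2) ?sqr_ge0 //; ring.
Qed.

(** The first N terms of [x] moved to position [h] and extended by zero, so that differently shifted
    copies can be summed over one common range. *)
Definition window (N : nat) (x : nat -> R) (h m : nat) : R :=
  if (h <= m < h + N)%N then x (m - h)%N else 0.

Lemma sum_window N x h M : (h + N <= M)%N ->
  \sum_(m < M) window N x h m = \sum_(n < N) x n.
Proof.
move=> hM; rewrite -(big_mkord xpredT (window N x h)).
rewrite (big_cat_nat (leq0n (h + N)) hM) /= (big_cat_nat (leq0n h) (leq_addr N h)) /=.
rewrite big_nat big1 ?add0r; last first.
  by move=> i /andP[_ ih]; rewrite /window leqNgt ih.
rewrite [X in _ + X]big_nat [X in _ + X]big1 ?addr0; last first.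
  by move=> i /andP[ih _]; rewrite /window ltnNge ih andbF.
rewrite -{1}(add0n h) big_addn addKn big_mkord; apply: eq_bigr => i _.
by rewrite /window addnC leq_addr ltn_add2l ltn_ord addKn.
Qed.

Lemma window_corr N x h r M : (h + N <= M)%N ->
  \sum_(m < M) window N x h m * window N x (h + r)%N m =
  \sum_(n < N - r) x n * x (n + r)%N.
Proof.
move=> hM; have [rN|Nr] := leqP r N; last first.
  rewrite (eqP (ltnW Nr : (N - r == 0)%N)) big_ord0 big1 // => m _.
  rewrite /window; case: ifP => [/andP[_ m1]|_]; last by rewrite mul0r.
  case: ifP => [/andP[m2 _]|_]; last by rewrite mulr0.
  by exfalso; move: m1 m2 Nr; clear; lia.
rewrite -(@sum_window (N - r) (fun n => x n * x (n + r)%N) (h + r) M); last first.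
  by rewrite -addnA subnKC.
apply: eq_bigr => m _; rewrite /window.
have -> : (h + r + (N - r) = h + N)%N by lia.
case: (leqP (h + r) m) => [hrm|mhr] /=; last by rewrite mulr0.
have -> : (h <= m)%N by lia.
case: (ltnP m (h + N)) => [mh|_] /=; last by rewrite mul0r.
have -> : (m < h + r + N)%N by lia.
by rewrite mulrC; congr (x _ * x _); lia.
Qed.

End inequalities.

Section vdc.
Variables (R : realType) (S : system R).
Local Notation adm := (@adm R S).
Local Notation mean := (@mean R S).
Local Notation U := (@koop R S).

(* The shifts run over the multiples of [s] rather than over an initial segment. *)
Lemma van_der_corput (u : nat -> S -> R) (N H s : nat) (D B : R) :
  (0 < H)%N -> 0 <= B -> (forall n, adm (u n)) ->
  \sum_(n < N) mean (fun x => u n x ^+ 2) <= D ->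
  (forall r, (0 < r < H)%N ->
    `|\sum_(n < N - s * r) mean (fun x => u n x * u (n + s * r)%N x)| <= B) ->
  mean (fun x => (\sum_(n < N) u n x) ^+ 2) <= (N + s * H)%:R * (D / H%:R + B).
Proof.
move=> H0 B0 au uD uB; set M := (N + s * H)%N.
have H0' : 0 < H%:R :> R by rewrite ltr0n.
pose y h m x := window N (u^~ x) (s * h) m.
have ay h m : adm (y h m).
  by rewrite /y /window; case: (_ <= m < _)%N; admt; apply: au.
have hM h : (h < H)%N -> (s * h + N <= M)%N.
  by move=> hH; rewrite /M addnC leq_add2l leq_mul2l (ltnW hH) orbT.
(* All [H] shifted copies have the same sum; Cauchy-Schwarz over the [M] positions then leaves only
   correlations between copies. *)
have pw x : (H%:R * \sum_(n < N) u n x) ^+ 2 <=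
    M%:R * \sum_(m < M) (\sum_(h < H) y h m x) ^+ 2.
  have -> : H%:R * \sum_(n < N) u n x = \sum_(m < M) \sum_(h < H) y h m x.
    rewrite exchange_big /= -[H in H%:R]card_ord mulr_natl -sumr_const.
    by apply: eq_bigr => h _; rewrite sum_window // hM.
  exact: sqr_sum_le (fun m => \sum_(h < H) y h m x).
have corr h k : (h < H)%N -> (k < H)%N ->
    \sum_(m < M) mean (fun x => y h m x * y k m x) <= if h == k then D else B.
  move=> hH kH; rewrite -mean_sum; last by move=> m _; admt; apply: ay.
  have main h' k' : (h' < H)%N -> (k' < H)%N -> (h' < k')%N ->
     mean (fun x => \sum_(m < M) y h' m x * y k' m x) <= B.
    move=> h'H k'H hk; apply: le_trans (ler_norm _) _.
    apply: le_trans (uB (k' - h')%N _); last by rewrite subn_gt0 hk; lia.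
    rewrite -mean_sum; last by move=> n _; admt; apply: au.
    rewrite le_eqVlt; apply/orP; left; apply/eqP; congr (`|mean _|); apply/funext => x.
    rewrite -(@window_corr _ N (u^~ x) (s * h') _ M (hM _ h'H)).
    by apply: eq_bigr => m _; rewrite -mulnDr subnKC // ltnW.
  case: (ltngtP h k) => [hk|kh|->].
  - exact: main.
  - under eq_fun do under eq_bigr do rewrite mulrC.
    exact: main.
  - apply: le_trans uD; rewrite -mean_sum; last by move=> n _; admt; apply: au.
    rewrite le_eqVlt; apply/orP; left; apply/eqP; congr (mean _); apply/funext => x.
    have := @window_corr _ N (u^~ x) (s * k) 0 M (hM _ kH).
    rewrite addn0 subn0 => ->.
    by apply: eq_bigr => n _; rewrite addn0 expr2.
have : mean (fun x => (H%:R * \sum_(n < N) u n x) ^+ 2) <=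
       mean (fun x => M%:R * \sum_(m < M) (\sum_(h < H) y h m x) ^+ 2).
  by apply: le_mean => [||x]; [admt; apply: au|admt; apply: ay|exact: pw].
under eq_fun do rewrite exprMn.
rewrite [X in X <= _ -> _]meanZ; last by admt; apply: au.
rewrite [X in _ <= X -> _]meanZ; last by admt; apply: ay.
rewrite mean_sum; last by move=> m _; admt; apply: ay.
have -> : \sum_(m < M) mean (fun x => (\sum_(h < H) y h m x) ^+ 2) =
    \sum_(h < H) \sum_(k < H) \sum_(m < M) mean (fun x => y h m x * y k m x).
  rewrite [RHS](eq_bigr (fun h : 'I_H => \sum_(m < M) \sum_(k < H) mean (fun x => y h m x * y k m x))); last first.
    by move=> h _; rewrite exchange_big.
  rewrite exchange_big; apply: eq_bigr => m _ /=.
  transitivity (mean (fun x => \sum_(h < H) \sum_(k < H) y h m x * y k m x)).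
    congr (mean _); apply/funext => x; rewrite expr2 mulr_suml.
    by apply: eq_bigr => h _; rewrite mulr_sumr.
  rewrite mean_sum; last by move=> h _; admt; apply: ay.
  by apply: eq_bigr => h _; rewrite mean_sum // => k _; admt; apply: ay.
have : \sum_(h < H) \sum_(k < H) \sum_(m < M) mean (fun x => y h m x * y k m x) <=
       \sum_(h < H) (D + H%:R * B).
  apply: ler_sum => h _.
  apply: (@le_trans _ _ (\sum_(k < H) if h == k then D else B)).
    by apply: ler_sum => k _; exact: corr.
  rewrite (bigD1 h) //= eqxx lerD2l.
  apply: (@le_trans _ _ (\sum_(k < H | k != h) B)).
    by apply: ler_sum => k kh; rewrite eq_sym (negbTE kh).
  rewrite big_mkcond -[H in leRHS]card_ord mulr_natl -sumr_const.
  by apply: ler_sum => k _; case: ifP.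
rewrite sumr_const card_ord -[(_ + _) *+ _]mulr_natl => h1 h2.
have M0 : 0 <= M%:R :> R by [].
have := le_trans h2 (ler_wpM2l M0 h1).
have -> : M%:R * (H%:R * (D + H%:R * B)) = H%:R ^+ 2 * (M%:R * (D / H%:R + B)).
  by field; rewrite gt_eqF.
by rewrite ler_pM2l // exprn_gt0.
Qed.

(** Stated with given bounds [a] and [b] to avoid square roots: the pointwise inequality F G <=
    (b/2a) F^2 + (a/2b) G^2 is averaged. *)
Lemma cauchy_schwarz (F G : S -> R) (a b : R) : adm F -> adm G -> 0 < a -> 0 < b ->
  mean (fun x => F x ^+ 2) <= a ^+ 2 -> mean (fun x => G x ^+ 2) <= b ^+ 2 ->
  `|mean (fun x => F x * G x)| <= a * b.
Proof.
move=> aF aG a0 b0 Fa Gb.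
have one F' : adm F' -> mean (fun x => F' x ^+ 2) <= a ^+ 2 ->
    mean (fun x => F' x * G x) <= a * b.
  move=> aF' Fa'.
  have pw x : F' x * G x <= (b / a / 2) * F' x ^+ 2 + (a / b / 2) * G x ^+ 2.
    have : 0 <= (b / a / 2) * (F' x - a / b * G x) ^+ 2.
      by rewrite mulr_ge0 ?sqr_ge0 // divr_ge0 // divr_ge0 // ltW.
    have -> : (b / a / 2) * (F' x - a / b * G x) ^+ 2 =
       (b / a / 2) * F' x ^+ 2 + (a / b / 2) * G x ^+ 2 - F' x * G x.
      by field; rewrite !gt_eqF.
    by rewrite subr_ge0.
  apply: le_trans (le_mean _ _ pw) _; [by admt|by admt|].
  rewrite meanD ?meanZ; try by admt.
  have h1 : (b / a / 2) * mean (fun x => F' x ^+ 2) <= (b / a / 2) * a ^+ 2.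
    by rewrite ler_wpM2l // divr_ge0 // divr_ge0 // ltW.
  have h2 : (a / b / 2) * mean (fun x => G x ^+ 2) <= (a / b / 2) * b ^+ 2.
    by rewrite ler_wpM2l // divr_ge0 // divr_ge0 // ltW.
  apply: le_trans (lerD h1 h2) _.
  by rewrite le_eqVlt; apply/orP; left; apply/eqP; field; rewrite !gt_eqF.
rewrite ler_norml one // andbT lerNl -meanN; last by admt.
under eq_fun do rewrite -mulNr.
by apply: one; [admt|under eq_fun do rewrite sqrrN].
Qed.

Lemma mean_sqr_sum (I : nat) (F : nat -> S -> R) : (forall i, adm (F i)) ->
  mean (fun x => (\sum_(i < I) F i x) ^+ 2) <=
  I%:R * \sum_(i < I) mean (fun x => F i x ^+ 2).
Proof.
move=> aF; rewrite -mean_sum; last by move=> i _; admt; apply: aF.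
rewrite -meanZ; last by admt; apply: aF.
by apply: le_mean => [||x]; [admt; apply: aF|admt; apply: aF|exact: sqr_sum_le (F^~ x)].
Qed.

Lemma mean_sqrD (F G : S -> R) : adm F -> adm G ->
  mean (fun x => (F x + G x) ^+ 2) <=
  2 * mean (fun x => F x ^+ 2) + 2 * mean (fun x => G x ^+ 2).
Proof.
move=> aF aG; rewrite -!meanZ; try by admt.
rewrite -meanD; try by admt.
by apply: le_mean => [||x]; [admt|admt|exact: sqrD_le].
Qed.

(** By invariance the mean is an average over [m < D] of the same sum started at time [m], and along
    one orbit this is a convolution on a cyclic group. Order [D + D] prevents wrap-around, since
    [m < D] and [w n <= D]; having twice as many points as starting times costs the factor 2. *)
Lemma transference (G : S -> R) (D : nat) (z : R[i]) (s : seq nat) (c : nat -> R)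
    (w : nat -> nat) (B : R) :
  adm G -> (forall x, `|G x| <= 1) -> (0 < D)%N -> (D + D)%N.-primitive_root z ->
  (forall n, n \in s -> (w n <= D)%N) ->
  (forall t, (t < D + D)%N ->
     (\sum_(n <- s) c n * complex.Re (z ^+ (t * w n))) ^+ 2 +
     (\sum_(n <- s) c n * complex.Im (z ^+ (t * w n))) ^+ 2 <= B) ->
  mean (fun x => (\sum_(n <- s) c n * U (w n) G x) ^+ 2) <= 2 * B.
Proof.
move=> aG G1 D0 zP wD cB.
have D0' : 0 < D%:R :> R by rewrite ltr0n.
rewrite -(ler_pM2l D0').
have -> : D%:R * mean (fun x => (\sum_(n <- s) c n * U (w n) G x) ^+ 2) =
    mean (fun x => \sum_(m < D) (\sum_(n <- s) c n * U (m + w n) G x) ^+ 2).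
  rewrite mean_sum; last by move=> m _; admt.
  rewrite -[D in LHS]card_ord mulr_natl -sumr_const; apply: eq_bigr => m _.
  rewrite -(mean_koop m); last by admt.
  congr (mean _); apply/funext => x; rewrite /koop; congr (_ ^+ 2).
  by apply: eq_bigr => n _; rewrite -iterD addnC.
apply: mean_le_cst => [|x]; first by admt.
have B0 : 0 <= B.
  by apply: le_trans (cB 0 _); rewrite ?addr_ge0 ?sqr_ge0 // addn_gt0 D0.
apply: (@le_trans _ _ (\sum_(m < D + D)
   (\sum_(n <- s) c n * U ((m + w n) %% (D + D)) G x) ^+ 2)).
  rewrite big_split_ord /= ler_wpDr ?sumr_ge0 // => [m _|]; first exact: sqr_ge0.
  apply: ler_sum => m _; rewrite le_eqVlt; apply/orP; left; apply/eqP; congr (_ ^+ 2).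
  rewrite !big_seq; apply: eq_bigr => n ns; rewrite modn_small //.
  by have := ltn_ord m; have := wD _ ns; lia.
apply: le_trans (circulant_bound (fun k => U k G x) zP cB) _.
rewrite mulrA mulrC; apply: ler_wpM2r => //.
apply: (@le_trans _ _ (\sum_(m < D + D) 1)).
  apply: ler_sum => m _; rewrite -real_normK ?num_real // expr_le1 //; exact: G1.
by rewrite sumr_const card_ord natrD mulrDr mulr1.
Qed.

End vdc.

(** * Real powers and slowly growing sequences *)

Section powers.
Variable R : realType.
Implicit Types x y p q b c : R.

(** Concavity of the power without derivatives: this is Young's inequality for x^p times 1 with
    exponents 1/p and 1/(1-p). *)
Lemma powR_le_tangent1 p x : 0 < p < 1 -> 0 <= x -> x `^ p <= 1 + p * (x - 1).
Proof.
move=> /andP[p0 p1] x0.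
have q0 : 0 < (1 - p)^-1 by rewrite invr_gt0 subr_gt0.
have pV : 0 < p^-1 by rewrite invr_gt0.
have := @conjugate_powR R (x `^ p) 1 p^-1 (1 - p)^-1 (powR_ge0 _ _) ler01 pV q0.
rewrite !invrK addrC subrK => /(_ erefl); rewrite mulr1 powR1 -powRrM mulfV ?gt_eqF //.
by rewrite powRr1 // => /le_trans; apply; lra.
Qed.

Lemma powR_ge_tangent1 c x : 1 < c -> 0 <= x -> 1 + c * (x - 1) <= x `^ c.
Proof.
move=> c1 x0; have c0 : 0 < c by lra.
have h : 0 < c^-1 < 1 by rewrite invr_gt0 c0 invf_lt1.
have := powR_le_tangent1 h (powR_ge0 x c).
rewrite -powRrM mulfV ?gt_eqF // powRr1 // => {}h.
have := ler_wpM2l (ltW c0) h; rewrite mulrDr mulr1 mulrA divff ?gt_eqF // mul1r.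
lra.
Qed.

Lemma powR_le_tangent p x y : 0 < p < 1 -> 0 < x -> 0 <= y ->
  y `^ p <= x `^ p + p * x `^ (p - 1) * (y - x).
Proof.
move=> p01 x0 y0; have yx : 0 <= y / x by rewrite divr_ge0 // ltW.
have -> : y `^ p = x `^ p * (y / x) `^ p.
  by rewrite -powRM // ?(ltW x0) // mulrC divfK // gt_eqF.
have := ler_wpM2l (powR_ge0 x p) (powR_le_tangent1 p01 yx).
move/le_trans; apply; rewrite powRB; last by rewrite (gt_eqF x0) implybT.
rewrite powRr1 ?(ltW x0) // le_eqVlt; apply/orP; left; apply/eqP.
by field; rewrite gt_eqF.
Qed.

Lemma powR_ge_tangent c x y : 1 < c -> 0 < x -> 0 <= y ->
  x `^ c + c * x `^ (c - 1) * (y - x) <= y `^ c.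
Proof.
move=> c1 x0 y0; have yx : 0 <= y / x by rewrite divr_ge0 // ltW.
have -> : y `^ c = x `^ c * (y / x) `^ c.
  by rewrite -powRM // ?(ltW x0) // mulrC divfK // gt_eqF.
have := ler_wpM2l (powR_ge0 x c) (powR_ge_tangent1 c1 yx).
apply: le_trans; rewrite powRB; last by rewrite (gt_eqF x0) implybT.
rewrite powRr1 ?(ltW x0) // le_eqVlt; apply/orP; left; apply/eqP.
by field; rewrite gt_eqF.
Qed.

Lemma powRK p x : 0 < p -> 0 <= x -> (x `^ p) `^ p^-1 = x.
Proof. by move=> p0 x0; rewrite -powRrM mulfV ?gt_eqF // powRr1. Qed.

Lemma powRVK p x : 0 < p -> 0 <= x -> (x `^ p^-1) `^ p = x.
Proof. by move=> p0 x0; rewrite -powRrM mulVf ?gt_eqF // powRr1. Qed.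

Lemma powR_nat_unbounded p C : 0 < p ->
  exists n0 : nat, forall n, (n0 <= n)%N -> C <= n%:R `^ p.
Proof.
move=> p0; pose D := Num.max C 0 `^ p^-1; exists (Num.truncn D).+1 => n hn.
have Dn : D <= n%:R.
  by apply: ltW; apply: lt_le_trans (truncnS_gt D) _; rewrite ler_nat.
have C0 : 0 <= Num.max C 0 by rewrite le_max lexx orbT.
apply: (@le_trans _ _ (Num.max C 0)); first by rewrite le_max lexx.
rewrite -[leLHS](powRVK p0) //.
by apply: ge0_ler_powR; rewrite ?nnegrE ?powR_ge0 // ltW.
Qed.

Lemma powR_nat_small p e : 0 < p -> 0 < e ->
  exists n0 : nat, forall n, (n0 <= n)%N -> (0 < n)%N /\ n%:R `^ (- p) <= e.
Proof.
move=> p0 e0; have [n0 h] := powR_nat_unbounded e^-1 p0.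
exists n0.+1 => n hn; split; first by lia.
have := h n (ltnW hn); rewrite powRN => h'.
by rewrite -[leRHS]invrK lef_pV2 ?posrE ?invr_gt0 // ?(lt_le_trans _ h') ?invr_gt0.
Qed.

Definition natceil x : nat := `|Num.ceil x|%N.

Lemma natceil_le x (n : nat) : 0 <= x -> (natceil x <= n)%N = (x <= n%:R).
Proof.
move=> x0; have c0 : 0 <= Num.ceil x.
  by rewrite ceil_ge0; lra.
by rewrite -lez_nat /natceil gez0_abs // ceil_le_int.
Qed.

Lemma natceil_ge x : 0 <= x -> x <= (natceil x)%:R.
Proof. by move=> x0; rewrite -natceil_le. Qed.

Lemma natceil_lt x : 0 <= x -> (natceil x)%:R < x + 1.
Proof.
move=> x0; case E: (natceil x) => [|k]; first by rewrite ltr_pwDr.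
rewrite -natr1 ltrD2r ltNge -natceil_le // E ltnn //.
Qed.

End powers.

Section slow.
Variables (R : realType) (K b : R).
Hypotheses (K0 : 0 < K) (b0 : 0 < b) (b1 : b < 1).

Definition slow (n : nat) : nat := Num.truncn (K * n%:R `^ b).

(** [tau] inverts K x^b, and [slow] equals [j] exactly on the block from [t j] to [t j.+1]. Block
    lengths [d j] are, up to rounding, the increments [dt j] of the convex function [tau]. *)
Let tau (j : nat) : R := (j%:R / K) `^ b^-1.
Let t (j : nat) : nat := natceil (tau j).

Let tau_ge0 j : 0 <= tau j. Proof. exact: powR_ge0. Qed.

Lemma slow_ge n j : (j <= slow n)%N = (j%:R <= K * n%:R `^ b).
Proof.
rewrite /slow truncn_ge_nat //.
by rewrite mulr_ge0 ?powR_ge0 // ltW.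
Qed.

Let t_le j n : (t j <= n)%N = (j <= slow n)%N.
Proof.
rewrite natceil_le // slow_ge /tau.
have jK : 0 <= j%:R / K by rewrite divr_ge0 // ltW.
rewrite [K * _]mulrC -ler_pdivrMr //.
have bV : 0 < b^-1 by rewrite invr_gt0.
apply/idP/idP => h.
  rewrite -[leLHS](powRVK b0) //.
  by apply: ge0_ler_powR; rewrite ?nnegrE ?powR_ge0 // ltW.
rewrite -[leRHS](powRK b0) //.
by apply: ge0_ler_powR; rewrite ?nnegrE ?powR_ge0 // ltW.
Qed.

Lemma le_slow m n : (m <= n)%N -> (slow m <= slow n)%N.
Proof.
move=> mn; rewrite slow_ge; apply: (@le_trans _ _ (K * m%:R `^ b)).
  by rewrite -slow_ge.
rewrite ler_pM2l //; apply: ge0_ler_powR; rewrite ?nnegrE ?ler_nat //; exact: ltW.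
Qed.

Let le_t i j : (i <= j)%N -> (t i <= t j)%N.
Proof. by move=> ij; rewrite t_le (leq_trans ij) // -t_le. Qed.

Let slow_t j n : (t j <= n < t j.+1)%N -> slow n = j.
Proof. by rewrite t_le ltnNge t_le -ltnNge ltnS => /andP[? ?]; apply/eqP; rewrite eqn_leq; apply/andP. Qed.

Let t0 : t 0 = 0%N.
Proof. by apply/eqP; rewrite -leqn0 t_le. Qed.

Let d j : R := (t j.+1)%:R - (t j)%:R.
Let dt j : R := tau j.+1 - tau j.

Let dt_mono j : dt j <= dt j.+1.
Proof.
rewrite /dt; have bV : 1 < b^-1 by rewrite invf_gt1.
have x0 : 0 < j.+1%:R / K by rewrite divr_gt0.
have y0 n : 0 <= n%:R / K by rewrite divr_ge0 // ltW.
have := powR_ge_tangent bV x0 (y0 j); have := powR_ge_tangent bV x0 (y0 j.+2).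
rewrite -!mulrBl -!/(tau _).
have -> : j.+2%:R - j.+1%:R = 1 :> R by rewrite -[j.+2%:R]natr1 addrC addKr.
have -> : j%:R - j.+1%:R = -1 :> R by rewrite -[j.+1%:R]natr1; ring.
lra.
Qed.

(** Since [dt] increases, the right side telescopes and bounds the total variation of the block
    lengths; the 2 pays for the ceilings. *)
Let d_var j : `|d j.+1 - d j| <= dt j.+1 - dt j + 2.
Proof.
have := dt_mono j; rewrite /d /dt.
have := natceil_ge (tau_ge0 j); have := natceil_lt (tau_ge0 j).
have := natceil_ge (tau_ge0 j.+1); have := natceil_lt (tau_ge0 j.+1).
have := natceil_ge (tau_ge0 j.+2); have := natceil_lt (tau_ge0 j.+2).
rewrite -!/(t _) ler_norml; lra.
Qed.

Let d_le j : 0 <= d j <= dt j + 1.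
Proof.
rewrite /d /dt subr_ge0 ler_nat le_t //=.
have := natceil_ge (tau_ge0 j); have := natceil_lt (tau_ge0 j.+1).
rewrite -!/(t _); lra.
Qed.

Let sum_levels (a : nat -> R) J :
  \sum_(0 <= n < t J) a (slow n) = \sum_(j < J) d j * a j.
Proof.
elim: J => [|J IH]; first by rewrite t0 big_geq // big_ord0.
rewrite (big_cat_nat (leq0n _) (le_t (leqnSn J))) /= IH big_ord_recr /=; congr (_ + _).
transitivity (\sum_(t J <= i < t J.+1) a J).
  by rewrite [LHS]big_nat [RHS]big_nat; apply: eq_bigr => i /slow_t ->.
rewrite sumr_const_nat /d -natrB ?le_t // mulr_natl //.
Qed.

Let abel (a : nat -> R) J :
  \sum_(j < J.+1) d j * (a j.+1 - a j) =
  d J * a J.+1 - d 0%N * a 0%N - \sum_(j < J) a j.+1 * (d j.+1 - d j).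
Proof.
elim: J => [|J IH]; first by rewrite big_ord_recr !big_ord0 /=; ring.
by rewrite big_ord_recr /= IH [in RHS]big_ord_recr /=; ring.
Qed.

Let tel J : \sum_(j < J) (dt j.+1 - dt j + 2) = dt J - dt 0 + 2 * J%:R.
Proof.
elim: J => [|J IH]; first by rewrite big_ord0; ring.
by rewrite big_ord_recr /= IH -[in RHS]natr1; ring.
Qed.

Let dt0 j : 0 <= dt j.
Proof.
rewrite subr_ge0; apply: ge0_ler_powR; rewrite ?nnegrE ?divr_ge0 ?invr_ge0 //; try exact: ltW.
by rewrite ler_pM2r ?invr_gt0 // ler_nat.
Qed.

(** Grouping by blocks and summing by parts moves the difference from [a] to the block lengths,
    leaving boundary terms and their variation. All of this is of the order of one block plus the
    number of blocks. *)
Let shift_bound (a : nat -> R) N : (forall j, `|a j| <= 1) -> (0 < N)%N ->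
  `|\sum_(0 <= n < N) (a (slow n).+1 - a (slow n))| <=
  5 * dt (slow N) + 2 * (slow N)%:R + 5.
Proof.
move=> a1 N0; set J := slow N.
have tJ : (t J <= N)%N by rewrite t_le.
have NtJ : (N < t J.+1)%N by rewrite ltnNge t_le -/J ltnn.
have a2 m n : `|a m - a n| <= 2.
  by apply: le_trans (ler_normB _ _) _; have := a1 m; have := a1 n; lra.
rewrite (big_cat_nat (leq0n _) tJ) /=.
rewrite (sum_levels (fun j => a j.+1 - a j)).
apply: le_trans (ler_normD _ _) _.
have h2 : `|\sum_(t J <= n < N) (a (slow n).+1 - a (slow n))| <= 2 * (dt J + 1).
  apply: le_trans (ler_norm_sum _ _ _) _.
  apply: (@le_trans _ _ (\sum_(t J <= n < N) 2)); first by apply: ler_sum.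
  rewrite sumr_const_nat -[_ *+ (N - _)]mulr_natl mulrC ler_pM2l //.
  have /andP[_] := d_le J; apply: le_trans.
  by rewrite natrB // /d lerD2r ler_nat ltnW.
have h1 : `|\sum_(j < J) d j * (a j.+1 - a j)| <= 3 * dt J + 2 * J%:R + 2.
  case: J tJ NtJ h2 => [|J] tJ NtJ h2.
    by rewrite big_ord0 normr0; have := dt0 0; lra.
  rewrite abel; apply: le_trans (ler_normB _ _) _.
  have e1 : `|\sum_(j < J) a j.+1 * (d j.+1 - d j)| <= dt J - dt 0 + 2 * J%:R.
    rewrite -tel; apply: le_trans (ler_norm_sum _ _ _) _; apply: ler_sum => j _.
    rewrite normrM; apply: le_trans (d_var j).
    by rewrite -[leRHS]mul1r; apply: ler_wpM2r.
  have e2 : `|d J * a J.+1 - d 0 * a 0| <= (dt J + 1) + (dt 0 + 1).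
    apply: le_trans (ler_normB _ _) _; rewrite !normrM.
    have /andP[u0 u1] := d_le J; have /andP[v0 v1] := d_le 0.
    rewrite (ger0_norm u0) (ger0_norm v0); apply: lerD.
      by apply: le_trans u1; rewrite -[leRHS]mulr1; apply: ler_wpM2l.
    by apply: le_trans v1; rewrite -[leRHS]mulr1; apply: ler_wpM2l.
  have := dt_mono J; have := dt0 J; rewrite -natr1; lra.
lra.
Qed.

(** [tau] grows polynomially, so its relative increment is O(1/J): the last block is a negligible
    part of the range. *)
Let dt_small e : 0 < e -> exists J0, forall J, (J0 <= J)%N -> dt J <= e * tau J.
Proof.
move=> e0; have bV : 1 < b^-1 by rewrite invf_gt1.
pose q := b^-1; pose C := q * 2 `^ q.
exists (Num.truncn (C / e)).+1 => J hJ.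
have J0 : (0 < J)%N by lia.
have CJ : C <= e * J%:R.
  rewrite mulrC -ler_pdivrMr //; apply: ltW; apply: lt_le_trans (truncnS_gt _) _.
  by rewrite ler_nat.
have x0 : 0 < J.+1%:R / K by rewrite divr_gt0.
have y0 : 0 < J%:R / K by rewrite divr_gt0 // ltr0n.
have h := powR_ge_tangent bV x0 (ltW y0).
have {h} : dt J <= q * (J.+1%:R / K) `^ (q - 1) / K.
  move: h; rewrite -!/(tau _) /dt -/q -mulrBl.
  have -> : (J%:R - J.+1%:R) = -1 :> R by rewrite -[J.+1%:R]natr1; ring.
  rewrite mulN1r mulrN; lra.
move/le_trans; apply.
rewrite powRB; last by rewrite (gt_eqF x0) implybT.
rewrite powRr1 ?(ltW x0) //.
have -> : q * ((J.+1%:R / K) `^ q / (J.+1%:R / K)) / K = q * (J.+1%:R / K) `^ q / J.+1%:R.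
  have : J.+1%:R != 0 :> R by rewrite pnatr_eq0.
  move: (J.+1%:R : R) => X X0; have K0' := lt0r_neq0 K0.
  by field; rewrite X0 K0'.
have h2 : (J.+1%:R / K) `^ q <= 2 `^ q * tau J.
  rewrite /tau -/q -powRM //; last exact: ltW.
  apply: ge0_ler_powR; rewrite ?nnegrE.
  - by rewrite /q; lra.
  - exact: ltW.
  - by rewrite mulr_ge0 // ltW.
  - rewrite mulrA ler_pM2r ?invr_gt0 // -natrM ler_nat; lia.
rewrite ler_pdivrMr ?ltr0n //.
have q0 : 0 <= q by rewrite /q; lra.
apply: le_trans (ler_wpM2l q0 h2) _; rewrite mulrA -/C.
have -> : e * tau J * J.+1%:R = (e * J.+1%:R) * tau J by ring.
apply: ler_wpM2r => //; apply: le_trans CJ _.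
by rewrite ler_pM2l // ler_nat.
Qed.

Lemma slow_unbounded j : exists n0, forall n, (n0 <= n)%N -> (j <= slow n)%N.
Proof. by exists (t j) => n; rewrite t_le. Qed.

Lemma slow_shift1 e : 0 < e -> exists N0, forall N (a : nat -> R), (N0 <= N)%N ->
  (forall j, `|a j| <= 1) ->
  `|\sum_(n < N) (a (slow n).+1 - a (slow n))| <= e * N%:R.
Proof.
move=> e0.
have [J0 hJ] := @dt_small (e / 10) ltac:(lra).
have [N1 h1] := slow_unbounded J0.
have b1' : 0 < 1 - b by rewrite subr_gt0.
have [N2 h2] := powR_nat_unbounded (8 * K / e) b1'.
exists (N1 + N2 + (Num.truncn (20 / e)).+1)%N => N a hN a1.
have N0 : (0 < N)%N by lia.
have N0' : 0 < N%:R :> R by rewrite ltr0n.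
rewrite -(big_mkord xpredT (fun n => a (slow n).+1 - a (slow n))).
apply: le_trans (shift_bound a1 N0) _.
have e1 : dt (slow N) <= e / 10 * N%:R.
  apply: le_trans (hJ _ (h1 N _)) _; first by lia.
  rewrite ler_pM2l; last by lra.
  by apply: le_trans (natceil_ge (tau_ge0 _)) _; rewrite ler_nat t_le.
have e2 : (slow N)%:R <= e / 8 * N%:R.
  have : (slow N)%:R <= K * N%:R `^ b by rewrite -slow_ge.
  move/le_trans; apply.
  have E : N%:R `^ b * N%:R `^ (1 - b) = N%:R :> R.
    rewrite -powRD; last by rewrite (gt_eqF N0') implybT.
    by rewrite addrC subrK powRr1 // ltW.
  have /h2 h : (N2 <= N)%N by lia.
  have {}h : K <= e / 8 * N%:R `^ (1 - b).
    by move: h; rewrite ler_pdivrMr // => h; lra.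
  apply: le_trans (ler_wpM2r (powR_ge0 _ _) h) _.
  by rewrite le_eqVlt -[in X in _ == X]E; apply/orP; left; apply/eqP; ring.
have e3 : 5 <= e / 4 * N%:R.
  have : 20 / e <= N%:R.
    apply: ltW; apply: lt_le_trans (truncnS_gt _) _; rewrite ler_nat.
    by apply: leq_trans hN; rewrite leq_addl.
  by rewrite ler_pdivrMr // => h; lra.
lra.
Qed.

Lemma slow_shift V e : 0 < e -> exists N0, forall N (a : nat -> R), (N0 <= N)%N ->
  (forall j, `|a j| <= 1) ->
  `|\sum_(n < N) (a (slow n + V)%N - a (slow n))| <= e * N%:R.
Proof.
move=> e0; have V0 : 0 < V.+1%:R :> R by [].
have [N0 h] := slow_shift1 (divr_gt0 e0 V0).
exists N0 => N a hN a1.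
suff gen v : `|\sum_(n < N) (a (slow n + v)%N - a (slow n))| <= v%:R * (e / V.+1%:R * N%:R).
  apply: le_trans (gen V) _; rewrite mulrA; apply: ler_wpM2r => //.
  rewrite mulrCA -[leRHS]mulr1 ler_pM2l // ler_pdivrMr // mul1r ler_nat; lia.
elim: v => [|v IH].
  by rewrite mul0r big1 ?normr0 // => n _; rewrite addn0 subrr.
rewrite -natr1 mulrDl mul1r [leRHS]addrC.
apply: le_trans (lerD (h N (fun j => a (j + v)%N) hN (fun j => a1 _)) IH).
apply: le_trans (ler_normD _ _); rewrite le_eqVlt; apply/orP; left; apply/eqP.
congr (`|_|); rewrite -big_split /=; apply: eq_bigr => n _.
by rewrite addSn addnS; ring.
Qed.

(** Values along the slow sequence may be replaced by averages over [V] consecutive arguments. The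
    threshold does not depend on [a]; this allows [a] to be read off the orbit of an arbitrary point
    in [const_corr]. *)
Lemma slow_average V e : 0 < e -> (0 < V)%N ->
  exists N0, forall N (a : nat -> R), (N0 <= N)%N -> (forall j, `|a j| <= 1) ->
  `|\sum_(n < N) a (slow n) - \sum_(n < N) V%:R^-1 * \sum_(v < V) a (slow n + v)%N|
    <= e * N%:R.
Proof.
move=> e0 V0; have V0' : 0 < V%:R :> R by rewrite ltr0n.
have [N0 hN0] : exists N0, forall v, (v < V)%N -> forall N (a : nat -> R), (N0 <= N)%N ->
    (forall j, `|a j| <= 1) ->
    `|\sum_(n < N) (a (slow n + v)%N - a (slow n))| <= e * N%:R.
  elim: V {V0 V0'} => [|V [N0 h]]; first by exists 0%N.
  have [N1 h1] := slow_shift V e0; exists (N0 + N1)%N => v; rewrite ltnS leq_eqVlt.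
  by case/orP => [/eqP ->|vV] N a hN; [apply: h1|apply: h]; lia.
exists N0 => N a hN a1.
rewrite -mulr_sumr exchange_big /=.
set A := \sum_(n < N) _; set B := \sum_(v < V) _.
have -> : A - V%:R^-1 * B = V%:R^-1 * (V%:R * A - B) by field; rewrite gt_eqF.
rewrite normrM gtr0_norm ?invr_gt0 // ler_pdivrMl // {}/A {}/B.
rewrite -[V in V%:R * \sum_(_ < N) _]card_ord mulr_natl -sumr_const -sumrB.
apply: le_trans (ler_norm_sum _ _ _) _.
rewrite -[V in leRHS]card_ord mulr_natl -sumr_const; apply: ler_sum => v _.
by rewrite -normrN opprB -sumrB; apply: hN0.
Qed.

End slow.

(** * Correlations along a sparse sequence *)

Section averages.
Variable R : realType.

Lemma average_le (K : nat) (a : nat -> R) (c : R) : 0 <= c ->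
  (forall k, (k < K)%N -> `|a k| <= c) -> `|K%:R^-1 * \sum_(k < K) a k| <= c.
Proof.
move=> c0 ac; case: K ac => [|K] ac; first by rewrite invr0 mul0r normr0.
rewrite normrM ger0_norm ?invr_ge0 // ler_pdivrMl //.
apply: le_trans (ler_norm_sum _ _ _) _.
rewrite -[K.+1 in leRHS]card_ord mulr_natl -sumr_const.
by apply: ler_sum => k _; exact: ac.
Qed.

Lemma sum_shift_le (a : nat -> R) (V L : nat) : (forall n, `|a n| <= 1) ->
  `|\sum_(v < V) (a v - a (v + L)%N)| <= 2 * L%:R.
Proof.
move=> a1; suff -> : \sum_(v < V) (a v - a (v + L)%N) = \sum_(l < L) (a l - a (V + l)%N).
  apply: le_trans (ler_norm_sum _ _ _) _.
  rewrite mulrC -[L in leRHS]card_ord mulr_natl -sumr_const; apply: ler_sum => l _.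
  by apply: le_trans (ler_normB _ _) _; have := a1 l; have := a1 (V + l)%N; lra.
rewrite !sumrB; apply/eqP; rewrite subr_eq addrAC -subr_eq opprK; apply/eqP.
transitivity (\sum_(i < V + L) a i); first by rewrite big_split_ord.
rewrite addnC big_split_ord; congr (_ + _); apply: eq_bigr => i _ /=.
by rewrite addnC.
Qed.

Lemma sum_eventually_small (a : nat -> R) (C e : R) : 0 < e ->
  (forall n, `|a n| <= C) -> (exists n0, forall n, (n0 <= n)%N -> `|a n| <= e) ->
  exists N0, forall N, (N0 <= N)%N -> `|\sum_(n < N) a n| <= 2 * e * N%:R.
Proof.
move=> e0 aC [n0 an0]; exists (n0 + (Num.truncn (n0%:R * C / e)).+1)%N => N hN.
have h1 : n0%:R * C <= e * N%:R.
  rewrite mulrC [e * _]mulrC -ler_pdivrMr // mulrC; apply: ltW.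
  apply: lt_le_trans (truncnS_gt _) _; rewrite ler_nat.
  by apply: leq_trans hN; rewrite leq_addl.
have n0N : (n0 <= N)%N by apply: leq_trans hN; rewrite leq_addr.
rewrite -(big_mkord xpredT a) (big_cat_nat (leq0n n0) n0N) /=.
apply: le_trans (ler_normD _ _) _; rewrite (_ : 2 * e * N%:R = e * N%:R + e * N%:R); last by ring.
apply: lerD.
  apply: le_trans h1; apply: le_trans (ler_norm_sum _ _ _) _.
  rewrite big_mkord -[n0 in leRHS]card_ord mulr_natl -sumr_const.
  by apply: ler_sum => n _.
apply: le_trans (ler_norm_sum _ _ _) _.
apply: (@le_trans _ _ (\sum_(n0 <= n < N) e)).
  by rewrite big_nat [leRHS]big_nat; apply: ler_sum => n /andP[? _]; exact: an0.
rewrite sumr_const_nat -[e *+ _]mulr_natl mulrC ler_pM2l // ler_nat leq_subr //.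
Qed.

End averages.

Section system_bounds.
Variables (R : realType) (S : system R).
Local Notation adm := (@adm R S).
Local Notation mean := (@mean R S).
Local Notation U := (@koop R S).

Lemma norm_mean_le (F : S -> R) (c : R) : adm F -> (forall x, `|F x| <= c) -> `|mean F| <= c.
Proof.
move=> aF Fc; rewrite ler_norml lerNl -meanN //.
by apply/andP; split; (apply: mean_le_cst => [|x];
  [by admt|have := Fc x; rewrite ler_norml; lra]).
Qed.

Lemma mean_sqr_le (F : S -> R) (c : R) : adm F -> (forall x, `|F x| <= c) ->
  mean (fun x => F x ^+ 2) <= c ^+ 2.
Proof.
move=> aF Fc; apply: mean_le_cst => [|x]; first by admt.
by rewrite -real_normK ?num_real // lerXn2r ?nnegrE //; exact: le_trans (Fc x).
Qed.

Lemma mean_prod_le (F G : S -> R) (c b : R) : adm F -> adm G -> 0 < c -> 0 < b ->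
  (forall x, `|F x| <= c) -> mean (fun x => G x ^+ 2) <= b ^+ 2 ->
  `|mean (fun x => F x * G x)| <= c * b.
Proof. by move=> aF aG c0 b0 Fc Gb; apply: cauchy_schwarz => //; exact: mean_sqr_le. Qed.

Lemma mean_koop_prod k (F G : S -> R) : adm F -> adm G ->
  mean (fun x => U k F x * U k G x) = mean (fun x => F x * G x).
Proof. by move=> aF aG; apply: (mean_koop k (F := fun x => F x * G x)); admt. Qed.

Lemma mean_koop_sqr k (F : S -> R) : adm F ->
  mean (fun x => U k F x ^+ 2) = mean (fun x => F x ^+ 2).
Proof. by move=> aF; apply: (mean_koop k (F := fun x => F x ^+ 2)); admt. Qed.

Lemma mean_average_sqr (K : nat) (F : nat -> S -> R) (b : R) :
  0 <= b -> (forall k, adm (F k)) ->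
  (forall k, (k < K)%N -> mean (fun x => F k x ^+ 2) <= b) ->
  mean (fun x => (K%:R^-1 * \sum_(k < K) F k x) ^+ 2) <= b.
Proof.
move=> b0 aF Fb; under eq_fun do rewrite exprMn.
rewrite meanZ; last by admt; apply: aF.
case: K Fb => [|K] Fb; first by rewrite invr0 expr0n mul0r.
apply: (@le_trans _ _ (K.+1%:R^-1 ^+ 2 * (K.+1%:R * \sum_(k < K.+1) b))).
  apply: ler_wpM2l; first exact: sqr_ge0.
  apply: le_trans (mean_sqr_sum _ aF) _; apply: ler_wpM2l => //.
  by apply: ler_sum => k _; exact: Fb.
rewrite sumr_const card_ord -[b *+ _]mulr_natl le_eqVlt; apply/orP; left; apply/eqP.
have : K.+1%:R != 0 :> R by rewrite pnatr_eq0.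
by move: (K.+1%:R : R) => X X0; field.
Qed.

End system_bounds.

(** * Two applications of van der Corput's inequality in a tower *)

Section key.
Variables (R : realType) (S : system R).
Local Notation adm := (@adm R S).
Local Notation mean := (@mean R S).
Local Notation U := (@koop R S).
(** To be read with [S] a tower of height [Q] whose [Q]-th shift is the original map, [v n] the
    floor of Q lam n^(1+b) and [j n] its rounded derivative. [g_cont] expresses that [g] is constant
    on the fibres of the tower, so that short shifts rarely change it. *)
Variables (Q : nat) (v j : nat -> nat) (g : S -> R).
Hypothesis Q0 : (0 < Q)%N.
Hypothesis v_ge : forall n, (Q * n <= v n)%N.
Hypothesis v_incr : forall r, exists n0, forall n, (n0 <= n)%N ->
  (v n + r * j n <= v (n + r) <= v n + r * j n + r.+1)%N.
Hypothesis j_incr : forall s, exists n0, forall n, (n0 <= n)%N ->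
  (j n <= j (n + s) <= (j n).+1)%N.
Hypothesis j_large : forall J, exists n0, forall n, (n0 <= n)%N -> (J <= j n)%N.
Hypothesis j_slow : forall V (e : R), 0 < e -> (0 < V)%N ->
  exists N0, forall N (a : nat -> R), (N0 <= N)%N -> (forall i, `|a i| <= 1) ->
  `|\sum_(n < N) a (j n) - \sum_(n < N) V%:R^-1 * \sum_(k < V) a (j n + k)%N|
    <= e * N%:R.
Hypothesis ag : adm g.
Hypothesis g1 : forall x, `|g x| <= 1.
Hypothesis g_cont : forall e, mean (fun x => (U e g x - g x) ^+ 2) <= 4 * e%:R / Q%:R.

Let Q0' : 0 < Q%:R :> R. Proof. by rewrite ltr0n. Qed.

(** The power left on [g] after invariance has cancelled the shift by [Q * n] on [f]; by [v_ge] the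
    subtraction is exact. *)
Let w n := (v n - Q * n)%N.

Lemma norm_prod_le (F G : S -> R) : (forall x, `|F x| <= 1) -> (forall x, `|G x| <= 1) ->
  forall x, `|F x * G x| <= 1.
Proof. by move=> F1 G1 x; rewrite normrM -[leRHS]mulr1; apply: ler_pM. Qed.

Let U1 k x : `|U k g x| <= 1. Proof. exact: g1. Qed.

Definition self_corr k (x : S) : R := g x * U k g x.

Lemma adm_self_corr k : adm (self_corr k). Proof. by rewrite /self_corr; admt. Qed.

Lemma self_corr_le k x : `|self_corr k x| <= 1.
Proof. exact: norm_prod_le g1 (U1 k) x. Qed.

(** On the tower this is the Birkhoff average along the original map. *)
Definition conv (M : nat) (h : S -> R) (x : S) : R := M%:R^-1 * \sum_(m < M) U (Q * m) h x.

Lemma adm_conv M h : adm h -> adm (conv M h).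
Proof. by move=> ah; rewrite /conv; admt. Qed.

Lemma conv_le M h (c : R) : 0 <= c -> (forall x, `|h x| <= c) -> forall x, `|conv M h x| <= c.
Proof. by move=> c0 hc x; rewrite /conv; apply: (average_le (a := fun m => U (Q * m) h x)) => // m _; exact: hc. Qed.

Lemma conv_sqr M h : adm h -> mean (fun x => conv M h x ^+ 2) <= mean (fun x => h x ^+ 2).
Proof.
move=> ah; apply: (mean_average_sqr (F := fun m => U (Q * m) h)).
- by apply: mean_ge0 => [|x]; [admt|exact: sqr_ge0].
- by move=> m; admt.
- by move=> m _; rewrite mean_koop_sqr.
Qed.

(* What remains of the autocorrelation once its long averages are removed. *)
Definition fluct M k (x : S) : R := self_corr k x - conv M (self_corr k) x.

Lemma adm_fluct M k : adm (fluct M k).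
Proof. by rewrite /fluct; have := adm_self_corr k => h; have := adm_conv M h => h'; admt. Qed.

Lemma fluct_le M k x : `|fluct M k x| <= 2.
Proof.
apply: le_trans (ler_normB _ _) _.
by have := self_corr_le k x; have := conv_le M ler01 (self_corr_le k) x; lra.
Qed.

Lemma koop_cont i e : mean (fun x => (U (i + e) g x - U i g x) ^+ 2) <= 4 * e%:R / Q%:R.
Proof.
apply: le_trans (g_cont e); rewrite -[leRHS](mean_koop_sqr i); last by admt.
rewrite le_eqVlt; apply/orP; left; apply/eqP; congr (mean _); apply/funext => x.
by rewrite /koop (addnC i e) iterD.
Qed.

(** Continuity in the shift and in the lag, both from [g_cont]. Splitting the product gives 8 (2e +
    d) / Q for [self_corr]; subtracting its [conv], which contracts square means, multiplies this by
    4. *)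
Lemma fluct_diff M k e d :
  mean (fun x => (U e (fluct M (k + d)) x - fluct M k x) ^+ 2) <=
  32 * (e + e + d)%:R / Q%:R.
Proof.
pose h x := U e (self_corr (k + d)) x - self_corr k x.
have ah : adm h by rewrite /h; have := adm_self_corr => ?; admt => //.
have -> : (fun x => (U e (fluct M (k + d)) x - fluct M k x) ^+ 2) =
          (fun x => (h x + - conv M h x) ^+ 2).
  apply/funext => x; congr (_ ^+ 2); rewrite /h /fluct /conv.
  have -> : \sum_(m < M) U (Q * m) (fun x0 => U e (self_corr (k + d)) x0 - self_corr k x0) x =
     \sum_(m < M) U (Q * m) (self_corr (k + d)) (iter e (@sh R S) x) - \sum_(m < M) U (Q * m) (self_corr k) x.
    rewrite -sumrB; apply: eq_bigr => m _; rewrite /koop; congr (_ - _).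
    by rewrite -!iterD (addnC e).
  rewrite /koop; ring.
have aN : adm (fun x => - conv M h x) by have := adm_conv M ah => ?; admt.
apply: le_trans (mean_sqrD ah aN) _.
under [X in _ + 2 * mean X]eq_fun do rewrite sqrrN.
have hh : mean (fun x => h x ^+ 2) <= 8 * (e + e + d)%:R / Q%:R.
  have -> : (fun x => h x ^+ 2) =
     (fun x => ((U e g x - g x) * U (e + (k + d)) g x + g x * (U (k + (e + d)) g x - U k g x)) ^+ 2).
    apply/funext => x; congr (_ ^+ 2); rewrite /h /self_corr /koop.
    have -> : iter (e + (k + d)) (@sh R S) x = iter (k + d) (@sh R S) (iter e (@sh R S) x).
      by rewrite -iterD addnC.
    have -> : iter (k + (e + d)) (@sh R S) x = iter (k + d) (@sh R S) (iter e (@sh R S) x).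
      by rewrite -iterD; congr (iter _ _ _); lia.
    ring.
  apply: le_trans (mean_sqrD _ _) _; [by admt|by admt|].
  have sq (F G : S -> R) : adm F -> adm G -> (forall x, `|G x| <= 1) ->
      mean (fun x => (F x * G x) ^+ 2) <= mean (fun x => F x ^+ 2).
    move=> aF aG G1; apply: le_mean => [||x]; [by admt|by admt|].
    rewrite exprMn -[leRHS]mulr1; apply: ler_wpM2l; first exact: sqr_ge0.
    by rewrite -real_normK ?num_real // expr_le1.
  have s1 := sq (fun x => U e g x - g x) (U (e + (k + d)) g) ltac:(admt) ltac:(admt) (U1 _).
  have s2 := sq (fun x => U (k + (e + d)) g x - U k g x) g ltac:(admt) ag g1.
  have c1 := g_cont e; have c2 := koop_cont k (e + d).
  under [X in _ + 2 * mean X]eq_fun do rewrite mulrC.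
  have l1 := le_trans s1 c1; have l2 := le_trans s2 c2.
  apply: le_trans (lerD (ler_wpM2l _ l1) (ler_wpM2l _ l2)) _ => //.
  rewrite !natrD le_eqVlt; apply/orP; left; apply/eqP; field; exact: lt0r_neq0.
have := conv_sqr M ah; lra.
Qed.

(** As [s] divides [Q], [conv] shifts by multiples of [s], so averaging along multiples of [s]
    cancels everything except the two ends. *)
Lemma fluct_average M k (s V : nat) x : (s %| Q)%N -> (0 < M)%N -> (0 < V)%N ->
  `|V%:R^-1 * \sum_(i < V) U (s * i) (fluct M k) x| <=
  2 * (Q %/ s * M)%:R / V%:R.
Proof.
move=> sQ M0 V0; have V0' : 0 < V%:R :> R by rewrite ltr0n.
rewrite normrM ger0_norm ?invr_ge0 // mulrC ler_pM2r ?invr_gt0 //.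
pose a n := U (s * n) (self_corr k) x.
have a1 n : `|a n| <= 1 by exact: self_corr_le.
have -> : \sum_(i < V) U (s * i) (fluct M k) x =
    \sum_(i < V) (M%:R^-1 * \sum_(m < M) (a i - a (i + Q %/ s * m)%N)).
  apply: eq_bigr => i _.
  rewrite sumrB sumr_const card_ord mulrBr -[a i *+ M]mulr_natl mulKf; last first.
    by rewrite pnatr_eq0 -lt0n.
  rewrite {1}/koop /fluct /conv; congr (_ - _ * _); apply: eq_bigr => m _.
  have E : (s * (i + Q %/ s * m) = s * i + Q * m)%N.
    by rewrite mulnDr mulnA (mulnC s (Q %/ s)%N) divnK.
  by rewrite /a E /koop -iterD addnC.
rewrite -mulr_sumr exchange_big /=.
apply: (average_le (a := fun m => \sum_(i < V) (a i - a (i + Q %/ s * m)%N))) => [|m mM].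
  by rewrite mulr_ge0.
apply: le_trans (sum_shift_le _ _ a1) _.
by rewrite ler_pM2l // ler_nat leq_mul2l (ltnW mM) orbT.
Qed.


Lemma eventually_forall (H : nat) (P : nat -> nat -> Prop) :
  (forall h, (h < H)%N -> exists N0, forall N, (N0 <= N)%N -> P h N) ->
  exists N0, forall N, (N0 <= N)%N -> forall h, (h < H)%N -> P h N.
Proof.
elim: H => [|H IH] PH; first by exists 0%N.
have [|N1 h1] := IH; first by move=> h hH; apply: PH; exact: ltnW.
have [N2 h2] := PH H (ltnSn H).
exists (N1 + N2)%N => N hN h; rewrite ltnS leq_eqVlt => /orP[/eqP ->|hH].
  by apply: h2; apply: leq_trans hN; rewrite leq_addl.
by apply: h1 => //; apply: leq_trans hN; rewrite leq_addr.
Qed.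

Let w_incr r : exists n0, forall n, (n0 <= n)%N ->
  exists2 e, (e <= r.+1)%N & w (n + r) = (w n + r * (j n - Q) + e)%N /\ (Q <= j n)%N.
Proof.
have [n1 h1] := v_incr r; have [n2 h2] := j_large Q.
exists (n1 + n2)%N => n hn; have /h1/andP[l u] : (n1 <= n)%N by lia.
have /h2 Qj : (n2 <= n)%N by lia.
exists (v (n + r) - (v n + r * j n))%N; first by lia.
split=> //; rewrite /w; have := v_ge n.
have -> : (r * j n = r * (j n - Q) + r * Q)%N by rewrite -mulnDr subnK.
move: l; have -> : (r * j n = r * (j n - Q) + r * Q)%N by rewrite -mulnDr subnK.
rewrite mulnDr (mulnC r Q); move: (r * _)%N (Q * r)%N (Q * n)%N => A B C; lia.
Qed.

Section fluct_sum.
Variables (M M' r sg H : nat) (e : R).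
Hypotheses (M0 : (0 < M)%N) (M'0 : (0 < M')%N) (sg0 : (0 < sg)%N) (H0 : (0 < H)%N).
Hypotheses (e0 : 0 < e).
Hypothesis hM : M%:R <= e * M'%:R.
Hypothesis hsg : 32 * (r * M')%:R <= e ^+ 2 * sg%:R.
Hypothesis hH : 1 <= e * H%:R.
Hypothesis sgQ : forall s, (0 < s < H)%N -> (sg * s %| Q)%N.
Hypothesis hQ : 32 * (2 * (sg * H).+1 + r)%:R <= e ^+ 2 * Q%:R.

(** The model for the correlation of the terms [n] and [n + s] when [j n = i]: the rounding in [w]
    and the change of [j] are dropped. The subtraction is exact once [j n] has passed [Q]. *)
Let Psi s i := mean (fun x => fluct M (r * i) x * U (s * (i - Q)) (fluct M (r * i)) x).

Let Psi_le s i : `|Psi s i| <= 4.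
Proof.
have aG := adm_fluct M (r * i); apply: norm_mean_le => [|x]; first by admt.
rewrite normrM (_ : 4 = 2 * 2); last by ring.
by apply: ler_pM => //; exact: fluct_le.
Qed.

Let fluct_close k d f : (2 * f + d <= 2 * (sg * H).+1 + r)%N ->
  mean (fun x => (U f (fluct M (k + d)) x - fluct M k x) ^+ 2) <= e ^+ 2.
Proof.
move=> hd; apply: le_trans (fluct_diff _ _ _ _) _.
rewrite ler_pdivrMr //; apply: le_trans hQ.
by rewrite ler_pM2l // ler_nat; lia.
Qed.

(** The neglected shift is at most [s.+1] and the neglected change of lag at most [r]; by [hQ] both
    are tiny compared with [Q]. *)
Let corr_close s : (s < sg * H)%N -> exists n0, forall n, (n0 <= n)%N ->
  `|mean (fun x => U (w n) (fluct M (r * j n)) x *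
                   U (w (n + s)) (fluct M (r * j (n + s))) x) - Psi s (j n)| <= 2 * e.
Proof.
move=> hs; have [n1 h1] := w_incr s; have [n2 h2] := j_incr s.
exists (n1 + n2)%N => n hn.
have [f fs [wE Qj]] := h1 n ltac:(lia); have /andP[j1 j2] := h2 n ltac:(lia).
have aG k := adm_fluct M k.
have [d dr jE] : exists2 d, (d <= r)%N & (r * j (n + s) = r * j n + d)%N.
  exists (r * (j (n + s) - j n))%N; last by rewrite -mulnDr subnKC.
  by rewrite -[leqRHS]muln1 leq_mul2l; apply/orP; right; lia.
pose D x := U f (fluct M (r * j n + d)) x - fluct M (r * j n) x.
have aD : adm D by rewrite /D; admt.
have -> : mean (fun x => U (w n) (fluct M (r * j n)) x *
                   U (w (n + s)) (fluct M (r * j (n + s))) x) - Psi s (j n) =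
    mean (fun x => fluct M (r * j n) x * U (s * (j n - Q)) D x).
  rewrite /Psi wE jE -addnA (addnC (w n)) -koopD mean_koop_prod; try by admt.
  rewrite -meanB; try by admt.
  congr (mean _); apply/funext => x; rewrite /D /koop -iterD (addnC f).
  by rewrite [RHS]mulrBr.
apply: mean_prod_le => //; [by admt|by move=> x; exact: fluct_le|].
rewrite mean_koop_sqr //; apply: fluct_close; lia.
Qed.

(** As [i] runs over [V] values the shift runs through multiples of [s], and with the lag frozen
    [fluct_average] gives 2M/M', small by [hM]. Freezing costs a lag change of at most r V = r M' Q
    / s, small against [Q] because [s >= sg]; this is why the shifts are multiples of a large
    [sg]. *)
Let Psi_avg s V i : s = (sg * (s %/ sg))%N -> (0 < s %/ sg < H)%N -> V = (Q %/ s * M')%N ->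
  (Q <= i)%N -> `|V%:R^-1 * \sum_(k < V) Psi s (i + k)%N| <= 8 * e.
Proof.
move=> sE /[dup] hs' /andP[s'0 _] VE Qi.
have sQ : (s %| Q)%N by rewrite sE; exact: sgQ.
have s0 : (0 < s)%N by rewrite sE muln_gt0 sg0.
have q0 : (0 < Q %/ s)%N by rewrite divn_gt0 // dvdn_leq.
have V0 : (0 < V)%N by rewrite VE muln_gt0 q0.
have V0' : 0 < V%:R :> R by rewrite ltr0n.
have aG k := adm_fluct M k.
pose Phi k := mean (fun x => fluct M (r * i) x * U (s * (i - Q) + s * k) (fluct M (r * i)) x).
have close k : (k < V)%N -> mean (fun x => (fluct M (r * (i + k)) x - fluct M (r * i) x) ^+ 2) <= e ^+ 2.
  move=> kV; have := fluct_diff M (r * i) 0 (r * k).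
  rewrite /= add0n -mulnDr => /le_trans; apply.
  rewrite ler_pdivrMr //.
  have h : (s * (r * k) <= r * M' * Q)%N.
    rewrite mulnCA -mulnA leq_mul2l; apply/orP; right.
    apply: (@leq_trans (s * V)); first by rewrite leq_mul2l (ltnW kV) orbT.
    by rewrite VE mulnA (mulnC s) divnK // mulnC.
  have sR : sg%:R <= s%:R :> R by rewrite ler_nat sE leq_pmulr.
  have s0' : 0 < s%:R :> R by rewrite ltr0n.
  rewrite -(ler_pM2l s0') mulrCA -natrM.
  apply: (@le_trans _ _ (32 * (r * M' * Q)%:R)); first by rewrite ler_pM2l // ler_nat.
  rewrite natrM mulrA; apply: (@le_trans _ _ (e ^+ 2 * sg%:R * Q%:R)).
    by rewrite ler_pM2r.
  rewrite [leRHS]mulrA ler_pM2r // mulrC ler_pM2r // exprn_gt0 //.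
have PP k : (k < V)%N -> `|Psi s (i + k) - Phi k| <= 4 * e.
  move=> kV; pose A := fluct M (r * i); pose A' := fluct M (r * (i + k)).
  pose L := (s * (i - Q) + s * k)%N.
  have aA : adm A by exact: aG. have aA' : adm A' by exact: aG.
  have -> : Psi s (i + k) - Phi k =
      mean (fun x => U L A' x * (A' x - A x)) + mean (fun x => A x * U L (fun y => A' y - A y) x).
    rewrite /Psi /Phi -/A -/A'.
    have -> : (s * (i + k - Q) = L)%N by rewrite /L -mulnDr addnBAC.
    rewrite -/L -meanB; try by admt.
    rewrite -meanD; try by admt.
    by congr (mean _); apply/funext => x; rewrite /koop; ring.
  apply: le_trans (ler_normD _ _) _.
  have cl := close k kV.
  have b1 : `|mean (fun x => U L A' x * (A' x - A x))| <= 2 * e.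
    apply: mean_prod_le => //; [by admt|by admt|by move=> x; exact: fluct_le].
  have b2 : `|mean (fun x => A x * U L (fun y => A' y - A y) x)| <= 2 * e.
    apply: mean_prod_le => //; [by admt|by move=> x; exact: fluct_le|].
    by rewrite (mean_koop_sqr L (F := fun y => A' y - A y)) //; admt.
  lra.
have -> : V%:R^-1 * \sum_(k < V) Psi s (i + k) =
    V%:R^-1 * \sum_(k < V) (Psi s (i + k) - Phi k) + V%:R^-1 * \sum_(k < V) Phi k.
  by rewrite -mulrDr -big_split /=; congr (_ * _); apply: eq_bigr => k _; rewrite subrK.
apply: le_trans (ler_normD _ _) _.
have t1 : `|V%:R^-1 * \sum_(k < V) (Psi s (i + k) - Phi k)| <= 4 * e.
  by apply: (average_le (a := fun k => Psi s (i + k) - Phi k)) => //; rewrite mulr_ge0 // ltW.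
have t2 : `|V%:R^-1 * \sum_(k < V) Phi k| <= 4 * e.
  have -> : V%:R^-1 * \sum_(k < V) Phi k = mean (fun x => fluct M (r * i) x *
      U (s * (i - Q)) (fun y => V%:R^-1 * \sum_(k < V) U (s * k) (fluct M (r * i)) y) x).
    rewrite /Phi -mean_sum; last by move=> k _; admt.
    rewrite -meanZ; last by admt.
    congr (mean _); apply/funext => x; rewrite {2}/koop mulrCA; congr (_ * _).
    rewrite mulr_sumr; apply: eq_bigr => k _; congr (_ * _).
    by rewrite /koop -iterD addnC.
  apply: norm_mean_le => [|x]; first by admt.
  rewrite normrM (_ : 4 * e = 2 * (2 * e)); last by ring.
  apply: ler_pM => //; first exact: fluct_le.
  apply: le_trans (fluct_average _ _ _ _ _) _ => //.
  rewrite -mulrA ler_pM2l // ler_pdivrMr // VE !natrM mulrCA ler_pM2l ?ltr0n //.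
lra.
Qed.

Lemma fluct_sum : exists N0, forall N, (N0 <= N)%N ->
  mean (fun x => (\sum_(n < N) U (w n) (fluct M (r * j n)) x) ^+ 2) <= 56 * e * N%:R ^+ 2.
Proof.
have aG k := adm_fluct M k.
pose c s n := mean (fun x => U (w n) (fluct M (r * j n)) x *
                   U (w (n + s)) (fluct M (r * j (n + s))) x).
have c_le s n : `|c s n| <= 4.
  apply: norm_mean_le => [|x]; first by admt.
  by rewrite normrM (_ : 4 = 2 * 2); [apply: ler_pM => //; exact: fluct_le|ring].
(* 24 = 4 + 4 + 16: passing to the model, averaging over [V] values of the slow sequence, and the
   averaged model. *)
have main s : (0 < s < H)%N -> exists N0, forall N, (N0 <= N)%N ->
    `|\sum_(n < N) c (sg * s) n| <= 24 * e * N%:R.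
  move=> /[dup] hs /andP[s0 sH]; set t := (sg * s)%N.
  have tE : (t %/ sg = s)%N by rewrite /t mulKn.
  pose V := (Q %/ t * M')%N.
  have V0 : (0 < V)%N.
    by rewrite muln_gt0 M'0 andbT divn_gt0 ?muln_gt0 ?sg0 // dvdn_leq // sgQ.
  have t_lt : (t < sg * H)%N by rewrite ltn_mul2l sg0.
  have [N1 h1] : exists N0, forall N, (N0 <= N)%N ->
      `|\sum_(n < N) (c t n - Psi t (j n))| <= 2 * (2 * e) * N%:R.
    apply: (@sum_eventually_small _ (fun n => c t n - Psi t (j n)) 8); first by rewrite mulr_gt0.
      move=> n; apply: le_trans (ler_normB _ _) _.
      by have := c_le t n; have := Psi_le t (j n); lra.
    exact: corr_close.
  have [N2 h2] := @j_slow V e e0 V0.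
  have [N3 h3] : exists N0, forall N, (N0 <= N)%N ->
      `|\sum_(n < N) V%:R^-1 * \sum_(k < V) Psi t (j n + k)%N| <= 2 * (8 * e) * N%:R.
    apply: (@sum_eventually_small _ (fun n => V%:R^-1 * \sum_(k < V) Psi t (j n + k)%N) 4).
    - by rewrite mulr_gt0.
    - by move=> n; apply: (average_le (a := fun k => Psi t (j n + k)%N)).
    have [n0 hn0] := j_large Q; exists n0 => n /hn0 Qj.
    by apply: Psi_avg => //; rewrite tE.
  exists (N1 + N2 + N3)%N => N hN.
  have := h1 N ltac:(lia); have := h3 N ltac:(lia).
  have P4 i : `|Psi t i / 4| <= 1.
    by rewrite normrM [X in _ * X]ger0_norm ?invr_ge0 // ler_pdivrMr // mul1r.
  have := h2 N (fun i => Psi t i / 4) ltac:(lia) P4.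
  under [X in `|_ - X| <= _ -> _]eq_bigr do rewrite -mulr_suml mulrA.
  rewrite -!mulr_suml -mulrBl normrM [X in _ * X <= _ -> _]ger0_norm ?invr_ge0 //.
  rewrite ler_pdivrMr // sumrB.
  move: (\sum_(n < N) c t n) (\sum_(n < N) Psi t (j n)) (\sum_(n < N) _) => A B C.
  rewrite !ler_norml; lra.
have [N0 hN0] : exists N0, forall N, (N0 <= N)%N -> forall s, (s < H)%N -> (0 < s)%N ->
    `|\sum_(n < N) c (sg * s) n| <= 24 * e * N%:R.
  apply: eventually_forall => s sH; case: (posnP s) => [->|s0]; first by exists 0%N.
  by have [|N0 h] := main s; [rewrite s0|exists N0 => N hN _; exact: h].
exists (N0 + sg * H)%N => N hN.
pose u n := U (w n) (fluct M (r * j n)).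
have au n : adm (u n) by rewrite /u; admt.
apply: le_trans (@van_der_corput _ S u N H sg (4 * N%:R) (24 * e * N%:R) H0 _ au _ _) _.
- by rewrite !mulr_ge0 // ltW.
- rewrite -[N in leRHS]card_ord mulr_natr -sumr_const; apply: ler_sum => n _.
  rewrite (_ : 4 = 2 ^+ 2); last by ring.
  by apply: mean_sqr_le => // x; exact: fluct_le.
- move=> s /andP[s0 sH].
  apply: le_trans (hN0 (N - sg * s)%N _ s sH s0) _.
    rewrite leq_subRL; last by apply: leq_trans hN; apply: leq_trans (leq_addl _ _); rewrite leq_mul2l (ltnW sH) orbT.
    by rewrite addnC; apply: leq_trans hN; rewrite leq_add2l leq_mul2l (ltnW sH) orbT.
  by rewrite ler_wpM2l ?mulr_ge0 ?(ltW e0) // ler_nat leq_subr.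
have sHN : (sg * H)%:R <= N%:R :> R by rewrite ler_nat; apply: leq_trans hN; rewrite leq_addl.
have H0' : 0 < H%:R :> R by rewrite ltr0n.
have iH : 4 * N%:R / H%:R <= 4 * e * N%:R.
  rewrite ler_pdivrMr //; have := ler_wpM2l (ler0n R (4 * N)) hH; rewrite natrM; lra.
apply: (@le_trans _ _ ((2 * N%:R) * (28 * e * N%:R))); last first.
  by rewrite le_eqVlt; apply/orP; left; apply/eqP; ring.
apply: ler_pM => //; last by lra.
- by rewrite addr_ge0 // ?divr_ge0 ?mulr_ge0 // ltW.
- rewrite natrD; lra.
Qed.

End fluct_sum.

(** Almost invariance of [F] makes the outer shift [w n] harmless. What remains pairs F g with [g]
    shifted by [r * j n]; [j_slow] replaces the latter by averages of [g] along multiples of [r],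
    which are small by assumption. *)
Lemma const_corr (F : S -> R) (r K : nat) (e : R) : (0 < K)%N -> 0 < e ->
  adm F -> (forall x, `|F x| <= 1) ->
  (forall k, mean (fun x => (U k F x - F x) ^+ 2) <= e ^+ 2) ->
  mean (fun x => (K%:R^-1 * \sum_(k < K) U (r * k) g x) ^+ 2) <= e ^+ 2 ->
  exists N0, forall N, (N0 <= N)%N ->
    `|\sum_(n < N) mean (fun x => F x * U (w n) (self_corr (r * j n)) x)| <= 3 * e * N%:R.
Proof.
move=> K0 e0 aF F1 Finv gK.
have [N0 hN0] := j_slow e0 K0; exists N0 => N hN.
have aC k := adm_self_corr k.
pose A x := K%:R^-1 * \sum_(k < K) U (r * k) g x.
have aA : adm A by rewrite /A; admt.
have one n : `|mean (fun x => F x * U (w n) (self_corr (r * j n)) x) -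
    mean (fun x => F x * self_corr (r * j n) x)| <= e.
  rewrite distrC -(mean_koop_prod (w n)) // -meanB; try by admt.
  have -> : (fun x => U (w n) F x * U (w n) (self_corr (r * j n)) x -
             F x * U (w n) (self_corr (r * j n)) x) =
            (fun x => U (w n) (self_corr (r * j n)) x * (U (w n) F x - F x)).
    by apply/funext => x; ring.
  rewrite -[leRHS]mul1r; apply: mean_prod_le => //; [by admt|by admt|].
  by move=> x; exact: self_corr_le.
have two n : `|mean (fun x => (F x * g x) * U (r * j n) A x)| <= e.
  rewrite -[leRHS]mul1r; apply: mean_prod_le => //; [by admt|by admt| |].
    exact: norm_prod_le.
  by rewrite mean_koop_sqr.
have three : `|mean (fun x => (F x * g x) * (\sum_(n < N) U (r * j n) g x -
     \sum_(n < N) U (r * j n) A x))| <= e * N%:R.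
  apply: norm_mean_le => [|x]; first by admt.
  rewrite normrM -[leRHS]mul1r; apply: ler_pM => //; first exact: norm_prod_le.
  have := hN0 N (fun i => U (r * i) g x) hN (fun i => U1 _ _).
  rewrite /A /koop; under [X in `|_ - X| <= _ -> _]eq_bigr do under eq_bigr do rewrite mulnDr addnC iterD.
  by [].
have -> : \sum_(n < N) mean (fun x => F x * U (w n) (self_corr (r * j n)) x) =
    \sum_(n < N) (mean (fun x => F x * U (w n) (self_corr (r * j n)) x) -
         mean (fun x => F x * self_corr (r * j n) x)) +
    \sum_(n < N) mean (fun x => (F x * g x) * U (r * j n) A x) +
    mean (fun x => (F x * g x) * (\sum_(n < N) U (r * j n) g x -
     \sum_(n < N) U (r * j n) A x)).
  rewrite -addrA sumrB -[LHS]addr0 -addrA; congr (_ + _).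
  apply/esym/eqP; rewrite addrC subr_eq0; apply/eqP.
  rewrite -[X in X + _]mean_sum; last by move=> n _; admt.
  rewrite -[RHS]mean_sum; last by move=> n _; admt.
  rewrite -meanD; [|by admt|by admt].
  congr (mean _); apply/funext => x.
  rewrite -mulr_sumr -mulrDr addrC subrK mulr_sumr; apply: eq_bigr => n _.
  by rewrite /self_corr mulrA.
apply: le_trans (ler_normD _ _) _.
have s1 : `|\sum_(n < N) (mean (fun x => F x * U (w n) (self_corr (r * j n)) x) -
         mean (fun x => F x * self_corr (r * j n) x))| <= e * N%:R.
  apply: le_trans (ler_norm_sum _ _ _) _.
  by rewrite -[N in leRHS]card_ord mulr_natr -sumr_const; apply: ler_sum.
have s2 : `|\sum_(n < N) mean (fun x => (F x * g x) * U (r * j n) A x)| <= e * N%:R.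
  apply: le_trans (ler_norm_sum _ _ _) _.
  by rewrite -[N in leRHS]card_ord mulr_natr -sumr_const; apply: ler_sum.
have := ler_normD (\sum_(n < N) (mean (fun x => F x * U (w n) (self_corr (r * j n)) x) -
         mean (fun x => F x * self_corr (r * j n) x)))
  (\sum_(n < N) mean (fun x => (F x * g x) * U (r * j n) A x)).
lra.
Qed.

(* Without invertibility the average is moved from the second factor to the
   first one by composing both with a further power of the shift. *)
Lemma coboundary_corr (F h : S -> R) (M n : nat) (e : R) : (0 < M)%N -> 0 < e ->
  adm F -> adm h -> (forall x, `|h x| <= 1) ->
  mean (fun x => conv M F x ^+ 2) <= e ^+ 2 ->
  `|mean (fun x => F x * U n (conv M h) x)| <= e.
Proof.
move=> M0 e0 aF ah h1 Fe.
have aC : adm (conv M F) by exact: adm_conv.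
have aC' : adm (conv M h) by exact: adm_conv.
have -> : mean (fun x => F x * U n (conv M h) x) =
    mean (fun x => U (n + Q * M.-1) h x * conv M F x).
  transitivity (M%:R^-1 * \sum_(m < M) mean (fun x => F x * U (n + Q * m) h x)).
    rewrite -mean_sum; last by move=> m _; admt.
    rewrite -meanZ; last by admt.
    congr (mean _); apply/funext => x; rewrite /conv {1}/koop mulrCA mulr_sumr.
    congr (_ * _); apply: eq_bigr => m _; congr (_ * _).
    by rewrite /koop -iterD addnC.
  transitivity (M%:R^-1 * \sum_(m < M) mean (fun x => U (n + Q * M.-1) h x * U (Q * m) F x)).
    congr (_ * _); rewrite (reindex_inj rev_ord_inj); apply: eq_bigr => m _ /=.
    rewrite -(mean_koop_prod (Q * m)) //; last by admt.
    congr (mean _); apply/funext => x; rewrite mulrC; congr (_ * _).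
    rewrite koopD; congr (U _ h x); rewrite -addnA -mulnDr; congr (_ + _ * _)%N.
    by have := ltn_ord m; lia.
  rewrite -mean_sum; last by move=> m _; admt.
  rewrite -meanZ; last by admt.
  congr (mean _); apply/funext => x; rewrite /conv [RHS]mulrCA; congr (_ * _).
  by rewrite mulr_sumr.
rewrite -[leRHS]mul1r; apply: mean_prod_le => //; first by admt.
by move=> x; exact: h1.
Qed.

Section assemble.
(** [Fc r] stands for the conditional expectation of [f] times its [Q * r]-shift on the invariant
    functions: it is almost invariant, and the difference has small long averages. *)
Variables (f : S -> R) (Fc : nat -> S -> R) (M M' sg H H1 : nat) (K : nat -> nat) (e : R).
Hypotheses (M0 : (0 < M)%N) (M'0 : (0 < M')%N) (sg0 : (0 < sg)%N) (H0 : (0 < H)%N).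
Hypotheses (e0 : 0 < e) (H10 : (0 < H1)%N) (K0 : forall r, (0 < K r)%N).
Hypotheses (af : adm f) (f1 : forall x, `|f x| <= 1).
Hypotheses (aFc : forall r, adm (Fc r)) (Fc1 : forall r x, `|Fc r x| <= 1).
Hypothesis Fc_inv : forall r k, (0 < r < H1)%N ->
  mean (fun x => (U k (Fc r) x - Fc r x) ^+ 2) <= e ^+ 2.
Hypothesis Fc_conv : forall r, (0 < r < H1)%N ->
  mean (fun x => conv M (fun y => f y * U (Q * r) f y - Fc r y) x ^+ 2) <= e ^+ 2.
Hypothesis gK : forall r, (0 < r < H1)%N ->
  mean (fun x => ((K r)%:R^-1 * \sum_(k < K r) U (r * k) g x) ^+ 2) <= e ^+ 2.
Hypothesis hM : M%:R <= e ^+ 2 * M'%:R.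
Hypothesis hsg : 32 * (H1 * M')%:R <= (e ^+ 2) ^+ 2 * sg%:R.
Hypothesis hH : 1 <= e ^+ 2 * H%:R.
Hypothesis hH1 : 1 <= e * H1%:R.
Hypothesis sgQ : forall s, (0 < s < H)%N -> (sg * s %| Q)%N.
Hypothesis hQ : 32 * (2 * (sg * H).+1 + H1)%:R <= (e ^+ 2) ^+ 2 * Q%:R.
Hypothesis hQ1 : 4 * H1.+1%:R <= e ^+ 2 * Q%:R.

Let F r x := f x * U (Q * r) f x.

Let aF r : adm (F r). Proof. by rewrite /F; admt. Qed.

Let F1 r x : `|F r x| <= 1. Proof. by apply: norm_prod_le => y; exact: f1. Qed.

(** Split the first factor into [Fc r] and a remainder, and for the remainder split the
    autocorrelation into its average and [fluct]. The three terms fall to [const_corr],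
    [coboundary_corr] and [fluct_sum]. The last is used with error [e ^+ 2] because Cauchy-Schwarz
    takes a square root; 20 = 3 + 1 + 16. *)
Let corr_main r : (0 < r < H1)%N -> exists N0, forall N, (N0 <= N)%N ->
  `|\sum_(n < N) mean (fun x => F r x * U (w n) (self_corr (r * j n)) x)| <= 20 * e * N%:R.
Proof.
move=> /[dup] hr /andP[r0 rH].
have e20 : 0 < e ^+ 2 by rewrite exprn_gt0.
have [N1 h1] := const_corr (K0 r) e0 (aFc r) (Fc1 r) (fun k => Fc_inv k hr) (gK hr).
have [||N2 h2] := @fluct_sum M M' r sg H (e ^+ 2) M0 M'0 sg0 H0 e20 hM _ hH sgQ _.
- by apply: le_trans hsg; rewrite ler_pM2l // ler_nat leq_mul2r (ltnW rH) orbT.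
- by apply: le_trans hQ; rewrite ler_pM2l // ler_nat leq_add2l ltnW.
exists (N1 + N2).+1 => N hN.
have N0' : 0 < N%:R :> R by rewrite ltr0n; apply: leq_trans hN.
have := h1 N ltac:(clear - hN; lia); have {h2} := h2 N ltac:(clear - hN; lia) => h2 {}h1.
pose F' x := F r x - Fc r x.
have aF' : adm F' by have := aF r => ?; have := aFc r => ?; rewrite /F'; admt.
have F'2 x : `|F' x| <= 2.
  by apply: le_trans (ler_normB _ _) _; have := F1 r x; have := Fc1 r x; lra.
have aC k := adm_self_corr k.
have aG k := adm_fluct M k.
have aV k : adm (conv M (self_corr k)) by exact: adm_conv.
have -> : \sum_(n < N) mean (fun x => F r x * U (w n) (self_corr (r * j n)) x) =
   \sum_(n < N) mean (fun x => Fc r x * U (w n) (self_corr (r * j n)) x) +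
   \sum_(n < N) mean (fun x => F' x * U (w n) (conv M (self_corr (r * j n))) x) +
   mean (fun x => F' x * \sum_(n < N) U (w n) (fluct M (r * j n)) x).
  have -> : mean (fun x => F' x * \sum_(n < N) U (w n) (fluct M (r * j n)) x) =
      \sum_(n < N) mean (fun x => F' x * U (w n) (fluct M (r * j n)) x).
    rewrite -mean_sum; last by move=> n _; admt.
    by congr (mean _); apply/funext => x; rewrite mulr_sumr.
  rewrite -!big_split /=; apply: eq_bigr => n _.
  have := aFc r => aFcr; have := aF r => aFr.
  rewrite -!meanD; try by admt.
  congr (mean _); apply/funext => x; rewrite /F' /fluct /koop; ring.
have t2 : `|\sum_(n < N) mean (fun x => F' x * U (w n) (conv M (self_corr (r * j n))) x)| <= e * N%:R.
  apply: le_trans (ler_norm_sum _ _ _) _.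
  rewrite -[N in leRHS]card_ord mulr_natr -sumr_const; apply: ler_sum => n _.
  apply: coboundary_corr => //; first by move=> x; exact: self_corr_le.
  exact: Fc_conv.
have t3 : `|mean (fun x => F' x * \sum_(n < N) U (w n) (fluct M (r * j n)) x)| <= 2 * (8 * e * N%:R).
  apply: mean_prod_le => //; [by admt|by rewrite !mulr_gt0|].
  apply: le_trans h2 _; rewrite !exprMn; apply: ler_wpM2r; first exact: sqr_ge0.
  by apply: ler_wpM2r; [exact: sqr_ge0|lra].
have := ler_normD (\sum_(n < N) mean (fun x => Fc r x * U (w n) (self_corr (r * j n)) x))
   (\sum_(n < N) mean (fun x => F' x * U (w n) (conv M (self_corr (r * j n))) x)).
move=> t4; apply: le_trans (ler_normD _ _) _.
lra.
Qed.

(** The outer van der Corput step. Cancelling the shift by [Q * n] turns the correlation at distance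
    [r] into the one of [corr_main], except for a lag error of at most [r.+1], which [koop_cont] and
    [hQ1] absorb. *)
Lemma fast_average : exists N0, forall N, (N0 <= N)%N ->
  mean (fun x => (\sum_(n < N) U (Q * n) f x * U (v n) g x) ^+ 2) <= 46 * e * N%:R ^+ 2.
Proof.
pose u n x := U (Q * n) f x * U (v n) g x.
have au n : adm (u n) by rewrite /u; admt.
have u1 n x : `|u n x| <= 1.
  by apply: norm_prod_le => y; [exact: f1|exact: g1].
pose c r n := mean (fun x => u n x * u (n + r)%N x).
have aC k := adm_self_corr k.
have main r : (0 < r < H1)%N -> exists N0, forall N, (N0 <= N)%N ->
    `|\sum_(n < N) c r n| <= 22 * e * N%:R.
  move=> /[dup] hr /andP[r0 rH]; have aFr := aF r.
  pose c' n := mean (fun x => F r x * U (w n) (self_corr (r * j n)) x).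
  have [N1 h1] := corr_main hr.
  have [N2 h2] : exists N0, forall N, (N0 <= N)%N ->
      `|\sum_(n < N) (c r n - c' n)| <= 2 * e * N%:R.
    apply: (@sum_eventually_small _ (fun n => c r n - c' n) 2) => //.
      move=> n; apply: le_trans (ler_normB _ _) _.
      have : `|c r n| <= 1 by apply: norm_mean_le => [|x]; [admt|exact: norm_prod_le].
      have : `|c' n| <= 1.
        apply: norm_mean_le => [|x]; first by admt.
        by apply: norm_prod_le => y; [exact: F1|exact: self_corr_le].
      lra.
    have [n0 hn0] := v_incr r; exists n0 => n /hn0 /andP[l l'].
    have [d dr vE] : exists2 d, (d <= r.+1)%N & v (n + r) = (v n + (r * j n + d))%N.
      by exists (v (n + r) - (v n + r * j n))%N; move: l l'; clear; lia.
    have wE : v n = (w n + Q * n)%N by rewrite /w subnK.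
    pose D x := U (r * j n + d) g x - U (r * j n) g x.
    have aD : adm D by rewrite /D; admt.
    have -> : c r n - c' n = mean (fun x => (F r x * U (w n) g x) * U (w n) D x).
      have -> : c r n = mean (fun x => F r x * U (w n) (fun y => g y * U (r * j n + d) g y) x).
        rewrite -(mean_koop_prod (Q * n)); [|by []|by admt].
        congr (mean _); apply/funext => x; rewrite /u /F /koop -!iterD.
        rewrite -wE (addnC _ (v n)) -vE -mulnDr (addnC r); ring.
      rewrite -meanB; [|by admt|by admt].
      by congr (mean _); apply/funext => x; rewrite /D /self_corr /koop; ring.
    rewrite -[leRHS]mul1r; apply: mean_prod_le => //; [by admt|by admt| |].
      by apply: norm_prod_le => y; [exact: F1|exact: g1].
    rewrite mean_koop_sqr //; apply: le_trans (koop_cont _ _) _.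
    rewrite ler_pdivrMr //; apply: le_trans hQ1; rewrite ler_pM2l // ler_nat; move: dr rH; clear; lia.
  exists (N1 + N2)%N => N hN.
  have := h1 N ltac:(clear - hN; lia); have := h2 N ltac:(clear - hN; lia); rewrite sumrB -/(c' _).
  move: (\sum_(n < N) c r n) (\sum_(n < N) _) => A B.
  rewrite !ler_norml; lra.
have [N0 hN0] : exists N0, forall N, (N0 <= N)%N -> forall r, (r < H1)%N -> (0 < r)%N ->
    `|\sum_(n < N) c r n| <= 22 * e * N%:R.
  apply: eventually_forall => r rH; case: (posnP r) => [->|r0]; first by exists 0%N.
  by have [|N0 h] := main r; [rewrite r0|exists N0 => N hN _; exact: h].
exists (N0 + H1)%N => N hN.
apply: le_trans (@van_der_corput _ S u N H1 1 N%:R (22 * e * N%:R) H10 _ au _ _) _.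
- by rewrite !mulr_ge0 // ltW.
- rewrite -[N in leRHS]card_ord -sumr_const; apply: ler_sum => n _.
  by rewrite -[leRHS](expr1n _ 2); apply: mean_sqr_le => // x.
- move=> r /andP[r0 rH]; rewrite mul1n.
  apply: le_trans (hN0 (N - r)%N _ r rH r0) _; first by move: hN rH; clear; lia.
  by rewrite ler_wpM2l ?mulr_ge0 ?(ltW e0) // ler_nat leq_subr.
have H1N : H1%:R <= N%:R :> R by rewrite ler_nat; apply: leq_trans hN; rewrite leq_addl.
have H10' : 0 < H1%:R :> R by rewrite ltr0n.
have iH : N%:R / H1%:R <= e * N%:R.
  by rewrite ler_pdivrMr //; have := ler_wpM2l (ler0n R N) hH1; lra.
apply: (@le_trans _ _ ((2 * N%:R) * (23 * e * N%:R))); last first.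
  by rewrite le_eqVlt; apply/orP; left; apply/eqP; ring.
apply: ler_pM => //; last by lra.
- by rewrite addr_ge0 // ?divr_ge0 ?mulr_ge0 // ltW.
- rewrite mul1n natrD; lra.
Qed.

End assemble.

End key.

(** * Birkhoff averages and suspensions *)

Section mean_ergodic.
Variables (R : realType) (S : system R).
Local Notation adm := (@adm R S).
Local Notation mean := (@mean R S).
Local Notation U := (@koop R S).
Implicit Types F : S -> R.

Definition birkhoff (M : nat) F (x : S) : R := M%:R^-1 * \sum_(m < M) U m F x.

Lemma adm_birkhoff M F : adm F -> adm (birkhoff M F).
Proof. by move=> aF; rewrite /birkhoff; admt. Qed.

Lemma birkhoff_le M F (c : R) : 0 <= c -> (forall x, `|F x| <= c) ->
  forall x, `|birkhoff M F x| <= c.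
Proof.
by move=> c0 Fc x; apply: (average_le (a := fun m => U m F x)) => // m _; exact: Fc.
Qed.

Lemma birkhoff_sqr M F : adm F ->
  mean (fun x => birkhoff M F x ^+ 2) <= mean (fun x => F x ^+ 2).
Proof.
move=> aF; apply: (mean_average_sqr (F := fun m => U m F)).
- by apply: mean_ge0 => [|x]; [admt|exact: sqr_ge0].
- by move=> m; admt.
- by move=> m _; rewrite mean_koop_sqr.
Qed.

Lemma birkhoff_koop L k F x : (0 < L)%N -> (forall x, `|F x| <= 1) ->
  `|birkhoff L (U k F) x - birkhoff L F x| <= 2 * k%:R / L%:R.
Proof.
move=> L0 F1; have L0' : 0 < L%:R :> R by rewrite ltr0n.
rewrite distrC /birkhoff -mulrBr -sumrB normrM ger0_norm ?invr_ge0 // mulrC.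
rewrite ler_pM2r ?invr_gt0 //.
have := @sum_shift_le _ (fun n => U n F x) L k (fun n => F1 _).
by congr (`|_| <= _); apply: eq_bigr => i _; rewrite koopD addnC.
Qed.

Lemma birkhoff_birkhoff L M F x : (0 < L)%N -> (0 < M)%N -> (forall x, `|F x| <= 1) ->
  `|birkhoff L (birkhoff M F) x - birkhoff L F x| <= 2 * M%:R / L%:R.
Proof.
move=> L0 M0 F1.
have -> : birkhoff L (birkhoff M F) x - birkhoff L F x =
    M%:R^-1 * \sum_(m < M) (birkhoff L (U m F) x - birkhoff L F x).
  rewrite sumrB sumr_const card_ord mulrBr -[birkhoff L F x *+ M]mulr_natl mulKf; last first.
    by rewrite pnatr_eq0 -lt0n.
  congr (_ - _); rewrite /birkhoff.
  transitivity (L%:R^-1 * \sum_(l < L) M%:R^-1 * \sum_(m < M) U m F (iter l (@sh R S) x)) => //.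
  rewrite -mulr_sumr exchange_big mulrCA; congr (_ * _).
  rewrite mulr_sumr; apply: eq_bigr => m _; congr (_ * _).
apply: (average_le (a := fun m => birkhoff L (U m F) x - birkhoff L F x)).
  by rewrite divr_ge0 // mulr_ge0.
move=> m mM; apply: le_trans (birkhoff_koop _ _ L0 F1) _.
by rewrite ler_wpM2r ?invr_ge0 // ler_pM2l // ler_nat ltnW.
Qed.

(* Convex combinations of the [U k F] have asymptotically the same Birkhoff
   averages as [F], hence square mean at least [inf]; near the infimum the
   parallelogram identity forces [birkhoff M F] to be almost invariant. *)
Lemma near_invariant F (e : R) : adm F -> (forall x, `|F x| <= 1) -> 0 < e ->
  exists2 M, (0 < M)%N & forall k,
    mean (fun x => (U k (birkhoff M F) x - birkhoff M F x) ^+ 2) <= e.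
Proof.
move=> aF F1 e0.
pose n2 M := mean (fun x => birkhoff M.+1 F x ^+ 2).
pose gam := inf (range n2).
have aB M : adm (birkhoff M F) by exact: adm_birkhoff.
have B1 M x : `|birkhoff M F x| <= 1 by exact: birkhoff_le.
have n20 M : 0 <= n2 M by apply: mean_ge0 => [|x]; [admt|exact: sqr_ge0].
have hin : has_inf (range n2).
  by split; [exists (n2 0%N); exists 0%N|exists 0 => _ [M _ <-]].
have gam_le M : gam <= n2 M by apply: ge_inf; [case: hin|exists M].
have [_ [M _ <-] hM] := @inf_adherent _ (range n2) (e / 4) ltac:(lra) hin.
rewrite -/gam in hM.
exists M.+1 => // k; set G := birkhoff M.+1 F.
have aG : adm G by exact: aB.
pose phi x := 2^-1 * (U k G x + G x).
have aphi : adm phi by rewrite /phi; admt.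
have phi_ge : gam <= mean (fun x => phi x ^+ 2).
  apply/ler_addgt0Pr => d d0.
  pose C : R := 2 * (2 * (M.+1 + k)%:R).
  pose L := (Num.truncn (C / d)).+1.
  have L0 : 0 < L%:R :> R by [].
  have CL : C / L%:R <= d.
    rewrite ler_pdivrMr // mulrC -ler_pdivrMr //; apply: ltW; exact: truncnS_gt.
  have err x : `|birkhoff L phi x - birkhoff L F x| <= C / 2 / L%:R.
    have -> : birkhoff L phi x - birkhoff L F x =
       2^-1 * ((birkhoff L (U k G) x - birkhoff L G x) + 2 * (birkhoff L G x - birkhoff L F x)).
      suff -> : birkhoff L phi x = 2^-1 * (birkhoff L (U k G) x + birkhoff L G x) by field.
      rewrite /birkhoff -mulrDr -big_split /= mulrCA; congr (_ * _).
      by rewrite mulr_sumr; apply: eq_bigr => i _; rewrite /koop /phi.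
    have e1 := @birkhoff_koop L k G x isT (B1 _).
    have e2 := @birkhoff_birkhoff L M.+1 F x isT isT F1.
    rewrite normrM ger0_norm ?invr_ge0 //.
    have e3 := ler_normD (birkhoff L (U k G) x - birkhoff L G x) (2 * (birkhoff L G x - birkhoff L F x)).
    have e4 (z : R) : `|2 * z| = 2 * `|z| by rewrite normrM ger0_norm.
    rewrite e4 in e3.
    have -> : C / 2 / L%:R = 2 * M.+1%:R / L%:R + 2 * k%:R / L%:R.
      by rewrite /C natrD; field; exact: lt0r_neq0.
    have k0 : 0 <= 2 * k%:R / L%:R :> R by rewrite divr_ge0 // mulr_ge0.
    lra.
  have step : n2 L.-1 <= mean (fun x => birkhoff L phi x ^+ 2) + C / L%:R.
    have aBp : adm (birkhoff L phi) by exact: adm_birkhoff.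
    rewrite -(mean_cst S (C / L%:R)) -meanD; [|by admt|by admt].
    apply: le_mean => [||x]; [by admt|by admt|].
    have := err x; have := B1 L x.
    have -> : C / L%:R = 2 * (C / 2 / L%:R) by field; exact: lt0r_neq0.
    move: (birkhoff L phi x) (birkhoff L F x) (C / 2 / L%:R) => p q c.
    move=> q1 pc.
    have h1 : `|q * (p - q)| <= c.
      by rewrite normrM -[leRHS]mul1r; apply: ler_pM.
    have h2 : 0 <= (p - q) ^+ 2 by exact: sqr_ge0.
    have -> : p ^+ 2 = q ^+ 2 + 2 * (q * (p - q)) + (p - q) ^+ 2 by ring.
    by move: h1; rewrite ler_norml => /andP[h1 _]; lra.
  have := birkhoff_sqr L aphi; have := gam_le L.-1; lra.
have -> : mean (fun x => (U k G x - G x) ^+ 2) =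
    2 * mean (fun x => U k G x ^+ 2) + 2 * mean (fun x => G x ^+ 2) - 4 * mean (fun x => phi x ^+ 2).
  rewrite -!meanZ; try by admt.
  rewrite -meanD; try by admt.
  rewrite -meanB; try by admt.
  by congr (mean _); apply/funext => x; rewrite /phi; field.
rewrite mean_koop_sqr //.
have : mean (fun x => G x ^+ 2) < gam + e / 4 by exact: hM.
lra.
Qed.

End mean_ergodic.

(** * The sequences [L n^(1+b)] and their increments *)

Section power_sequences.
Variables (R : realType) (b L : R) (Q : nat).
Hypotheses (b0 : 0 < b) (b1 : b < 1) (L0 : 0 < L) (LQ : Q%:R <= L).

Definition fast (n : nat) : nat := Num.truncn (L * n%:R `^ (1 + b)).

Let c0 : 0 < 1 + b. Proof. by rewrite addr_gt0. Qed.
Let c1 : 1 < 1 + b. Proof. by rewrite ltrDl. Qed.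

Lemma fast_real n : (fast n)%:R <= L * n%:R `^ (1 + b) < (fast n).+1%:R.
Proof.
by apply: truncn_itv; rewrite mulr_ge0 ?powR_ge0 // ltW.
Qed.

Lemma fast_ge n : (Q * n <= fast n)%N.
Proof.
rewrite /fast truncn_ge_nat ?mulr_ge0 ?powR_ge0 ?(ltW L0) // natrM.
case: n => [|n]; first by rewrite mulr0 mulr_ge0 ?powR_ge0 // ltW.
apply: ler_pM => //; apply: le1r_powR; [by rewrite ler1n|exact: ltW].
Qed.

Lemma power_incr (n r : nat) : (0 < n)%N ->
  (1 + b) * r%:R * n%:R `^ b <= (n + r)%:R `^ (1 + b) - n%:R `^ (1 + b)
    <= (1 + b) * r%:R * (n + r)%:R `^ b.
Proof.
move=> n0; have n0' : 0 < n%:R :> R by rewrite ltr0n.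
have nr0 : 0 < (n + r)%:R :> R by rewrite ltr0n addn_gt0 n0.
have h1 := powR_ge_tangent c1 n0' (ltW nr0).
have h2 := powR_ge_tangent c1 nr0 (ltW n0').
have e : 1 + b - 1 = b by rewrite addrC addKr.
rewrite e natrD in h1 h2; rewrite natrD; apply/andP; split.
  by rewrite lerBrDl; apply: le_trans h1; rewrite le_eqVlt; apply/orP; left; apply/eqP; ring.
rewrite lerBlDl -lerBlDr; apply: le_trans h2.
by rewrite le_eqVlt; apply/orP; left; apply/eqP; ring.
Qed.

(** The tangent bound for the concave power n^b: its increment over [r] steps is at most b r
    n^(b-1), which tends to 0. *)
Lemma power_flat (K d : R) (r : nat) : 0 < K -> 0 < d -> exists n0, forall n, (n0 <= n)%N ->
  K * (n + r)%:R `^ b <= K * n%:R `^ b + d.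
Proof.
move=> K0 d0.
have b1' : 0 < 1 - b by rewrite subr_gt0.
have C0 : 0 < d / (K * r.+1%:R) by rewrite divr_gt0 // mulr_gt0.
have [n0 hn0] := powR_nat_small b1' C0.
exists n0 => n /hn0[n_gt0 hn].
have n0' : 0 < n%:R :> R by rewrite ltr0n.
have h := powR_le_tangent (p := b) (x := n%:R) (y := (n + r)%:R) ltac:(by rewrite b0) n0' ltac:(by []).
apply: le_trans (ler_wpM2l (ltW K0) h) _; rewrite mulrDr lerD2l.
rewrite (_ : b - 1 = - (1 - b)); last by ring.
rewrite natrD addrAC subrr add0r.
apply: (@le_trans _ _ (K * (1 * (d / (K * r.+1%:R)) * r%:R))).
  apply: ler_wpM2l; first exact: ltW.
  apply: ler_wpM2r => //; apply: ler_pM => //; exact: ltW.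
have -> : K * (1 * (d / (K * r.+1%:R)) * r%:R) = d * (r%:R / r.+1%:R).
  have K1 := lt0r_neq0 K0; have : r.+1%:R != 0 :> R by rewrite pnatr_eq0.
  by move: (r.+1%:R : R) => X X0; field; rewrite X0 K1.
by rewrite -[leRHS]mulr1 ler_pM2l // ler_pdivrMr // mul1r ler_nat.
Qed.

Local Notation j := (slow (L * (1 + b)) b).

Let K0 : 0 < L * (1 + b). Proof. by rewrite mulr_gt0. Qed.

Lemma slow_real n : (j n)%:R <= L * (1 + b) * n%:R `^ b < (j n).+1%:R.
Proof. by apply: truncn_itv; rewrite mulr_ge0 ?powR_ge0 // ltW. Qed.

(** The real increment exceeds L (1+b) r n^b by at most 1 for large [n], and rounding the derivative
    inside [r * j n] loses at most [r]. These two errors are the [r.+1], since the final comparison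
    of floors is strict. *)
Lemma fast_incr r : exists n0, forall n, (n0 <= n)%N ->
  (fast n + r * j n <= fast (n + r) <= fast n + r * j n + r.+1)%N.
Proof.
have Kr : 0 < L * (1 + b) * r.+1%:R by rewrite mulr_gt0.
have [n0 hn0] := power_flat r Kr ltr01.
exists n0.+1 => n hn; have {}hn0 := hn0 n (ltnW hn).
have n_gt0 : (0 < n)%N by apply: leq_trans hn.
have /andP[p1 p2] := power_incr r n_gt0.
have /andP[v1 v2] := fast_real n.
have /andP[w1 w2] := fast_real (n + r).
have /andP[j1 j2] := slow_real n.
have p1' := ler_wpM2l (ltW L0) p1; have p2' := ler_wpM2l (ltW L0) p2.
rewrite mulrBr in p1' p2'.
have r0 : 0 <= r%:R :> R by [].
have j1' := ler_wpM2l r0 j1; have j2' := ler_wpM2l r0 (ltW j2).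
have flat : L * ((1 + b) * r%:R * (n + r)%:R `^ b) <=
            L * ((1 + b) * r%:R * n%:R `^ b) + 1.
  apply: le_trans (_ : L * (1 + b) * r%:R * n%:R `^ b + r%:R / r.+1%:R <= _); last first.
    rewrite !mulrA lerD2l ler_pdivrMr // mul1r ler_nat; exact: leqnSn.
  have := ler_wpM2r (divr_ge0 r0 (ler0n R r.+1)) hn0.
  have : r.+1%:R != 0 :> R by rewrite pnatr_eq0.
  rewrite mulrDl mul1r; move: (r.+1%:R : R) => X X0.
  have -> Y : L * (1 + b) * X * Y * (r%:R / X) = L * ((1 + b) * r%:R * Y) by field.
  have -> Y : L * (1 + b) * X * Y * (r%:R / X) = L * (1 + b) * r%:R * Y by field.
  by [].
rewrite -![_.+1%:R]natr1 in v2 w2 j2 j2'.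
apply/andP; split; rewrite -ltnS -(ltr_nat R) -!natr1 !natrD natrM -?natr1.
  lra.
lra.
Qed.

Lemma slow_incr s : exists n0, forall n, (n0 <= n)%N -> (j n <= j (n + s) <= (j n).+1)%N.
Proof.
have [n0 hn0] := power_flat s K0 ltr01.
exists n0 => n /hn0 hn; rewrite le_slow ?leq_addr //=.
have /andP[j1 j2] := slow_real n; have /andP[k1 k2] := slow_real (n + s).
rewrite -![_.+1%:R]natr1 in j2 k2.
rewrite -ltnS -(ltr_nat R) -!natr1; lra.
Qed.

End power_sequences.

(** * Towers of finite height over a system *)

Section suspension.
Variables (R : realType) (S : system R) (q : nat).
Local Notation Q := q.+1.

(** One step up the tower, with the original shift applied on leaving the top floor. [Q] steps make
    one original shift on every floor, so this is a [Q]-th root of it. *)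
Definition susp_shift (p : S * 'I_Q) : S * 'I_Q :=
  ((if p.2 == ord_max then sh p.1 else p.1), ordS p.2).

Definition susp_adm (F : S * 'I_Q -> R) : Prop := forall i, adm (fun x => F (x, i)).

Definition susp_mean (F : S * 'I_Q -> R) : R := Q%:R^-1 * \sum_i mean (fun x => F (x, i)).

Lemma susp_mean_shift F : susp_adm F -> susp_mean (fun p => F (susp_shift p)) = susp_mean F.
Proof.
move=> aF; rewrite /susp_mean [in RHS](reindex_inj (@ordS_inj Q)) /=; congr (_ * _).
apply: eq_bigr => i _; rewrite /susp_shift /=; case: eqP => // _.
exact: mean_sh.
Qed.

Definition susp : system R.
Proof.
refine (@System R _ susp_adm susp_mean susp_shift _ _ _ _ _ _ _ _ _).
- by move=> c i; exact: adm_cst.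
- by move=> F G aF aG i; apply: admD.
- by move=> F G aF aG i; apply: admM.
- by move=> F aF i; rewrite /susp_shift /=; case: eqP => _ //; exact: adm_sh (aF _).
- move=> F G aF aG; rewrite /susp_mean -mulrDr -big_split /=; congr (_ * _).
  by apply: eq_bigr => i _; rewrite meanD.
- move=> c F aF; rewrite /susp_mean mulrCA; congr (_ * _); rewrite mulr_sumr.
  by apply: eq_bigr => i _; rewrite meanZ.
- move=> F aF F0; rewrite /susp_mean mulr_ge0 // sumr_ge0 // => i _.
  exact: mean_ge0.
- exact: susp_mean_shift.
- rewrite /susp_mean; under eq_bigr do rewrite mean_cst1.
  by rewrite sumr_const card_ord mulVf.
Defined.

Definition slift (g : S -> R) (p : susp) : R := g p.1.

Lemma iter_susp e x (i : 'I_Q) :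
  iter e (@sh R susp) (x, i) =
  (iter ((i + e) %/ Q) (@sh R S) x, Ordinal (ltn_pmod (i + e) (ltn0Sn q))).
Proof.
elim: e => [|e IH].
  rewrite /= addn0 divn_small //=; congr (_, _); apply: val_inj => /=.
  by rewrite modn_small.
rewrite iterS IH /= /susp_shift /=; congr (_, _); last first.
  by apply: val_inj => /=; rewrite addnS -addn1 modnDml addn1.
rewrite -val_eqE /= addnS; case: eqP => [h|h].
  suff -> : ((i + e).+1 %/ Q = ((i + e) %/ Q).+1)%N by [].
  have -> : ((i + e).+1 = ((i + e) %/ Q).+1 * Q)%N; last by rewrite mulnK.
  by move: (divn_eq (i + e) Q); rewrite h mulSn; move: (_ * Q)%N => z; lia.
suff -> : ((i + e).+1 %/ Q = (i + e) %/ Q)%N by [].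
rewrite [in LHS](divn_eq (i + e) Q) -addnS divnMDl //.
by rewrite [X in (_ + X)%N]divn_small ?addn0 // ltn_neqAle ltn_pmod // andbT; apply/eqP => -[].
Qed.

Lemma koop_lift e g x (i : 'I_Q) : koop e (slift g) (x, i) = koop ((i + e) %/ Q) g x.
Proof. by rewrite /koop iter_susp. Qed.

Lemma koop_lift_mul m g : koop (Q * m) (slift g) = slift (koop m g).
Proof.
apply/funext => -[x i]; rewrite koop_lift /slift /= mulnC addnC divnMDl //.
by rewrite divn_small // addn0.
Qed.

Lemma adm_lift g : adm g -> @adm R susp (slift g).
Proof. by move=> ag i. Qed.

Lemma mean_lift g : @mean R susp (slift g) = mean g.
Proof.
rewrite /= /susp_mean /slift /= sumr_const card_ord -[X in _ * X]mulr_natl mulKf //.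
Qed.

Lemma susp_meanE F : @mean R susp F = Q%:R^-1 * \sum_(i < Q) mean (fun x => F (x, i)).
Proof. by []. Qed.

Lemma sum_ltn_le e n : \sum_(i < n) ((i < e)%N%:R : R) <= e%:R.
Proof.
suff -> : \sum_(i < n) ((i < e)%N%:R : R) = (minn n e)%:R by rewrite ler_nat geq_minr.
elim: n => [|n IH]; first by rewrite big_ord0 min0n.
rewrite big_ord_recr /= IH -natrD; congr (_%:R); case: ltnP; lia.
Qed.

(** Only the top [e] floors leave their fibre within [e] steps; this is a proportion e/Q of the
    tower, and there the square is at most 4. *)
Lemma lift_cont e g : adm g -> (forall x, `|g x| <= 1) ->
  @mean R susp (fun p => (koop e (slift g) p - slift g p) ^+ 2) <= 4 * e%:R / Q%:R.
Proof.
move=> ag g1; rewrite susp_meanE mulrC; apply: ler_wpM2r; first by rewrite invr_ge0.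
apply: (@le_trans _ _ (\sum_(i < Q) 4 * (rev_ord i < e)%N%:R)); last first.
  by rewrite -mulr_sumr ler_pM2l // (reindex_inj rev_ord_inj); under eq_bigr do rewrite rev_ordK; exact: sum_ltn_le.
apply: ler_sum => i _.
under eq_fun do rewrite koop_lift /slift /=.
case: (ltnP (rev_ord i) e) => [h|h].
  rewrite mulr1; apply: mean_le_cst => [|x]; first by admt.
  rewrite (_ : 4 = 2 ^+ 2); last by ring.
  rewrite -real_normK ?num_real // lerXn2r ?nnegrE //.
  apply: le_trans (ler_normB _ _) _.
  by have := g1 (iter ((i + e) %/ Q) (@sh R S) x); have := g1 x; rewrite /koop; lra.
rewrite divn_small; last by move: h (ltn_ord i) => /=; lia.
under eq_fun do rewrite /koop /= subrr expr0n /=.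
by rewrite mean_cst mulr0.
Qed.

End suspension.

(** * Cesaro averages *)

Lemma nat_above (R : realType) (x : R) : exists2 n : nat, (0 < n)%N & x <= n%:R.
Proof. by exists (Num.truncn x).+1 => //; apply: ltW; exact: truncnS_gt. Qed.

Lemma nat_above_ratio (R : realType) (x y : R) : 0 < y ->
  exists2 n : nat, (0 < n)%N & x <= y * n%:R.
Proof.
by move=> y0; have [n n0 h] := nat_above (x / y); exists n => //; rewrite mulrC -ler_pdivrMr.
Qed.

Section suspended_average.
Variables (R : realType) (S : system R).
Local Notation adm := (@adm R S).
Local Notation U := (@koop R S).
Implicit Types f g : S -> R.

Lemma sum_mul_index (a : nat -> R) (p L : nat) :
  \sum_(k < p * L) a k = \sum_(i < p) \sum_(l < L) a (p * l + i)%N.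
Proof.
elim: L => [|L IH].
  by rewrite muln0 big_ord0 big1 // => i _; rewrite big_ord0.
rewrite mulnS addnC big_split_ord /= IH -big_split /=.
by apply: eq_bigr => i _; rewrite [RHS]big_ord_recr.
Qed.

(** All parameters of [fast_average] are fixed here. Each depends only on earlier ones: the outer
    length [H1], the averaging lengths [Mr] and [L], then [M], [M'], the step [sg], the inner length
    [H], and finally the height [Q]. *)
Lemma suspended_average f g (b lam e : R) (m0 : nat) :
  adm f -> adm g -> (forall x, `|f x| <= 1) -> (forall x, `|g x| <= 1) ->
  0 < b < 1 -> 1 <= lam -> 0 < e -> (0 < m0)%N ->
  (forall d, 0 < d -> exists2 L, (0 < L)%N & mean (fun x => birkhoff L g x ^+ 2) <= d) ->
  exists2 q, (m0 %| q.+1)%N & exists N0, forall N, (N0 <= N)%N ->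
    q.+1%:R^-1 * \sum_(i < q.+1) mean (fun x => (\sum_(n < N) U n f x *
       U ((i + fast b (q.+1%:R * lam) n) %/ q.+1) g x) ^+ 2) <= e * N%:R ^+ 2.
Proof.
move=> af ag f1 g1 /andP[b0 b1] lam1 e0 m00 gL.
pose d := e / 46; have d0 : 0 < d by rewrite divr_gt0.
have d20 : 0 < d ^+ 2 by rewrite exprn_gt0.
have d40 : 0 < (d ^+ 2) ^+ 2 by rewrite exprn_gt0.
have [H1 H10 hH1] := nat_above_ratio 1 d0.
pose F r x := f x * U r f x.
have aF r : adm (F r) by rewrite /F; admt.
have F1 r x : `|F r x| <= 1.
  by rewrite normrM -[leRHS]mulr1; apply: ler_pM => //; exact: f1.
have /choice[Mr hMr] : forall r, exists M, (0 < M)%N /\ forall k,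
    mean (fun x => (U k (birkhoff M (F r)) x - birkhoff M (F r) x) ^+ 2) <= d ^+ 2.
  move=> r; have [M M0 hM] := near_invariant (aF r) (F1 r) d20.
  by exists M.
have [L L0 hL] := gL _ d20.
have [M M0 hM] := nat_above_ratio (2 * (\sum_(r < H1) Mr r)%N%:R) d0.
have [M' M'0 hM'] := nat_above_ratio M%:R d20.
have [sg sg0 hsg] := nat_above_ratio (32 * (H1 * M')%:R) d40.
have [H H0 hH] := nat_above_ratio 1 d20.
have [t1 t10 ht1] := nat_above_ratio (32 * (2 * (sg * H).+1 + H1)%:R) d40.
have [t2 t20 ht2] := nat_above_ratio (4 * H1.+1%:R) d20.
(* The factorials provide the divisibility by every lag, [t1] and [t2] the size. *)
pose Q := (m0 * sg * H`! * H1`! * t1 * t2)%N.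
have Q0 : (0 < Q)%N by rewrite !muln_gt0 m00 sg0 t10 t20 !fact_gt0.
have m0Q : (m0 %| Q)%N by rewrite /Q -!mulnA dvdn_mulr.
have t1Q : (t1 <= Q)%N.
  by apply: dvdn_leq => //; rewrite /Q mulnAC dvdn_mull.
have t2Q : (t2 <= Q)%N by apply: dvdn_leq => //; rewrite /Q dvdn_mull.
have sgQ s : (0 < s < H)%N -> (sg * s %| Q)%N.
  move=> /andP[s0 sH]; rewrite /Q; do 3 apply: dvdn_mulr.
  by rewrite -mulnA dvdn_mull // dvdn_mul // dvdn_fact // s0 ltnW.
have rQ r : (0 < r < H1)%N -> (r %| Q)%N.
  move=> /andP[r0 rH]; rewrite /Q; do 2 apply: dvdn_mulr.
  by rewrite dvdn_mull // dvdn_fact // r0 ltnW.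
clearbody Q; case: Q Q0 m0Q t1Q t2Q sgQ rQ => // q _ m0Q t1Q t2Q sgQ rQ.
exists q => //.
pose Y := susp S q.
have L1 : q.+1%:R <= q.+1%:R * lam by rewrite -[leLHS]mulr1 ler_pM2l.
have LL : 0 < q.+1%:R * lam by exact: lt_le_trans L1.
(* With p = Q/r and k = p l + i one has r k = Q l + r i. So an average over these multiples of [r]
   is an average over [i] of shifted Birkhoff averages of length [L] in the base. *)
pose K r := if (0 < r < H1)%N then (q.+1 %/ r * L)%N else 1%N.
have K0 r : (0 < K r)%N.
  rewrite /K; case: ifP => // hr; rewrite muln_gt0 L0 andbT.
  by have /andP[r0 _] := hr; rewrite divn_gt0 // dvdn_leq // rQ.
have B1 r x : `|birkhoff (Mr r) (F r) x| <= 1 by exact: birkhoff_le.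
have aB r : adm (birkhoff (Mr r) (F r)) by exact: adm_birkhoff.
have Kb : 0 < q.+1%:R * lam * (1 + b) by rewrite mulr_gt0 // addr_gt0.
have [||||||||||N0 hN0] := @fast_average R Y q.+1 (fast b (q.+1%:R * lam))
   (slow (q.+1%:R * lam * (1 + b)) b) (slift g) (ltn0Sn q) (fast_ge b0 LL L1)
   (fast_incr b0 b1 LL) (slow_incr b0 b1 LL) (slow_unbounded Kb b0)
   (fun V e => @slow_average R _ b Kb b0 b1 V e)
   (adm_lift ag) _ (fun e => @lift_cont R S q e g ag g1) (slift f)
   (fun r => slift (birkhoff (Mr r) (F r))) M M' sg H H1 K d M0 M'0 sg0 H0 d0 H10 K0
   _ _ _ _ _ _ _ hM' hsg hH hH1 sgQ _ _.
- by case=> x i; exact: g1.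
- exact: adm_lift.
- by case=> x i; exact: f1.
- by move=> r; exact: adm_lift.
- by move=> r [x i]; exact: B1.
- move=> r k hr; rewrite susp_meanE.
  rewrite ler_pdivrMl // mulr_natl -[q.+1 in leRHS]card_ord -sumr_const.
  apply: ler_sum => i _; under eq_fun do rewrite koop_lift /slift /=.
  by have [_] := hMr r; apply.
- move=> r hr.
  have -> : (fun x : Y => conv q.+1 M (fun y => slift f y * koop (q.+1 * r) (slift f) y -
        slift (birkhoff (Mr r) (F r)) y) x ^+ 2) =
     slift (fun x => birkhoff M (fun y => F r y - birkhoff (Mr r) (F r) y) x ^+ 2) :> (Y -> R).
    apply/funext => -[x i]; rewrite /conv /slift /=; congr ((_ * _) ^+ 2).
    have E : (fun y : Y => f y.1 * koop (q.+1 * r) (slift f) y - birkhoff (Mr r) (F r) y.1) =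
             slift (fun y => F r y - birkhoff (Mr r) (F r) y).
      by apply/funext => -[y l]; rewrite koop_lift_mul.
    by apply: eq_bigr => m _; rewrite E koop_lift_mul.
  rewrite mean_lift.
  have aFB : adm (fun y => F r y - birkhoff (Mr r) (F r) y).
    by have := aF r; have := aB r => ? ?; admt.
  apply: mean_sqr_le => [|x]; first exact: adm_birkhoff.
  have -> : birkhoff M (fun y => F r y - birkhoff (Mr r) (F r) y) x =
      birkhoff M (F r) x - birkhoff M (birkhoff (Mr r) (F r)) x.
    by rewrite /birkhoff -mulrBr -sumrB.
  rewrite distrC; have [Mr0 _] := hMr r.
  apply: le_trans (birkhoff_birkhoff _ M0 Mr0 (F1 r)) _.
  rewrite ler_pdivrMr ?ltr0n //; apply: le_trans hM; rewrite ler_pM2l // ler_nat.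
  have /andP[_ rH] := hr.
  by rewrite (bigD1 (Ordinal rH)) //= leq_addr.
- move=> r hr; rewrite /K hr; have /andP[r0 _] := hr.
  set p := (q.+1 %/ r)%N.
  have prQ : (r * p = q.+1)%N by rewrite mulnC divnK // rQ.
  have -> : (fun x : Y => ((p * L)%:R^-1 * \sum_(k < p * L) koop (r * k) (slift g) x) ^+ 2) =
     (fun x : Y => (p%:R^-1 * \sum_(i < p) koop (r * i) (slift (birkhoff L g)) x) ^+ 2).
    apply/funext => x; rewrite (sum_mul_index (fun k => koop (r * k) (slift g) x)).
    rewrite natrM invfM -mulrA; congr ((_ * _) ^+ 2); rewrite mulr_sumr.
    apply: eq_bigr => i _; rewrite /slift /birkhoff /koop; congr (_ * _).
    apply: eq_bigr => l _; rewrite mulnDr mulnA prQ iterD.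
    move: (iter (r * i) _ _) => [y s]; rewrite iter_susp /=.
    by rewrite addnC mulnC divnMDl // divn_small // addn0.
  apply: (mean_average_sqr (F := fun i => koop (r * i) (slift (birkhoff L g)))).
  + exact: ltW.
  + by move=> i; apply: adm_koop; apply: adm_lift; exact: adm_birkhoff.
  + move=> i _; rewrite mean_koop_sqr; last by apply: adm_lift; exact: adm_birkhoff.
    by rewrite (mean_lift q (fun x => birkhoff L g x ^+ 2)).
- by apply: le_trans ht1 _; rewrite ler_pM2l // ler_nat.
- by apply: le_trans ht2 _; rewrite ler_pM2l // ler_nat.
exists N0 => N /hN0; rewrite susp_meanE (_ : 46 * d = e); last by rewrite /d; field.
apply: le_trans; rewrite le_eqVlt; apply/orP; left; apply/eqP.
congr (_ * _); apply: eq_bigr => i _; congr (mean _); apply/funext => x.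
congr (_ ^+ 2); apply: eq_bigr => n _.
by rewrite koop_lift_mul koop_lift.
Qed.

End suspended_average.

(** Here uniform estimates with [f = g = 1] become scalar statements; the towers over this system
    are the finite rotations. *)
Definition unit_system (R : realType) : system R.
Proof.
refine (@System R unit (fun=> True) (fun F => F tt) id _ _ _ _ _ _ _ _ _) => //.
Defined.

(** * Equidistribution from finite rotations *)

Section fractional_parts.
Variables (R : realType) (b : R).
Hypotheses (b0 : 0 < b) (b1 : b < 1).

Lemma fast_nested (Q : nat) (L : R) n : (0 < Q)%N -> 0 < L ->
  (fast b (Q%:R * L) n %/ Q = fast b L n)%N.
Proof.
move=> Q0 L0; have Q0' : 0 < Q%:R :> R by rewrite ltr0n.
have /andP[h1 h2] := fast_real b (mulr_gt0 Q0' L0) n.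
have /andP[k1 k2] := fast_real b L0 n.
rewrite -mulrA in h1 h2.
set y := L * n%:R `^ (1 + b) in h1 h2 k1 k2.
apply/eqP; rewrite eqn_leq -ltnS ltn_divLR // leq_divRL //; apply/andP; split.
  rewrite -(ltr_nat R) natrM; apply: le_lt_trans h1 _; rewrite mulrC ltr_pM2r //.
rewrite -ltnS -(ltr_nat R); apply: le_lt_trans h2; rewrite natrM mulrC.
by rewrite ler_pM2l.
Qed.

(* [fast b m n %% m = m - 1] says that the fractional part of [n ^ (1 + b)] is
   at least [1 - 1 / m]. *)
Lemma frac_density (m : nat) : (2 < m)%N -> exists N0, forall N, (N0 <= N)%N ->
  \sum_(n < N) ((fast b m%:R n %% m == m.-1)%N%:R : R) <= 3 / m%:R * N%:R.
Proof.
case: m => // p p2; set m := p.+1.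
pose C := susp (unit_system R) p.
(* Two residues, because starting on floor [i] of the tower may carry the quotient from u to u + 1,
   and so from residue m - 1 to 0. *)
pose arc (k : nat) : R := ((k == p) || (k == 0%N))%:R.
pose g (z : C) : R := arc z.2 - 2 / m%:R.
have m3 : 3 <= m%:R :> R by rewrite ler_nat.
have i2 : 0 <= (2 / m%:R : R) <= 1.
  by rewrite divr_ge0 //= ler_pdivrMr // mul1r; lra.
have g1 z : `|g z| <= 1.
  by rewrite /g /arc ler_norml; case: (_ || _) => /=; lra.
have ag : adm g by move=> i.
have arc_sum : \sum_(k < m) arc k = 2.
  have p0 : p != 0%N by move: p2; clear; lia.
  rewrite (bigD1 ord_max) //= (bigD1 ord0) /=; last by rewrite -val_eqE /= eq_sym.
  have -> : arc p = 1 by rewrite /arc eqxx.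
  have -> : arc 0%N = 1 by rewrite /arc eqxx orbT.
  rewrite big1 => [|i /andP[ip i0]]; first by rewrite addr0.
  rewrite -!val_eqE /= in ip i0.
  by rewrite /arc (negbTE ip) (negbTE i0).
have gL d : 0 < d -> exists2 L, (0 < L)%N & mean (fun x => birkhoff L g x ^+ 2) <= d.
  move=> d0; exists m => //; apply: le_trans (ltW d0).
  apply: mean_le_cst => [|[x i]]; first exact: (admX _ (adm_birkhoff _ ag)).
  suff -> : birkhoff m g (x, i) = 0 by rewrite expr0n.
  rewrite /birkhoff /koop /g; under eq_bigr do rewrite iter_susp /=.
  rewrite sumrB sumr_const card_ord -[(2 / _) *+ m]mulr_natl mulrC.
  have -> : \sum_(k < m) arc ((i + k) %% m)%N = 2.
    rewrite -arc_sum; pose h (k : 'I_m) : 'I_m := Ordinal (ltn_pmod (i + k) (ltn0Sn p)).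
    have hi : injective h.
      move=> k k' /(congr1 val) /= /eqP; rewrite eqn_modDl !modn_small // => /eqP.
      exact: val_inj.
    by rewrite [RHS](reindex_inj hi).
  by rewrite [m%:R * _]mulrC divfK ?gt_eqF // subrr mul0r.
(* One starting point of the rotation has mass 1/m. If the count exceeded its expected bound 2N/m by
   more than N/m, this point alone would contribute more than m^(-3) N^2. *)
have e0 : 0 < m%:R^-1 ^+ 3 :> R by rewrite exprn_gt0 // invr_gt0.
have f1 (x : C) : `|(1 : R)| <= 1 by rewrite normr1.
have b01 : 0 < b < 1 by rewrite b0.
have m1 : 1 <= m%:R :> R by rewrite ler1n.
have [q _ [N0 hN0]] := suspended_average (adm_cst C 1) ag f1 g1 b01 m1 e0 (ltn0Sn 0) gL.
clear f1; exists N0 => N /hN0 {hN0}.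
set Q := q.+1; have Q0 : 0 < Q%:R :> R by [].
set cnt := \sum_(n < N) _ => hN; rewrite leNgt; apply/negP => ct.
pose t := cnt - 2 / m%:R * N%:R.
have Nm0 : 0 <= N%:R / m%:R :> R by rewrite divr_ge0.
have tN : N%:R / m%:R < t by rewrite /t; lra.
pose A (i : nat) (z : C) : R := \sum_(n < N) koop n (fun=> 1) z *
    koop ((i + fast b (Q%:R * m%:R) n) %/ Q) g z.
have At (i : 'I_Q) : t <= A i (tt, ord0).
  have E : 2 / m%:R * N%:R = \sum_(n < N) (2 / m%:R : R) by rewrite sumr_const card_ord mulr_natr.
  rewrite /t E /cnt -sumrB.
  apply: ler_sum => n _; rewrite /koop mul1r iter_susp /g /= lerB // add0n.
  case: eqP => [h|_]; last by rewrite /arc; case: (_ || _).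
  set V := fast b (Q%:R * m%:R) n.
  have VQ : (V %/ Q = fast b m%:R n)%N by exact: fast_nested.
  have k1 : (fast b m%:R n <= (i + V) %/ Q)%N by rewrite -VQ leq_div2r // leq_addl.
  have k2 : ((i + V) %/ Q <= (fast b m%:R n).+1)%N.
    rewrite -VQ -[(_ %/ Q).+1]add1n -divnMDl // leq_div2r // mul1n leq_add2r ltnW //.
  have : ((i + V) %/ Q = fast b m%:R n \/ (i + V) %/ Q = (fast b m%:R n).+1)%N.
    by move: k1 k2; move: (_ %/ _)%N (fast _ _ _); clear; lia.
  case=> ->; first by rewrite /arc h eqxx.
  by rewrite -addn1 -modnDml h addn1 modnn /arc eqxx orbT.
have : m%:R^-1 * t ^+ 2 <= m%:R^-1 ^+ 3 * N%:R ^+ 2.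
  apply: le_trans hN; rewrite ler_pdivlMl //.
  have -> : Q%:R * (m%:R^-1 * t ^+ 2) = \sum_(i < Q) m%:R^-1 * t ^+ 2.
    by rewrite sumr_const card_ord mulr_natl.
  apply: ler_sum => i _; rewrite susp_meanE ler_pM2l ?invr_gt0 //.
  rewrite (bigD1 ord0) //= -[leLHS]addr0; apply: lerD; last first.
    by apply: sumr_ge0 => z _; exact: sqr_ge0.
  have t0 : 0 <= t by lra.
  by rewrite lerXn2r ?nnegrE //; [exact: le_trans (At i)|exact: At].
have -> : m%:R^-1 ^+ 3 * N%:R ^+ 2 = m%:R^-1 * (N%:R / m%:R) ^+ 2 :> R.
  by rewrite !exprMn; ring.
rewrite ler_pM2l ?invr_gt0 // leNgt => /negP; apply.
by rewrite ltrXn2r // nnegrE; lra.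
Qed.

End fractional_parts.

Section deterministic.
Variables (R : realType) (S : system R) (b : R).
Hypotheses (b0 : 0 < b) (b1 : b < 1).
Local Notation adm := (@adm R S).
Local Notation mean := (@mean R S).
Local Notation U := (@koop R S).
Implicit Types f g : S -> R.

(** On the lowest Q/m floors a carry can occur only if the fractional part of n^(1+b) is at least 1
    - 1/m, which [frac_density] makes rare; elsewhere the tower exponent is the true one. Keeping
    only these floors costs a factor m, hence the error [e / (4 * m%:R)]. The rare indices
    contribute 8 (3N/m)^2 = 72 N^2 / m^2, whence 144. *)
Lemma coboundary_average f g (e : R) :
  adm f -> adm g -> (forall x, `|f x| <= 1) -> (forall x, `|g x| <= 1) -> 0 < e ->
  (forall d, 0 < d -> exists2 L, (0 < L)%N & mean (fun x => birkhoff L g x ^+ 2) <= d) ->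
  exists N0, forall N, (N0 <= N)%N ->
    mean (fun x => (\sum_(n < N) U n f x * U (fast b 1 n) g x) ^+ 2) <= e * N%:R ^+ 2.
Proof.
move=> af ag f1 g1 e0 gL.
have [m' m'0 hm'] := nat_above_ratio 144 e0.
pose m := (m' + 2)%N; have m2 : (2 < m)%N by rewrite /m; lia.
have m0 : (0 < m)%N by apply: leq_trans m2.
have mR : 0 < m%:R :> R by rewrite ltr0n.
have hm : 144 <= e * m%:R by apply: le_trans hm' _; rewrite ler_pM2l // ler_nat leq_addr.
have d0 : 0 < e / (4 * m%:R) by rewrite divr_gt0 // mulr_gt0.
have b01 : 0 < b < 1 by rewrite b0.
have [q mQ [N1 hN1]] := suspended_average af ag f1 g1 b01 (lexx 1) d0 m0 gL.
have [N2 hN2] := frac_density b0 b1 m2.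
exists (N1 + N2)%N => N hN.
have {hN1} := hN1 N ltac:(clear - hN; lia); have {hN2} := hN2 N ltac:(clear - hN; lia).
set cnt := \sum_(n < N) _; move: mQ; set Q := q.+1 => mQ hcnt hN1.
have Q0 : 0 < Q%:R :> R by [].
set p := (Q %/ m)%N.
have pm : (p * m = Q)%N by rewrite divnK.
have p0 : (0 < p)%N by rewrite divn_gt0 // dvdn_leq.
have pR : 0 < p%:R :> R by rewrite ltr0n.
pose A i x := \sum_(n < N) U n f x * U ((i + fast b (Q%:R * 1) n) %/ Q) g x.
pose B x := \sum_(n < N) U n f x * U (fast b 1 n) g x.
have aA i : adm (A i) by rewrite /A; admt.
have aB : adm B by rewrite /B; admt.
have cnt0 : 0 <= cnt by apply: sumr_ge0.
have close i x : (i < p)%N -> `|B x - A i x| <= 2 * cnt.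
  move=> ip; rewrite -sumrB; apply: le_trans (ler_norm_sum _ _ _) _.
  rewrite mulr_sumr; apply: ler_sum => n _; rewrite -mulrBr normrM.
  case: eqP => [_|h].
    rewrite [2 * _]mulr1 -[leRHS]mul1r; apply: ler_pM => //; first exact: f1.
    apply: le_trans (ler_normB _ _) _.
    by have := g1 (iter (fast b 1 n) (@sh R S) x);
       have := g1 (iter ((i + fast b (Q%:R * 1) n) %/ Q) (@sh R S) x); rewrite /koop; lra.
  suff -> : ((i + fast b (Q%:R * 1) n) %/ Q = fast b 1 n)%N by rewrite subrr normr0 !mulr0.
  have E1 : (fast b (Q%:R * 1) n %/ p = fast b m%:R n)%N.
    by rewrite mulr1 -pm natrM; apply: fast_nested.
  have E2 : (fast b m%:R n %/ m = fast b 1 n)%N.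
    by rewrite -[X in fast b X n]mulr1; apply: fast_nested.
  move: E1 E2 h; set V := fast b _ n; set u := fast b m%:R n => E1 E2 h.
  rewrite -pm divnMA.
  have k1 : (u <= (i + V) %/ p)%N by rewrite -E1 leq_div2r // leq_addl.
  have k2 : ((i + V) %/ p <= u.+1)%N.
    by rewrite -E1 -[(_ %/ p).+1]add1n -divnMDl // leq_div2r // mul1n leq_add2r ltnW.
  have : ((i + V) %/ p = u \/ (i + V) %/ p = u.+1)%N.
    by move: k1 k2; move: (_ %/ _)%N => z; clear; lia.
  case=> ->; first by [].
  rewrite -E2; apply/eqP; rewrite eqn_leq; apply/andP; split; last exact: leq_div2r.
  rewrite -ltnS ltn_divLR //.
  rewrite {1}(divn_eq u m) -addnS mulSn addnC ltn_add2r.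
  by have := ltn_pmod u m0; move: h m0; move: (u %% m)%N; clear; lia.
have step i : (i < p)%N -> mean (fun x => B x ^+ 2) <=
    2 * mean (fun x => A i x ^+ 2) + 8 * cnt ^+ 2.
  move=> ip; have -> : (fun x => B x ^+ 2) = (fun x => (A i x + (B x - A i x)) ^+ 2).
    by apply/funext => x; congr (_ ^+ 2); ring.
  have aBA : adm (fun x => B x - A i x) by have := aA i => ?; admt.
  apply: le_trans (mean_sqrD (aA i) aBA) _; rewrite lerD2l.
  rewrite (_ : 8 * _ = 2 * (2 * cnt) ^+ 2); last by ring.
  by rewrite ler_pM2l //; apply: mean_sqr_le => // x; exact: close.
have tot : p%:R * mean (fun x => B x ^+ 2) <=
    2 * \sum_(i < Q) mean (fun x => A i x ^+ 2) + p%:R * (8 * cnt ^+ 2).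
  apply: (@le_trans _ _ (2 * \sum_(i < p) mean (fun x => A i x ^+ 2) + p%:R * (8 * cnt ^+ 2))).
    rewrite -[p in leLHS]card_ord mulr_natl -sumr_const mulr_sumr.
    rewrite -[p in _ + p%:R * _]card_ord mulr_natl -sumr_const -big_split /=.
    by apply: ler_sum => i _; exact: step.
  rewrite lerD2r ler_pM2l //.
  have pQ : (p <= Q)%N by rewrite -pm leq_pmulr.
  rewrite -(big_mkord xpredT (fun i => mean (fun x => A i x ^+ 2))).
  rewrite -(big_mkord xpredT (fun i => mean (fun x => A i x ^+ 2))).
  rewrite (big_cat_nat (leq0n p) pQ) /= lerDl sumr_ge0 // => i _.
  by have := aA i => ?; apply: mean_ge0 => [|x]; [admt|exact: sqr_ge0].
have hS : \sum_(i < Q) mean (fun x => A i x ^+ 2) <= Q%:R * (e / (4 * m%:R) * N%:R ^+ 2).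
  by rewrite -ler_pdivrMl.
have hc : cnt ^+ 2 <= (3 / m%:R * N%:R) ^+ 2.
  by rewrite lerXn2r ?nnegrE // mulr_ge0 // divr_ge0.
rewrite -(ler_pM2l pR); apply: le_trans tot _.
have QE : Q%:R = p%:R * m%:R :> R by rewrite -natrM pm.
apply: (@le_trans _ _ (p%:R * (e / 2 * N%:R ^+ 2 + 72 / m%:R ^+ 2 * N%:R ^+ 2))).
  have mN := lt0r_neq0 mR.
  rewrite mulrDr; apply: lerD.
    apply: le_trans (ler_wpM2l _ hS) _ => //.
    by rewrite QE le_eqVlt; apply/orP; left; apply/eqP; field.
  rewrite ler_pM2l //; apply: le_trans (ler_wpM2l _ hc) _ => //.
  by rewrite le_eqVlt; apply/orP; left; apply/eqP; field.
rewrite ler_pM2l // -mulrDl; apply: ler_wpM2r; first exact: sqr_ge0.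
have : 72 / m%:R ^+ 2 <= e / 2.
  rewrite ler_pdivrMr ?exprn_gt0 //.
  have m1 : 1 <= m%:R :> R by rewrite ler1n.
  have : e / 2 * m%:R <= e / 2 * m%:R ^+ 2.
    by rewrite expr2 mulrA ler_peMr // mulr_ge0 // ?ltW // divr_gt0.
  lra.
lra.
Qed.

(** A Cauchy condition in square mean: [psi] may depend on [e]. The uniform bound on [psi] is what
    dominated convergence uses when the limit is built. *)
Definition approximable (Phi : nat -> S -> R) : Prop := forall e : R, 0 < e ->
  exists psi : S -> R, [/\ adm psi, forall x, `|psi x| <= 1 &
    exists N0, forall N, (N0 <= N)%N -> mean (fun x => (Phi N x - psi x) ^+ 2) <= e].

Lemma mean_sqrD4 (A B C D : S -> R) : adm A -> adm B -> adm C -> adm D ->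
  mean (fun x => (A x + B x + (C x + D x)) ^+ 2) <=
  4 * (mean (fun x => A x ^+ 2) + mean (fun x => B x ^+ 2) +
       (mean (fun x => C x ^+ 2) + mean (fun x => D x ^+ 2))).
Proof.
move=> aA aB aC aD.
apply: le_trans (mean_sqrD (F := fun x => A x + B x) (G := fun x => C x + D x) _ _) _;
  [by admt|by admt|].
have := mean_sqrD aA aB; have := mean_sqrD aC aD; lra.
Qed.

Lemma cesaro_approximable f g :
  adm f -> adm g -> (forall x, `|f x| <= 1) -> (forall x, `|g x| <= 1) ->
  approximable (fun N x => N%:R^-1 * \sum_(n < N) U n f x * U (fast b 1 n) g x).
Proof.
move=> af ag f1 g1 e e0.
have e16 : 0 < e / 16 by rewrite divr_gt0.
have [L L0 hL] := near_invariant ag g1 e16.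
have [M M0 hM] := near_invariant af f1 e16.
set g2 := birkhoff L g in hL; set fM := birkhoff M f in hM.
have ag2 : adm g2 by exact: adm_birkhoff.
have afM : adm fM by exact: adm_birkhoff.
have g21 x : `|g2 x| <= 1 by exact: birkhoff_le.
have fM1 x : `|fM x| <= 1 by exact: birkhoff_le.
pose h x := 2^-1 * (g x - g2 x).
have ah : adm h by rewrite /h; admt.
have h1 x : `|h x| <= 1.
  rewrite normrM ger0_norm ?invr_ge0 //.
  by have := ler_normB (g x) (g2 x); have := g1 x; have := g21 x; lra.
have hB d : 0 < d -> exists2 L', (0 < L')%N & mean (fun x => birkhoff L' h x ^+ 2) <= d.
  move=> d0; have d1 : 0 < Num.min d 1 by rewrite lt_min d0 ltr01.
  have [L' L'0 hL'] := nat_above_ratio L%:R d1; exists L' => //.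
  have L'R : 0 < L'%:R :> R by rewrite ltr0n.
  have s1 : mean (fun x => birkhoff L' h x ^+ 2) <= (Num.min d 1) ^+ 2.
    apply: mean_sqr_le => [|x]; first exact: adm_birkhoff.
    have -> : birkhoff L' h x = 2^-1 * (birkhoff L' g x - birkhoff L' g2 x).
      rewrite /birkhoff -mulrBr -sumrB mulrCA; congr (_ * _).
      by rewrite mulr_sumr.
    rewrite normrM ger0_norm ?invr_ge0 // distrC.
    have := birkhoff_birkhoff x L'0 L0 g1; rewrite -/g2.
    have : L%:R / L'%:R <= Num.min d 1 by rewrite ler_pdivrMr.
    lra.
  apply: le_trans s1 _; apply: (@le_trans _ _ (Num.min d 1)); last by rewrite ge_min lexx.
  rewrite expr2 -[leRHS]mulr1; apply: ler_wpM2l; first exact: ltW.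
  by rewrite ge_min lexx orbT.
have [N1 hN1] := @coboundary_average f h (e / 64) af ah f1 h1 ltac:(by rewrite divr_gt0) hB.
have mn0 : 0 < Num.min (e / 16) 1 by rewrite lt_min e16 ltr01.
have [N2 N20 hN2] := nat_above_ratio (2 * M%:R) mn0.
exists (fun x => fM x * g2 x); split; first by admt.
  by move=> x; rewrite normrM -[leRHS]mulr1; apply: ler_pM.
exists (N1 + N2)%N => N hN.
have N0 : (0 < N)%N by clear - hN N20; lia.
have NR : 0 < N%:R :> R by rewrite ltr0n.
have NN := lt0r_neq0 NR.
pose t1 x := N%:R^-1 * \sum_(n < N) U n f x * U (fast b 1 n) (fun y => g y - g2 y) x.
pose t2 x := N%:R^-1 * \sum_(n < N) U n f x * (U (fast b 1 n) g2 x - g2 x).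
pose t3 x := (birkhoff N f x - birkhoff N fM x) * g2 x.
pose t4 x := g2 x * (birkhoff N fM x - fM x).
have aBN F : adm F -> adm (birkhoff N F) by exact: adm_birkhoff.
have aBf := aBN _ af; have aBM := aBN _ afM.
have a1 : adm t1 by rewrite /t1; admt.
have a2 : adm t2 by rewrite /t2; admt.
have a3 : adm t3 by rewrite /t3; admt.
have a4 : adm t4 by rewrite /t4; admt.
have -> : (fun x => (N%:R^-1 * \sum_(n < N) U n f x * U (fast b 1 n) g x - fM x * g2 x) ^+ 2) =
     (fun x => (t1 x + t2 x + (t3 x + t4 x)) ^+ 2).
  apply/funext => x; congr (_ ^+ 2); rewrite /t1 /t2 /t3 /t4 -mulrDr -big_split /=.
  have -> : \sum_(n < N) (U n f x * U (fast b 1 n) (fun y => g y - g2 y) x +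
        U n f x * (U (fast b 1 n) g2 x - g2 x)) =
     \sum_(n < N) U n f x * U (fast b 1 n) g x - (\sum_(n < N) U n f x) * g2 x.
    rewrite mulr_suml -sumrB; apply: eq_bigr => n _; rewrite /koop; ring.
  rewrite /birkhoff; ring.
apply: le_trans (mean_sqrD4 a1 a2 a3 a4) _.
have b1' : mean (fun x => t1 x ^+ 2) <= e / 16.
  have -> : (fun x => t1 x ^+ 2) =
      (fun x => (4 / N%:R ^+ 2) * (\sum_(n < N) U n f x * U (fast b 1 n) h x) ^+ 2).
    apply/funext => x; rewrite /t1.
    have -> : \sum_(n < N) U n f x * U (fast b 1 n) (fun y => g y - g2 y) x =
       2 * \sum_(n < N) U n f x * U (fast b 1 n) h x.
      by rewrite mulr_sumr; apply: eq_bigr => n _; rewrite /koop /h; field.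
    by move: (\sum_(n < N) _) => z; field.
  rewrite meanZ; last by admt.
  have c0 : 0 <= 4 / N%:R ^+ 2 :> R by rewrite divr_ge0 // sqr_ge0.
  apply: le_trans (ler_wpM2l c0 (hN1 N _)) _; first by clear - hN; lia.
  by rewrite le_eqVlt; apply/orP; left; apply/eqP; field.
have b2' : mean (fun x => t2 x ^+ 2) <= e / 16.
  apply: (mean_average_sqr (F := fun n x => U n f x * (U (fast b 1 n) g2 x - g2 x))).
  - exact: ltW.
  - by move=> n; admt.
  - move=> n _; apply: le_trans (hL (fast b 1 n)).
    apply: le_mean => [||x]; [by admt|by admt|].
    rewrite exprMn -[leRHS]mul1r; apply: ler_wpM2r; first exact: sqr_ge0.
    by rewrite -real_normK ?num_real // expr_le1 //; exact: f1.
have b3' : mean (fun x => t3 x ^+ 2) <= e / 16.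
  apply: (@le_trans _ _ ((Num.min (e / 16) 1) ^+ 2)).
    apply: mean_sqr_le => // x; rewrite normrM -[leRHS]mulr1; apply: ler_pM => //.
    rewrite distrC; apply: le_trans (birkhoff_birkhoff x N0 M0 f1) _.
    rewrite ler_pdivrMr //; apply: le_trans hN2 _; apply: ler_wpM2l.
      by rewrite le_min ler01 andbT ltW.
    rewrite ler_nat; clear - hN; lia.
  apply: (@le_trans _ _ (Num.min (e / 16) 1)); last by rewrite ge_min lexx.
  rewrite expr2 -[leRHS]mulr1; apply: ler_wpM2l.
    by rewrite le_min ler01 andbT ltW.
  by rewrite ge_min lexx orbT.
have b4' : mean (fun x => t4 x ^+ 2) <= e / 16.
  have -> : (fun x => t4 x ^+ 2) = (fun x => (N%:R^-1 * \sum_(n < N) g2 x * (U n fM x - fM x)) ^+ 2).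
    apply/funext => x; congr (_ ^+ 2); rewrite /t4 -mulr_sumr sumrB sumr_const card_ord.
    by rewrite -[fM x *+ N]mulr_natl /birkhoff; field.
  apply: (mean_average_sqr (F := fun n x => g2 x * (U n fM x - fM x))).
  - exact: ltW.
  - by move=> n; admt.
  - move=> n _; apply: le_trans (hM n).
    apply: le_mean => [||x]; [by admt|by admt|].
    rewrite exprMn -[leRHS]mul1r; apply: ler_wpM2r; first exact: sqr_ge0.
    by rewrite -real_normK ?num_real // expr_le1.
lra.
Qed.

End deterministic.

(** * From weighted averages to the generated sequence *)

Lemma sqr_weighted_sum_le (R : realType) (n : nat) (p a : nat -> R) :
  (forall i, (i < n)%N -> 0 <= p i) ->
  (\sum_(i < n) p i * a i) ^+ 2 <= (\sum_(i < n) p i) * \sum_(i < n) p i * a i ^+ 2.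
Proof.
move=> p0.
have : 0 <= \sum_(i < n) \sum_(j < n) p i * p j * (a i - a j) ^+ 2.
  by apply: sumr_ge0 => i _; apply: sumr_ge0 => j _; apply: mulr_ge0;
    [apply: mulr_ge0; exact: p0|exact: sqr_ge0].
have -> : \sum_(i < n) \sum_(j < n) p i * p j * (a i - a j) ^+ 2 =
    2 * ((\sum_(i < n) p i) * (\sum_(i < n) p i * a i ^+ 2) - (\sum_(i < n) p i * a i) ^+ 2).
  transitivity (\sum_(i < n) (p i * a i ^+ 2 * (\sum_(j < n) p j) +
     p i * (\sum_(j < n) p j * a j ^+ 2) - 2 * (p i * a i) * \sum_(j < n) p j * a j)).
    apply: eq_bigr => i _.
    rewrite !mulr_sumr -sumrN -!big_split /=.
    by apply: eq_bigr => j _; ring.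
  rewrite !big_split /= sumrN -!mulr_suml -!mulr_sumr; ring.
by lra.
Qed.

Section weighted.
Variables (R : realType) (S : system R).
Local Notation adm := (@adm R S).
Local Notation mean := (@mean R S).
Variables (F : nat -> S -> R) (s : nat -> R).
Hypotheses (aF : forall n, adm (F n)) (F1 : forall n x, `|F n x| <= 1).
Hypotheses (s0 : forall n, 0 < s n) (s_dec : forall n, s n.+1 <= s n).
Let W N := \sum_(n < N) s n.
Hypothesis W_inf : forall C, exists N0, forall N, (N0 <= N)%N -> C <= W N.

Let abel (a : nat -> R) N : \sum_(n < N.+1) s n * a n =
  \sum_(n < N) (s n - s n.+1) * (\sum_(m < n.+1) a m) + s N * \sum_(m < N.+1) a m.
Proof.
elim: N => [|N IH]; first by rewrite !big_ord_recr !big_ord0 /=; ring.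
rewrite big_ord_recr /= IH [X in _ = X + _]big_ord_recr /= [X in _ = _ + s N.+1 * X]big_ord_recr /=.
ring.
Qed.

(** Summation by parts writes the weighted average as a convex combination of Cesaro averages,
    because the weights decrease. The first [m0] of these carry bounded total mass, negligible as
    [W] diverges. *)
Lemma weighted_approximable :
  approximable (fun N x => N%:R^-1 * \sum_(n < N) F n x) ->
  approximable (fun N x => (W N)^-1 * \sum_(n < N) s n * F n x).
Proof.
move=> FA e e0; have [psi [apsi psi1 [m0 hm0]]] := FA (e / 2) ltac:(by rewrite divr_gt0).
exists psi; split=> //.
have [N1 hN1] := W_inf (8 * m0.+1%:R * s 0%N / e).
exists N1.+1 => -[//|N] hN; have {}hN1 := hN1 N.+1 (ltnW hN).
have W0 : 0 < W N.+1.
  by rewrite /W big_ord_recr /= ltr_wpDl // sumr_ge0 // => i _; exact: ltW.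
(* The mass put on the Cesaro average of length m + 1; the second case is the boundary term at
   [m = N]. *)
pose p m : R := if (m < N)%N then (s m - s m.+1) * m.+1%:R else s m * m.+1%:R.
have p0 m : 0 <= p m.
  by rewrite /p; case: ifP => _; rewrite mulr_ge0 // ?subr_ge0 // ltW.
pose D m x := m.+1%:R^-1 * (\sum_(n < m.+1) F n x) - psi x.
have aD m : adm (D m) by rewrite /D; admt; apply: aF.
have D2 m x : `|D m x| <= 2.
  apply: le_trans (ler_normB _ _) _.
  have := average_le (K := m.+1) (a := fun n => F n x) ler01 (fun n _ => F1 n x).
  have := psi1 x; lra.
have pW : \sum_(m < N.+1) p m = W N.+1.
  have := abel (fun=> 1) N; under eq_bigr do rewrite mulr1; rewrite -/(W _) => ->.
  rewrite big_ord_recr /= {2}/p ltnn sumr_const card_ord; congr (_ + _).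
  by apply: eq_bigr => i _; rewrite /p ltn_ord sumr_const card_ord.
have DE x : (W N.+1)^-1 * (\sum_(n < N.+1) s n * F n x) - psi x =
    (W N.+1)^-1 * \sum_(m < N.+1) p m * D m x.
  have -> : \sum_(m < N.+1) p m * D m x = \sum_(n < N.+1) s n * F n x - W N.+1 * psi x.
    rewrite -pW mulr_suml; under eq_bigr do rewrite mulrBr.
    rewrite sumrB; congr (_ - _); rewrite (abel (F^~ x)) big_ord_recr /=.
    have X0 k : k.+1%:R != 0 :> R by rewrite pnatr_eq0.
    congr (_ + _).
      by apply: eq_bigr => i _; rewrite /p ltn_ord mulrA mulfK.
    by rewrite /p ltnn mulrA mulfK.
  by rewrite mulrBr mulrA mulVf ?gt_eqF // mul1r.
have step : mean (fun x => ((W N.+1)^-1 * (\sum_(n < N.+1) s n * F n x) - psi x) ^+ 2) <=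
    (W N.+1)^-1 * \sum_(m < N.+1) p m * mean (fun x => D m x ^+ 2).
  have -> : \sum_(m < N.+1) p m * mean (fun x => D m x ^+ 2) =
      mean (fun x => \sum_(m < N.+1) p m * D m x ^+ 2).
    rewrite mean_sum; last by move=> m _; have := aD m => ?; admt.
    by apply: eq_bigr => m _; rewrite meanZ //; have := aD m => ?; admt.
  rewrite -meanZ; last by admt; apply: aD.
  apply: le_mean => [||x]; [by admt; apply: aF|by admt; apply: aD|].
  rewrite DE exprMn.
  have := @sqr_weighted_sum_le R N.+1 p (D^~ x) (fun i _ => p0 i); rewrite pW => h.
  apply: le_trans (ler_wpM2l (sqr_ge0 _) h) _.
  by rewrite le_eqVlt; apply/orP; left; apply/eqP; field; exact: lt0r_neq0.
apply: le_trans step _; rewrite ler_pdivrMl //.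
have mD m : mean (fun x => D m x ^+ 2) <= e / 2 + (if (m < m0)%N then 4 else 0).
  case: ltnP => mm0; last by rewrite addr0; apply: hm0; exact: leq_trans mm0 _.
  apply: (@le_trans _ _ 4); last by rewrite lerDr ltW // divr_gt0.
  by rewrite (_ : 4 = 2 ^+ 2); [apply: mean_sqr_le|ring].
apply: (@le_trans _ _ (\sum_(m < N.+1) p m * (e / 2 + (if (m < m0)%N then 4 else 0)))).
  by apply: ler_sum => m _; exact: ler_wpM2l.
under eq_bigr do rewrite mulrDr.
rewrite big_split /= -mulr_suml pW.
have hsmall : \sum_(m < N.+1) p m * (if (m < m0)%N then 4 else 0) <= 4 * (m0.+1%:R * s 0%N).
  have tele K : \sum_(m < K) (s m - s m.+1) = s 0%N - s K.
    by elim: K => [|K IH]; [rewrite big_ord0 subrr|rewrite big_ord_recr /= IH; ring].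
  have s0K K : s K <= s 0%N by elim: K => // K; apply: le_trans.
  have [Nm|mN] := leqP m0 N.
    rewrite big_ord_recr /= [in X in _ + X]ltnNge Nm /= mulr0 addr0.
    apply: (@le_trans _ _ (\sum_(m < N) (s m - s m.+1) * (4 * m0.+1%:R))).
      apply: ler_sum => m _; rewrite /p ltn_ord -mulrA; apply: ler_wpM2l.
        by rewrite subr_ge0.
      case: ltnP => mm0; last by rewrite mulr0 mulr_ge0.
      by rewrite mulrC ler_pM2l // ler_nat ltnW.
    rewrite -mulr_suml tele mulrC mulrA; apply: ler_wpM2l; first by rewrite mulr_ge0.
    by rewrite lerBlDr lerDl ltW.
  apply: (@le_trans _ _ (\sum_(m < N.+1) p m * 4)).
    by apply: ler_sum => m _; apply: ler_wpM2l => //; case: ifP.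
  rewrite -mulr_suml pW mulrC ler_pM2l //.
  apply: (@le_trans _ _ (\sum_(n < N.+1) s 0%N)); first by apply: ler_sum.
  rewrite sumr_const card_ord -[s 0%N *+ N.+1]mulr_natl ler_wpM2r ?ler_nat //; first exact: ltW.
  exact: leqW.
have : 8 * m0.+1%:R * s 0%N <= e * W N.+1 by move: hN1; rewrite ler_pdivrMr // [e * _]mulrC.
lra.
Qed.

End weighted.

(** * Counting hits and reindexing by them *)

Section generated.
Variables (R : realType) (Y : nat -> R).
Hypothesis Y01 : forall n, (1 <= n)%N -> Y n = 0 \/ Y n = 1.

Definition hit_count (K : nat) : nat := (\sum_(1 <= i < K.+1) (Y i == 1%R))%N.

Lemma hit_count_real K : \sum_(1 <= i < K.+1) Y i = (hit_count K)%:R.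
Proof.
rewrite /hit_count natr_sum [LHS]big_nat [RHS]big_nat; apply: eq_bigr => i /andP[i1 _].
by case: (Y01 i1) => ->; rewrite ?eqxx // eq_sym oner_eq0.
Qed.

Lemma hit_countS K : hit_count K.+1 = (hit_count K + (Y K.+1 == 1%R))%N.
Proof. by rewrite /hit_count big_nat_recr. Qed.

Lemma le_hit_count K L : (K <= L)%N -> (hit_count K <= hit_count L)%N.
Proof.
elim: L => [|L IH]; first by rewrite leqn0 => /eqP ->.
rewrite leq_eqVlt => /orP[/eqP -> //|]; rewrite ltnS => /IH /leq_trans; apply.
by rewrite hit_countS leq_addr.
Qed.

Lemma generated_seq_hit K : Y K.+1 = 1 -> generated_seq Y (hit_count K.+1) = K.+1.
Proof.
move=> YK; rewrite /generated_seq.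
set A := [set k : nat | _].
have AK : A K.+1.
  split=> [|j [j1 hj]]; first by split=> //; rewrite hit_count_real.
  rewrite leqNgt; apply/negP => jK.
  move/eqP: hj; rewrite hit_count_real eqr_nat hit_countS YK eqxx addn1.
  by have := le_hit_count (jK : (j <= K)%N) => h1 /eqP h2; rewrite h2 ltnn in h1.
case: xgetP => [k _ [[k1 hk] kmin]|/(_ K.+1) //].
apply/eqP; rewrite eqn_leq; apply/andP; split.
  by apply: kmin; case: AK.
by case: AK => _; apply.
Qed.

Lemma generated_seq_sum (V : lmodType R) (F : nat -> V) K :
  \sum_(1 <= n < (hit_count K).+1) F (generated_seq Y n) =
  \sum_(1 <= i < K.+1) Y i *: F i.
Proof.
elim: K => [|K IH]; first by rewrite /hit_count !big_geq.
rewrite [RHS]big_nat_recr //= -IH.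
have [Y0|Y1] := Y01 (ltn0Sn K).
  by rewrite hit_countS Y0 eq_sym oner_eq0 addn0 scale0r addr0.
have := generated_seq_hit Y1; rewrite hit_countS Y1 eqxx addn1 => gK.
by rewrite big_nat_recr //= gK scale1r.
Qed.

(** The count grows by at most one per step, so it skips no value. There are at most [K] hits up to
    [K], which makes [K] large whenever [N] is. *)
Lemma hit_count_surj N : (exists K, (N <= hit_count K)%N) -> (0 < N)%N ->
  exists2 K, hit_count K = N & (N <= K)%N.
Proof.
move=> ex N0; case: ex => K; elim: K => [|K IH].
  by rewrite /hit_count big_geq // leqNgt N0.
case: (leqP N (hit_count K)) => [h _|h h']; first exact: IH.
exists K.+1; last first.
  apply: leq_trans h' _; rewrite /hit_count.
  apply: (@leq_trans (\sum_(1 <= i < K.+2) 1)).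
    by apply: leq_sum => i _; case: (_ == _).
  by rewrite sum_nat_const_nat muln1 subn1.
apply/eqP; rewrite eqn_leq h' andbT hit_countS.
by case: (_ == _); rewrite ?addn1 ?addn0 // ltnW.
Qed.

End generated.

Lemma approximable_close (R : realType) (S : system R) (Phi Phi' : nat -> S -> R) :
  (forall N, adm (Phi N)) -> (forall N, adm (Phi' N)) ->
  (forall e, 0 < e -> exists N0, forall N, (N0 <= N)%N ->
     mean (fun x => (Phi' N x - Phi N x) ^+ 2) <= e) ->
  approximable Phi -> approximable Phi'.
Proof.
move=> aP aP' close aPhi e e0; have e4 : 0 < e / 4 by rewrite divr_gt0.
have [psi [apsi psi1 [N1 h1]]] := aPhi _ e4; have [N2 h2] := close _ e4.
exists psi; split=> //; exists (N1 + N2)%N => N hN.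
have {}h1 := h1 N ltac:(lia); have {}h2 := h2 N ltac:(lia).
have -> : (fun x => (Phi' N x - psi x) ^+ 2) =
    (fun x => ((Phi' N x - Phi N x) + (Phi N x - psi x)) ^+ 2).
  by apply/funext => x; rewrite addrA subrK.
have aPN := aP N; have aPN' := aP' N.
apply: le_trans (mean_sqrD (F := fun x => Phi' N x - Phi N x) (G := fun x => Phi N x - psi x) _ _) _;
  [by admt|by admt|lra].
Qed.

Section random_reduction.
Variables (R : realType) (a b : R) (X : nat -> R).
Hypotheses (a0 : 0 < a) (a1 : a < 1) (b0 : 0 < b) (b1 : b < 1).
Hypothesis X01 : forall n, (1 <= n)%N -> X n = 0 \/ X n = 1.

Definition two_term (S : system R) (f g : S -> R) (n : nat) (x : S) : R :=
  koop n f x * koop (fast b 1 n) g x.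

Definition weight (N : nat) : R := \sum_(1 <= n < N.+1) n%:R `^ (- a).

(** The property of one sample sequence shown to hold almost surely. The quantifier over systems
    lies inside it, so a single null set serves all of them. *)
Definition typical : Prop := forall (S : system R) (f g : S -> R),
  adm f -> adm g -> (forall x, `|f x| <= 1) -> (forall x, `|g x| <= 1) ->
  forall e, 0 < e -> exists N0, forall N, (N0 <= N)%N ->
    mean (fun x => (\sum_(1 <= n < N.+1) (X n - n%:R `^ (- a)) * two_term f g n x) ^+ 2)
      <= e * weight N ^+ 2.

Lemma weight_ge N : N%:R `^ (1 - a) <= weight N.
Proof.
case: N => [|N].
  by rewrite powR0 ?subr_eq0 ?gt_eqF // /weight big_geq.
have N0 : 0 < N.+1%:R :> R by [].
have -> : N.+1%:R `^ (1 - a) = \sum_(1 <= n < N.+2) N.+1%:R `^ (- a) :> R.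
  rewrite sumr_const_nat subn1 /= -[RHS]mulr_natl powRD; last by rewrite (gt_eqF N0) implybT.
  by rewrite powRr1.
rewrite /weight big_nat [leRHS]big_nat; apply: ler_sum => n /andP[n1 nN].
have n0 : 0 < n%:R :> R by rewrite ltr0n.
rewrite !powRN lef_pV2 ?posrE ?powR_gt0 //.
by apply: ge0_ler_powR; rewrite ?nnegrE // ?ler_nat // ltW.
Qed.

Lemma weight_unbounded C : exists N0, forall N, (N0 <= N)%N -> C <= weight N.
Proof.
have c0 : 0 < 1 - a by rewrite subr_gt0.
have [N0 h] := powR_nat_unbounded C c0.
by exists N0 => N /h hN; apply: le_trans hN (weight_ge N).
Qed.

Hypothesis X_typical : typical.

Local Notation S_ K := (\sum_(1 <= n < K.+1) X n).

(** The law of large numbers for the hits is the case of the one-point system with [f = g = 1] in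
    [typical]. *)
Lemma hits_sim e : 0 < e -> exists N0, forall N, (N0 <= N)%N ->
  0 < weight N /\ `|1 - S_ N / weight N| <= e.
Proof.
move=> e0; have e20 : 0 < e ^+ 2 by rewrite exprn_gt0.
have c1 (x : unit_system R) : `|(1 : R)| <= 1 by rewrite normr1.
have [N1 h1] := X_typical (adm_cst (unit_system R) 1) (adm_cst (unit_system R) 1) c1 c1 e20.
clear c1; have [N2 h2] := weight_unbounded 1.
exists (N1 + N2)%N => N hN.
have W0 : 0 < weight N by apply: lt_le_trans (h2 N _) => //; lia.
split=> //.
have := h1 N ltac:(lia); rewrite /=.
under eq_bigr do rewrite /two_term /koop !mulr1.
rewrite sumrB -/(weight N) -exprMn => h.
have h' : `|S_ N - weight N| <= e * weight N.
  rewrite -ler_sqr ?nnegrE ?mulr_ge0 ?(ltW e0) ?(ltW W0) //.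
  by rewrite real_normK ?num_real.
have -> : 1 - S_ N / weight N = (weight N - S_ N) / weight N.
  by rewrite mulrBl divff ?gt_eqF.
by rewrite normrM normfV (gtr0_norm W0) ler_pdivrMr // distrC.
Qed.

Variables (S : system R) (f g : S -> R).
Hypotheses (af : adm f) (ag : adm g) (f1 : forall x, `|f x| <= 1) (g1 : forall x, `|g x| <= 1).

Let F n x := two_term f g n x.

Let aF n : adm (F n).
Proof. by rewrite /F /two_term; admt. Qed.

Let F1 n x : `|F n x| <= 1.
Proof. by rewrite normrM -[leRHS]mulr1; apply: ler_pM => //; [exact: f1|exact: g1]. Qed.

Let s (n : nat) : R := n.+1%:R `^ (- a).

Let weightE N : weight N = \sum_(n < N) s n.
Proof. by rewrite /weight big_add1 big_mkord. Qed.

Let approx1 : approximable (fun N x => (weight N)^-1 *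
  \sum_(1 <= n < N.+1) n%:R `^ (- a) * F n x).
Proof.
have -> : (fun N x => (weight N)^-1 * \sum_(1 <= n < N.+1) n%:R `^ (- a) * F n x) =
   (fun N x => (\sum_(n < N) s n)^-1 * \sum_(n < N) s n * F n.+1 x).
  by apply/funext => N; apply/funext => x; rewrite weightE big_add1 big_mkord.
apply: (@weighted_approximable R S (fun n => F n.+1) s).
- by move=> n; exact: aF.
- by move=> n; exact: F1.
- by move=> n; exact: powR_gt0.
- move=> n; rewrite /s !powRN lef_pV2 ?posrE ?powR_gt0 //.
  by apply: ge0_ler_powR; rewrite ?nnegrE // ?ler_nat // ltW.
- by move=> C; have [N0 h] := weight_unbounded C; exists N0 => N; rewrite -weightE; exact: h.
(* The Cesaro result starts at index 0 and the random sequence at 1; this shift changes the average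
   by at most 2/N. *)
apply: (approximable_close (Phi := fun N x => N%:R^-1 * \sum_(n < N) F n x)).
- by move=> N; admt; apply: aF.
- by move=> N; admt; apply: aF.
- move=> e e0; have m0 : 0 < Num.min e 1 by rewrite lt_min e0 ltr01.
  have [N0 N00 hN0] := nat_above_ratio 2 m0; exists N0 => N hN.
  have N0' : 0 < N%:R :> R by rewrite ltr0n (leq_trans N00).
  apply: (@le_trans _ _ (Num.min e 1 ^+ 2)).
    apply: mean_sqr_le => [|x]; first by admt; apply: aF.
    rewrite -mulrBr -sumrB normrM ger0_norm ?invr_ge0 // ler_pdivrMl //.
    have := @sum_shift_le _ (fun n => F n x) N 1 (fun n => F1 n x).
    rewrite mulr1 -normrN -sumrN; under eq_bigr do rewrite opprB addn1.
    move=> h; apply: le_trans h _; apply: le_trans hN0 _.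
    by rewrite mulrC ler_wpM2r ?ler_nat // ltW.
  apply: (@le_trans _ _ (Num.min e 1)); last by rewrite ge_min lexx.
  rewrite expr2 -[leRHS]mulr1; apply: ler_wpM2l; first exact: ltW.
  by rewrite ge_min lexx orbT.
exact: cesaro_approximable.
Qed.

Let approx2 : approximable (fun N x => (weight N)^-1 * \sum_(1 <= n < N.+1) X n * F n x).
Proof.
apply: approximable_close approx1.
- by move=> N; admt; apply: aF.
- by move=> N; admt; apply: aF.
move=> e e0; have [N1 h1] := X_typical af ag f1 g1 e0.
have [N2 h2] := weight_unbounded 1.
exists (N1 + N2)%N => N hN.
have W0 : 0 < weight N by apply: lt_le_trans (h2 N _) => //; lia.
have -> : (fun x => ((weight N)^-1 * (\sum_(1 <= n < N.+1) X n * F n x) -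
    (weight N)^-1 * \sum_(1 <= n < N.+1) n%:R `^ (- a) * F n x) ^+ 2) =
  (fun x => (weight N)^-1 ^+ 2 * (\sum_(1 <= n < N.+1) (X n - n%:R `^ (- a)) * F n x) ^+ 2).
  apply/funext => x; rewrite -exprMn -mulrBr -sumrB; congr ((_ * _) ^+ 2).
  by apply: eq_bigr => n _; rewrite mulrBl.
rewrite meanZ; last by admt; apply: aF.
rewrite exprVn ler_pdivrMl ?exprn_gt0 // mulrC.
by apply: h1; lia.
Qed.

Let S_ge0 N : 0 <= S_ N.
Proof.
by rewrite big_nat; apply: sumr_ge0 => n /andP[/X01[->|->] _].
Qed.

Let sum_le N x : `|\sum_(1 <= n < N.+1) X n * F n x| <= S_ N.
Proof.
apply: le_trans (ler_norm_sum _ _ _) _.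
rewrite big_nat [leRHS]big_nat; apply: ler_sum => n /andP[/X01[->|->] _].
  by rewrite mul0r normr0.
by rewrite mul1r.
Qed.

(** Changing the normalisation from [weight N] to the number of hits costs at most |1 - S_N / weight
    N|, as the sum is bounded by S_N. When S_N = 0 the sum vanishes too. *)
Let approx3 : approximable (fun N x => (S_ N)^-1 * \sum_(1 <= n < N.+1) X n * F n x).
Proof.
apply: approximable_close approx2.
- by move=> N; admt; apply: aF.
- by move=> N; admt; apply: aF.
move=> e e0; have m0 : 0 < Num.min e 1 by rewrite lt_min e0 ltr01.
have [N1 h1] := hits_sim m0; exists N1 => N /h1[W0 h].
apply: (@le_trans _ _ (Num.min e 1 ^+ 2)).
  apply: mean_sqr_le => [|x]; first by admt; apply: aF.
  apply: le_trans h; rewrite -mulrBl; have := sum_le N x; have := S_ge0 N.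
  set z := \sum_(1 <= n < N.+1) X n * F n x; move: (S_ N) => c; rewrite le_eqVlt => /orP[/eqP <-|c0].
    by rewrite normr_le0 => /eqP ->; rewrite mulr0 normr0.
  move=> zc; have -> : (c^-1 - (weight N)^-1) * z = (1 - c / weight N) * (c^-1 * z).
    by field; rewrite !gt_eqF.
  rewrite normrM -[leRHS]mulr1; apply: ler_wpM2l => //.
  by rewrite normrM normfV (gtr0_norm c0) ler_pdivrMl // mulr1.
apply: (@le_trans _ _ (Num.min e 1)); last by rewrite ge_min lexx.
rewrite expr2 -[leRHS]mulr1; apply: ler_wpM2l; first exact: ltW.
by rewrite ge_min lexx orbT.
Qed.

(** An average over the first [N] hits is the hit-normalised sum up to some [K] with exactly [N]
    hits, and [K >= N] puts it in the range of [approx3]. *)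
Lemma random_average_approximable :
  approximable (fun N x => N%:R^-1 *
    \sum_(1 <= n < N.+1) F (generated_seq X n) x).
Proof.
move=> e e0; have [psi [apsi psi1 [N0 h0]]] := approx3 e0.
exists psi; split=> //; exists N0.+1 => N hN.
have N_gt0 : (0 < N)%N by apply: leq_trans hN.
have [] := @hit_count_surj R X N => //.
  have [N1 h1] := hits_sim (e := 1 / 2) ltac:(by rewrite divr_gt0).
  have [N2 h2] := weight_unbounded (2 * N%:R).
  exists (N1 + N2)%N; set K := (N1 + N2)%N.
  have [W0 hK] := h1 K (leq_addr _ _); have {}h2 := h2 K (leq_addl _ _).
  rewrite -(ler_nat R) -hit_count_real //.
  move: hK; rewrite ler_norml => /andP[_ hK].
  have : S_ K / weight K >= 1 / 2 by lra.
  by rewrite ler_pdivlMr //; lra.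
move=> K KN NK.
have := h0 K (leq_trans (ltnW hN) NK).
congr (mean _ <= _); apply/funext => x; congr ((_^-1 * _ - _) ^+ 2).
  by rewrite hit_count_real // KN.
rewrite -KN; have := @generated_seq_sum R X X01 R^o (fun n => F n x) K.
by move=> ->; apply: eq_bigr.
Qed.

End random_reduction.

(** * The random part for a typical sequence *)

Section random_estimate.
Variables (R : realType) (v : nat -> nat).
Hypothesis v_gt : forall n, (n < v n)%N.
Hypothesis v_mono : forall n r, (v n + r <= v (n + r))%N.

Let w n := (v n - n.+1)%N.

Definition gap (r n : nat) : nat := (v (n + r) - v n)%N.

Definition reim (part : bool) (z : R[i]) : R := if part then complex.Re z else complex.Im z.

(* The indices with a prescribed gap; the parity of [n %/ r] separates them into
   two classes in which the pairs [{n, n + r}] are pairwise disjoint. *)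
Definition gap_class (N r k : nat) (par : bool) : seq nat :=
  [seq n <- iota 0 (N - r) | (gap r n == k) && (odd (n %/ r) == par)].

Definition small_correlations (y : nat -> R) (z : R[i]) (N H K D : nat) (u : R) : Prop :=
  forall r, (0 < r < H)%N -> forall k, (k < K)%N -> forall t, (t < D + D)%N ->
  forall par part, `|\sum_(n <- gap_class N r k par)
     y n * y (n + r)%N * reim part (z ^+ (t * (v n - n.+1)))| <= u.

Section system.
Variables (S : system R) (f g : S -> R).
Hypotheses (af : adm f) (ag : adm g) (f1 : forall x, `|f x| <= 1) (g1 : forall x, `|g x| <= 1).
Local Notation adm := (@adm R S).
Local Notation mean := (@mean R S).
Local Notation U := (@koop R S).

(** In the correlation at distance [r] the function g U^k g depends on [n] only through the gap [k].
    For each [k] the sum over [n] is therefore a combination of shifts of one bounded function, to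
    which [transference] applies; adding up the gaps gives the factor [K]. *)
Lemma random_vdc (y : nat -> R) (z : R[i]) (N H K D : nat) (u : R) :
  (0 < H)%N -> (0 < D)%N -> 0 < u -> (D + D)%N.-primitive_root z ->
  (forall n, (n < N)%N -> (v n <= D)%N) ->
  (forall r n, (0 < r < H)%N -> (n + r < N)%N -> (gap r n < K)%N) ->
  small_correlations y z N H K D u ->
  mean (fun x => (\sum_(n < N) y n * (U n.+1 f x * U (v n) g x)) ^+ 2) <=
  (N + H)%:R * ((\sum_(n < N) y n ^+ 2) / H%:R + K%:R * (4 * u)).
Proof.
move=> H0 D0 u0 zP vD gK small.
pose uu n x := y n * (U n.+1 f x * U (v n) g x).
have auu n : adm (uu n) by rewrite /uu; admt.
have FG1 (n m : nat) x : `|U n f x * U m g x| <= 1.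
  by rewrite normrM -[leRHS]mulr1; apply: ler_pM => //; [exact: f1|exact: g1].
have -> : (N + H)%N = (N + 1 * H)%N by rewrite mul1n.
apply: (@van_der_corput _ S uu N H 1) => //.
- by rewrite !mulr_ge0 // ltW.
- apply: ler_sum => n _; apply: mean_le_cst => [|x]; first by admt.
  rewrite exprMn -[leRHS]mulr1; apply: ler_wpM2l; first exact: sqr_ge0.
  by rewrite -real_normK ?num_real // expr_le1.
move=> r /[dup] hr /andP[r0 rH]; rewrite mul1n.
pose F x := f x * U r f x.
have aF : adm F by rewrite /F; admt.
have F1 x : `|F x| <= 1.
  by rewrite normrM -[leRHS]mulr1; apply: ler_pM => //; exact: f1.
pose G k x := g x * U k g x.
have aG k : adm (G k) by rewrite /G; admt.
have G1 k x : `|G k x| <= 1.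
  by rewrite normrM -[leRHS]mulr1; apply: ler_pM => //; exact: g1.
have term n : mean (fun x => uu n x * uu (n + r)%N x) =
    y n * y (n + r)%N * mean (fun x => F x * U (w n) (G (gap r n)) x).
  rewrite -(mean_koop_prod n.+1 aF); last by admt.
  rewrite -meanZ; last by admt.
  congr (mean _); apply/funext => x; rewrite /uu /F /G /koop -!iterD.
  have vn : (w n + n.+1 = v n)%N by rewrite /w subnK.
  have gn : (gap r n + v n = v (n + r))%N.
    by rewrite /gap subnK // (leq_trans _ (v_mono n r)) // leq_addr.
  rewrite addnS (addnC r n) vn gn.
  ring.
pose c n := y n * y (n + r)%N.
pose s k := [seq n <- iota 0 (N - r) | gap r n == k].
pose Z k x := \sum_(n <- s k) c n * U (w n) (G k) x.
have aZ k : adm (Z k) by rewrite /Z; admt.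
have split_sum : \sum_(n < N - r) mean (fun x => uu n x * uu (n + r)%N x) =
    \sum_(k < K) mean (fun x => F x * Z k x).
  transitivity (\sum_(n < N - r) \sum_(k < K)
      if gap r n == k then c n * mean (fun x => F x * U (w n) (G k) x) else 0).
    apply: eq_bigr => n _; rewrite term.
    have hk : (gap r n < K)%N by apply: gK => //; rewrite addnC -ltn_subRL.
    rewrite (bigD1 (Ordinal hk)) //= eqxx big1 ?addr0 // => k kn.
    by rewrite ifN //; apply: contra kn => /eqP kE; apply/eqP/val_inj.
  rewrite exchange_big /=; apply: eq_bigr => k _.
  have -> : (fun x => F x * Z k x) = (fun x => \sum_(n <- s k) c n * (F x * U (w n) (G k) x)).
    by apply/funext => x; rewrite mulr_sumr; apply: eq_bigr => n _; rewrite mulrCA.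
  rewrite mean_sum; last by move=> n _; admt.
  rewrite /s big_filter -[X in iota 0 X]subn0 -/(index_iota 0 (N - r)) big_mkord.
  by rewrite -big_mkcond /=; apply: eq_bigr => n _; rewrite meanZ //; admt.
rewrite split_sum; apply: le_trans (ler_norm_sum _ _ _) _.
have -> : K%:R * (4 * u) = \sum_(k < K) 4 * u by rewrite sumr_const card_ord mulr_natl.
apply: ler_sum => k _; rewrite -[leRHS]mul1r; apply: mean_prod_le => //.
  by rewrite mulr_gt0.
(* The outer 2 comes from [transference], the two squares are the real and imaginary parts, and each
   2u collects the two parity classes. *)
rewrite (_ : (4 * u) ^+ 2 = 2 * ((2 * u) ^+ 2 + (2 * u) ^+ 2)); last by ring.
apply: (transference (aG k) (G1 k) D0 zP) => [n|t tD].
  rewrite mem_filter mem_iota add0n => /and3P[_ _ nN].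
  apply: leq_trans (leq_subr _ _) (vD n _).
  by apply: leq_trans nN (leq_subr _ _).
have part_le part : (\sum_(n <- s k) c n * reim part (z ^+ (t * w n))) ^+ 2 <= (2 * u) ^+ 2.
  rewrite -real_normK ?num_real // lerXn2r ?nnegrE ?mulr_ge0 // ?(ltW u0) //.
  have -> : \sum_(n <- s k) c n * reim part (z ^+ (t * w n)) =
      \sum_(n <- gap_class N r k true) y n * y (n + r)%N * reim part (z ^+ (t * w n)) +
      \sum_(n <- gap_class N r k false) y n * y (n + r)%N * reim part (z ^+ (t * w n)).
    rewrite /s /gap_class !big_filter (bigID (fun n => odd (n %/ r))) /=.
    by congr (_ + _); apply: eq_bigl => n; case: (odd _); rewrite ?andbT ?andbF.
  apply: le_trans (ler_normD _ _) _; rewrite (_ : 2 * u = u + u); last by ring.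
  by apply: lerD; exact: small.
apply: lerD; [exact: (part_le true)|exact: (part_le false)].
Qed.

End system.
End random_estimate.

(** * Choice of exponents for the random part *)

Section exponents.
Variables (R : realType) (a b : R).
Hypotheses (a0 : 0 < a) (b0 : 0 < b) (ab : b + 2 * a < 1 / 2).

(** With u = [corr_bound] the quotient u^2 / N^(1-2a) in Bernstein's exponent is N^(1-4a-2b-4s),
    where s is [slack]; dividing by 8 makes this N^(4s). At the same time N times the gap count
    times u is of order N^(2-2a-s), a saving of N^(-s). *)
Definition slack : R := (1 - 4 * a - 2 * b) / 8.
Definition vdc_length (N : nat) : nat := (Num.truncn (N%:R `^ (a + slack))).+1.
Definition gap_bound (N : nat) : nat :=
  (Num.truncn ((1 + b) * (vdc_length N)%:R * N%:R `^ b)).+3.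
Definition corr_bound (N : nat) : R := N%:R `^ (1 - 3 * a - b - 2 * slack).

Lemma slack_gt0 : 0 < slack.
Proof. by move: ab; rewrite /slack; lra. Qed.

Let b1 : b < 1. Proof. move: a0 ab; lra. Qed.

Let powR_ge1 (N : nat) (p : R) : (0 < N)%N -> 0 <= p -> 1 <= N%:R `^ p.
Proof. by move=> N0 p0; rewrite -[leLHS](powRr0 N%:R); apply: ler_powR => //; rewrite ler1n. Qed.

Lemma vdc_length_le N : (0 < N)%N -> N%:R `^ (a + slack) <= (vdc_length N)%:R <= 2 * N%:R `^ (a + slack).
Proof.
move=> N0; have := powR_ge1 N0 (addr_ge0 (ltW a0) (ltW slack_gt0)) => h.
have h0 : 0 <= N%:R `^ (a + slack) by exact: powR_ge0.
have /andP[t1 t2] := truncn_itv h0.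
rewrite /vdc_length; move: t1 t2; rewrite -natr1 => t1 t2; apply/andP; split; lra.
Qed.

Lemma gap_bound_le N : (0 < N)%N -> (gap_bound N)%:R <= 7 * N%:R `^ (a + slack + b).
Proof.
move=> N0; have /andP[h1 h2] := vdc_length_le N0.
have NR : 0 < N%:R :> R by rewrite ltr0n.
have h3 := powR_ge1 N0 (addr_ge0 (addr_ge0 (ltW a0) (ltW slack_gt0)) (ltW b0)).
have t1 : (Num.truncn ((1 + b) * (vdc_length N)%:R * N%:R `^ b))%:R <=
    (1 + b) * (vdc_length N)%:R * N%:R `^ b.
  rewrite truncn_le.
  by rewrite !mulr_ge0 ?powR_ge0 // addr_ge0 // ltW.
rewrite /gap_bound -addn3 natrD.
have t2 : (1 + b) * (vdc_length N)%:R * N%:R `^ b <= 2 * (2 * N%:R `^ (a + slack)) * N%:R `^ b.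
  apply: ler_wpM2r; first exact: powR_ge0.
  by apply: ler_pM => //; [rewrite addr_ge0 // ltW|move: b1; lra].
have E : N%:R `^ (a + slack + b) = N%:R `^ (a + slack) * N%:R `^ b.
  by rewrite powRD // (gt_eqF NR) implybT.
rewrite E in h3 *; lra.
Qed.

(* The condition [b + 2 a < 1 / 2] makes this a power saving. *)
Lemma main_term_le N : (0 < N)%N ->
  N%:R * ((gap_bound N)%:R * corr_bound N) <= 7 * N%:R `^ (- slack) * (N%:R `^ (1 - a)) ^+ 2.
Proof.
move=> N0; have NR : 0 < N%:R :> R by rewrite ltr0n.
have P p q : N%:R `^ p * N%:R `^ q = N%:R `^ (p + q) :> R.
  by rewrite powRD // (gt_eqF NR) implybT.
apply: (@le_trans _ _ (N%:R * (7 * N%:R `^ (a + slack + b) * corr_bound N))).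
  apply: ler_wpM2l => //; apply: ler_wpM2r; first exact: powR_ge0.
  exact: gap_bound_le.
rewrite /corr_bound -mulrA P mulrCA -mulrA; apply: ler_wpM2l => //.
rewrite expr2 !P -{1}(powRr1 (ltW NR)) P le_eqVlt; apply/orP; left; apply/eqP.
by congr (_ `^ _); ring.
Qed.

Lemma diagonal_le N : (0 < N)%N ->
  N%:R / (vdc_length N)%:R <= N%:R `^ (- slack) * N%:R `^ (1 - a).
Proof.
move=> N0; have NR : 0 < N%:R :> R by rewrite ltr0n.
have /andP[h1 _] := vdc_length_le N0.
have P p q : N%:R `^ p * N%:R `^ q = N%:R `^ (p + q) :> R.
  by rewrite powRD // (gt_eqF NR) implybT.
rewrite ler_pdivrMr ?ltr0n //.
apply: (@le_trans _ _ (N%:R `^ (- slack) * N%:R `^ (1 - a) * N%:R `^ (a + slack))).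
  rewrite !P -{1}(powRr1 (ltW NR)) le_eqVlt; apply/orP; left; apply/eqP.
  by congr (_ `^ _); ring.
by apply: ler_wpM2l => //; rewrite mulr_ge0 // powR_ge0.
Qed.

Lemma vdc_length_small N : (0 < N)%N -> (vdc_length N)%:R <= 3 * N%:R :> R.
Proof.
move=> N0; have /andP[_ h] := vdc_length_le N0; apply: le_trans h _.
have : N%:R `^ (a + slack) <= N%:R `^ 1 :> R.
  by apply: ler_powR; rewrite ?ler1n // /slack; move: a0 b0 ab; lra.
rewrite powRr1 // => h; have : 0 <= N%:R :> R by []. lra.
Qed.

Let v n : nat := fast b (1 : R) n.+1.

Lemma fast_gt n : (n < v n)%N.
Proof. by have := @fast_ge R b 1 1 b0 ltr01 (lexx 1) n.+1; rewrite mul1n. Qed.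

Lemma fast_add_ge n r : (v n + r <= v (n + r))%N.
Proof.
have /andP[p1 _] := @power_incr R b b0 n.+1 r isT.
have /andP[l1 l2] := @fast_real R b 1 ltr01 n.+1.
have /andP[k1 k2] := @fast_real R b 1 ltr01 (n + r).+1.
rewrite !mul1r in l1 l2 k1 k2.
rewrite -ltnS -(ltr_nat R); apply: le_lt_trans k2; rewrite natrD.
have hb : r%:R <= (1 + b) * r%:R * n.+1%:R `^ b.
  rewrite mulrAC; have : 1 <= (1 + b) * n.+1%:R `^ b.
    by rewrite -[leLHS]mulr1; apply: ler_pM => //; [rewrite lerDl ltW|apply: powR_ge1 => //; exact: ltW].
  by move=> h; rewrite -[leLHS]mul1r; apply: ler_wpM2r.
rewrite addSn in p1; lra.
Qed.

Lemma fast_le N n : (n < N)%N -> (v n <= N * N)%N.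
Proof.
move=> nN; have /andP[l1 _] := @fast_real R b 1 ltr01 n.+1.
rewrite -(ler_nat R); apply: le_trans l1 _; rewrite mul1r.
have N0 : (0 < N)%N by apply: leq_trans nN.
apply: (@le_trans _ _ (N%:R `^ (1 + b))).
  by apply: ge0_ler_powR; rewrite ?nnegrE ?ler_nat // addr_ge0 // ltW.
apply: (@le_trans _ _ (N%:R `^ 2%:R)); first by apply: ler_powR; rewrite ?ler1n //; move: b1; lra.
by rewrite powR_mulrn // natrM.
Qed.

Lemma gap_lt N r n : (0 < r < vdc_length N)%N -> (n + r < N)%N -> (gap v r n < gap_bound N)%N.
Proof.
move=> /andP[r0 rH] nrN.
have /andP[_ p2] := @power_incr R b b0 n.+1 r isT.
have /andP[l1 l2] := @fast_real R b 1 ltr01 n.+1.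
have /andP[k1 k2] := @fast_real R b 1 ltr01 (n + r).+1.
rewrite !mul1r in l1 l2 k1 k2; rewrite addSn in p2.
have vv : (v n <= v (n + r))%N by apply: leq_trans (fast_add_ge n r); rewrite leq_addr.
rewrite /gap -(ltr_nat R) natrB //.
have t1 : (1 + b) * r%:R * (n + r).+1%:R `^ b <= (1 + b) * (vdc_length N)%:R * N%:R `^ b.
  apply: ler_pM; rewrite ?powR_ge0 ?mulr_ge0 ?addr_ge0 ?(ltW b0) //.
    by rewrite ler_pM2l ?addr_gt0 // ler_nat ltnW.
  by apply: ge0_ler_powR; rewrite ?nnegrE ?ler_nat // ltW.
have t2 := truncnS_gt ((1 + b) * (vdc_length N)%:R * N%:R `^ b).
have -> : (gap_bound N)%:R = (Num.truncn ((1 + b) * (vdc_length N)%:R * N%:R `^ b)).+1%:R + 2 :> R.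
  by rewrite /gap_bound -addn2 natrD.
rewrite -[(fast _ _ _).+1%:R]natr1 in l2.
rewrite /v; lra.
Qed.

End exponents.

Section typical_from_small.
Variables (R : realType) (a b : R) (X : nat -> R).
Hypotheses (a0 : 0 < a) (a1 : a < 1) (b0 : 0 < b) (ab : b + 2 * a < 1 / 2).
Hypothesis X01 : forall n, (1 <= n)%N -> X n = 0 \/ X n = 1.

Let v n : nat := fast b (1 : R) n.+1.
Let y n : R := X n.+1 - n.+1%:R `^ (- a).

Hypothesis small : exists N0, forall N, (N0 <= N)%N -> exists2 z : R[i],
  (N * N + N * N)%N.-primitive_root z &
  small_correlations v y z N (vdc_length a b N) (gap_bound a b N) (N * N) (corr_bound a b N).

Let W N := weight a N.

(** For X in {0, 1} and 0 <= s <= 1 one has (X - s)^2 <= X + s = (X - s) + 2s. The sum of the [y n]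
    is kept as an unknown, controlled only afterwards. *)
Let y_sqr N : \sum_(n < N) y n ^+ 2 <= `|\sum_(n < N) y n| + 2 * W N.
Proof.
have -> : W N = \sum_(n < N) n.+1%:R `^ (- a) by rewrite /W /weight big_add1 big_mkord.
apply: (@le_trans _ _ (\sum_(n < N) y n + 2 * \sum_(n < N) n.+1%:R `^ (- a))); last first.
  by rewrite lerD2r ler_norm.
rewrite mulr_sumr -big_split /=; apply: ler_sum => n _; rewrite /y.
have s0 : 0 <= n.+1%:R `^ (- a) :> R by exact: powR_ge0.
have s1 : n.+1%:R `^ (- a) <= 1 :> R.
  rewrite powRN invf_le1 ?powR_gt0 // -[leLHS](powRr0 n.+1%:R); apply: ler_powR; rewrite ?ler1n //.
  exact: ltW.
move: (n.+1%:R `^ (- a)) s0 s1 => s s0 s1.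
have ss : s ^+ 2 <= s by rewrite expr2 -[leRHS]mulr1; apply: ler_wpM2l.
case: (X01 (ltn0Sn n)) => ->; first by rewrite sub0r sqrrN; lra.
by rewrite (_ : (1 - s) ^+ 2 = 1 - 2 * s + s ^+ 2); [lra|ring].
Qed.

Let estimate : exists N0, forall N, (N0 <= N)%N ->
  forall (S : system R) (f g : S -> R), adm f -> adm g ->
  (forall x, `|f x| <= 1) -> (forall x, `|g x| <= 1) ->
  mean (fun x => (\sum_(n < N) y n * (koop n.+1 f x * koop (v n) g x)) ^+ 2) <=
  4 * N%:R `^ (- slack a b) * (W N * (`|\sum_(n < N) y n| + 30 * W N)).
Proof.
have [N0 hN0] := small; exists N0.+1 => N hN S f g af ag f1 g1.
have N_gt0 : (0 < N)%N by apply: leq_trans hN.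
have NR : 0 < N%:R :> R by rewrite ltr0n.
have [z zP sm] := hN0 N (ltnW hN).
have u0 : 0 < corr_bound a b N by exact: powR_gt0.
have NN0 : (0 < N * N)%N by rewrite muln_gt0 N_gt0.
have vN n : (n < N)%N -> (v n <= N * N)%N by exact: (fast_le a0 b0 ab).
have gN r n : (0 < r < vdc_length a b N)%N -> (n + r < N)%N -> (gap v r n < gap_bound a b N)%N.
  exact: gap_lt.
apply: le_trans (random_vdc (fast_gt b0) (fast_add_ge b0) af ag f1 g1 (ltn0Sn _) NN0 u0 zP vN gN sm) _.
have H3 := vdc_length_small a0 b0 ab N_gt0.
have d1 := diagonal_le a0 ab N_gt0.
have m1 := main_term_le a0 b0 ab N_gt0.
have wN : N%:R `^ (1 - a) <= W N by exact: weight_ge.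
have yW := y_sqr N.
set Z := `|_| in yW *; set H := (vdc_length a b N)%:R in H3 d1 *.
have e0 : 0 <= N%:R `^ (- slack a b) by exact: powR_ge0.
move: (N%:R `^ (- slack a b)) e0 d1 m1 => e e0 d1 m1.
have Z0 : 0 <= Z by exact: normr_ge0.
have H0 : 0 < H by rewrite /H ltr0n.
have q0 : 0 <= \sum_(n < N) y n ^+ 2 by apply: sumr_ge0 => n _; exact: sqr_ge0.
move: (\sum_(n < N) y n ^+ 2) q0 yW => q q0 yW.
have W0 : 0 <= W N by exact: le_trans wN.
have w2 : (N%:R `^ (1 - a)) ^+ 2 <= W N ^+ 2 by rewrite lerXn2r ?nnegrE.
have A : N%:R * (q / H) <= e * W N * (Z + 2 * W N).
  rewrite mulrCA mulrC; apply: ler_pM => //; first by rewrite divr_ge0 // ltW.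
  by apply: le_trans d1 _; exact: ler_wpM2l.
have B : N%:R * ((gap_bound a b N)%:R * corr_bound a b N) <= 7 * e * W N ^+ 2.
  by apply: le_trans m1 _; apply: ler_wpM2l => //; rewrite mulr_ge0.
apply: (@le_trans _ _ (4 * N%:R * (q / H + (gap_bound a b N)%:R * (4 * corr_bound a b N)))).
  apply: ler_wpM2r; last by rewrite natrD -/H; lra.
  by rewrite addr_ge0 ?divr_ge0 ?(ltW H0) // !mulr_ge0 // ltW.
apply: (@le_trans _ _ (4 * (e * W N * (Z + 2 * W N) + 4 * (7 * e * W N ^+ 2)))).
  rewrite -mulrA ler_pM2l // mulrDr; apply: lerD => //.
  by apply: le_trans (ler_wpM2l _ B) => //; rewrite le_eqVlt; apply/orP; left; apply/eqP; ring.
by rewrite le_eqVlt; apply/orP; left; apply/eqP; ring.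
Qed.

(* Applied to the one-point system the estimate bounds its own error term. *)
Lemma typical_of_small : typical a b X.
Proof.
have [N1 h1] := estimate.
move=> S f g af ag f1 g1 e e0.
(* Any number above 124 = 4 * 31 would do: if |sum y| exceeded [W N], the estimate on one point
   would bound its square by 124/200 of itself. *)
have m0 : 0 < Num.min e 1 / 200 by rewrite divr_gt0 // lt_min e0 ltr01.
have [N2 h2] := powR_nat_small (slack_gt0 ab) m0.
exists (N1 + N2)%N => N hN.
have hN1 : (N1 <= N)%N by apply: leq_trans hN; rewrite leq_addr.
have [N0 small_d] := h2 N (leq_trans (leq_addl _ _) hN).
have W0 : 0 < W N by apply: lt_le_trans (weight_ge a0 a1 N); rewrite powR_gt0 // ltr0n.
have d0 : 0 <= N%:R `^ (- slack a b) by exact: powR_ge0.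
have me : Num.min e 1 <= e by rewrite ge_min lexx.
have me1 : Num.min e 1 <= 1 by rewrite ge_min lexx orbT.
have Zle : `|\sum_(n < N) y n| <= W N.
  have c1 (x : unit_system R) : `|(1 : R)| <= 1 by rewrite normr1.
  have := h1 N hN1 (unit_system R) _ _ (adm_cst _ 1) (adm_cst _ 1) c1 c1.
  rewrite /= /koop; under eq_bigr do rewrite !mulr1.
  rewrite -[X in X <= _ -> _]real_normK ?num_real //; clear c1.
  set Z := `|_|; have Z0 : 0 <= Z by exact: normr_ge0.
  move: (N%:R `^ (- slack a b)) d0 small_d => d d0 dle h; rewrite leNgt; apply/negP => WZ.
  have : 4 * d * (W N * (Z + 30 * W N)) <= 4 * d * (Z * (31 * Z)).
    apply: ler_wpM2l; first by rewrite mulr_ge0.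
    by apply: ler_pM; rewrite ?addr_ge0 ?mulr_ge0 ?(ltW W0) //; lra.
  have Zp : 0 < Z by apply: lt_trans WZ.
  have Z2 : 0 < Z ^+ 2 by rewrite exprn_gt0.
  have : d * Z ^+ 2 <= 1 / 200 * Z ^+ 2 by rewrite ler_pM2r //; lra.
  have -> : 4 * d * (Z * (31 * Z)) = 124 * (d * Z ^+ 2) by ring.
  lra.
have := h1 N hN1 S f g af ag f1 g1.
under [X in _ -> mean X <= _]eq_fun do rewrite big_add1 big_mkord.
move/le_trans; apply.
rewrite -/(W N); move: (N%:R `^ (- slack a b)) d0 small_d => d d0 dle.
apply: (@le_trans _ _ (4 * d * (W N * (31 * W N)))).
  apply: ler_wpM2l; first by rewrite mulr_ge0.
  by apply: ler_wpM2l; [exact: ltW|lra].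
have W2 : 0 < W N ^+ 2 by rewrite exprn_gt0.
have -> : 4 * d * (W N * (31 * W N)) = 124 * (d * W N ^+ 2) by ring.
have : d * W N ^+ 2 <= e / 200 * W N ^+ 2 by rewrite ler_pM2r //; lra.
have : 0 < e * W N ^+ 2 by rewrite mulr_gt0.
lra.
Qed.

End typical_from_small.

(** * Almost every sequence is typical *)

Lemma measure_bigU_le {d} {T : measurableType d} {R : realType} (mu : {measure set T -> \bar R})
    (I : Type) (s : seq I) (A : I -> set T) : (forall i, measurable (A i)) ->
  (mu (\big[setU/set0]_(i <- s) A i) <= \sum_(i <- s) mu (A i))%E.
Proof.
move=> mA; elim: s => [|i s IH]; first by rewrite !big_nil measure0.
rewrite !big_cons; apply: (@le_trans _ _ (mu (A i) + mu (\big[setU/set0]_(j <- s) A j)))%E.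
  by apply: measureU2 => //; exact: bigsetU_measurable.
by rewrite leeD2l.
Qed.

(** The majorant 1 / ((n+1)(n+2)) is chosen because its partial sums telescope to values at most
    1. *)
Lemma borel_cantelli_eventually {d} {T : measurableType d} {R : realType} (P : probability T R)
    (F : nat -> set T) N0 : (forall n, measurable (F n)) ->
  (forall n, (N0 <= n)%N -> (P (F n) <= ((n.+1 * n.+2)%:R^-1)%:E)%E) ->
  {ae P, forall w, exists N1, forall n, (N1 <= n)%N -> ~ F n w}.
Proof.
move=> mF Fle; pose G n := if (N0 <= n)%N then F n else set0.
have mG n : measurable (G n) by rewrite /G; case: ifP.
have telescope n : \sum_(0 <= k < n) ((k.+1 * k.+2)%:R^-1 : R) = 1 - n.+1%:R^-1.
  elim: n => [|n IH]; first by rewrite big_nil invr1 subrr.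
  rewrite big_nat_recr //= IH natrM -[n.+2%:R]natr1.
  have h : n.+1%:R != 0 :> R by [].
  have h1 : n.+1%:R + 1 != 0 :> R by rewrite natr1.
  move: (n.+1%:R : R) h h1 => x h h1; by field; rewrite h h1.
have fin : (\sum_(n <oo) P (G n) < +oo)%E.
  apply: (@le_lt_trans _ _ 1%E); last exact: ltry.
  apply: lime_le; first by apply: is_cvg_nneseries => n _ _; exact: measure_ge0.
  apply: nearW => n.
  apply: (@le_trans _ _ (\sum_(0 <= k < n) ((k.+1 * k.+2)%:R^-1)%:E)%E).
    apply: lee_sum => k _; rewrite /G; case: ifP => [|_]; first exact: Fle.
    by rewrite measure0 lee_fin.
  by rewrite sumEFin telescope lee_fin lerBlDr lerDl.
exists (lim_sup_set G); split; first by apply: bigcap_measurable => // k _; exact: bigcup_measurable.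
  exact: lim_sup_set_cvg0.
move=> w /= nw n _; apply: contrapT => h; apply: nw; exists (maxn n N0) => k; rewrite geq_max.
move=> /andP[nk N0k] Fk; apply: h; exists k => //=; by rewrite /G N0k.
Qed.

(** * The joint law of finitely many variables *)

Section joint_law.
Variables (R : realType) (d : measure_display) (Omega : measurableType d) (P : probability Omega R).
Variables (X : nat -> {RV P >-> R}) (a : R).
Hypothesis X01 : forall n w, (1 <= n)%N -> X n w = 0 \/ X n w = 1.
Hypothesis X_indep : independent_RVs [set n | (1 <= n)%N] X.
Hypothesis a_gt0 : 0 < a.
Hypothesis X_law : forall n, (1 <= n)%N -> P [set w | X n w = 1] = (n%:R `^ (- a))%:E.

Definition hits N (w : Omega) : {ffun 'I_N -> bool} := [ffun i : 'I_N => X i.+1 w == 1].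

Definition density N (i : 'I_N) : R := i.+1%:R `^ (- a).

Lemma density01 N (i : 'I_N) : 0 <= density i <= 1.
Proof.
rewrite /density powR_ge0 /= powRN invf_le1 ?powR_gt0 // -[leLHS](powRr0 i.+1%:R).
by apply: ler_powR; rewrite ?ler1n // ltW.
Qed.

Let X_eq n (x : bool) : (1 <= n)%N ->
  X n @^-1` [set x%:R] = if x then [set w | X n w = 1] else ~` [set w | X n w = 1].
Proof.
move=> n1; apply/seteqP; case: x; split=> w //=; rewrite /preimage /=.
- by move=> -> /eqP; rewrite eq_sym oner_eq0.
- by case: (X01 w n1).
Qed.

Let mX1 n : measurable [set w | X n w = 1].
Proof.
rewrite -[X in measurable X]/(X n @^-1` [set 1]) -[X in measurable X]setTI.
exact: measurable_funP.
Qed.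

Let X_bern N (i : 'I_N) (x : bool) : P (X i.+1 @^-1` [set x%:R]) = (bern (@density N) i x)%:E.
Proof.
rewrite X_eq // /bern /density; case: x; first exact: X_law.
by rewrite probability_setC // X_law.
Qed.

Let hits_cyl N (e : {ffun 'I_N -> bool}) :
  hits N @^-1` [set e] = \bigcap_(j in [set` [fset (nat_of_ord i).+1 | i : 'I_N]%fset])
    X j @^-1` [set (oapp e false (insub j.-1))%:R].
Proof.
apply/seteqP; split=> w /=.
  move=> he j /= /imfsetP[i _ ->] /=; rewrite /preimage /= valK /= -he ffunE.
  by case: (X01 w (ltn0Sn i)) => ->; rewrite ?eqxx // eq_sym oner_eq0.
move=> h; apply/ffunP => i; rewrite ffunE.
have /h : [set` [fset (nat_of_ord i).+1 | i : 'I_N]%fset] i.+1 by apply/imfsetP; exists i.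
rewrite /preimage /= valK /= => ->; case: (e i); rewrite ?eqxx // eq_sym; exact: oner_eq0.
Qed.

Lemma hits_measurable N (e : {ffun 'I_N -> bool}) : measurable (hits N @^-1` [set e]).
Proof.
rewrite hits_cyl; apply: fin_bigcap_measurable => [|j _]; first exact: finite_fset.
by rewrite -[X in measurable X]setTI; exact: measurable_funP.
Qed.

Lemma hits_law N (e : {ffun 'I_N -> bool}) :
  P (hits N @^-1` [set e]) = (bern_weight (@density N) e)%:E.
Proof.
rewrite hits_cyl X_indep //; last by move=> j /= /imfsetP[i _ ->].
rewrite big_imfset /=; last by move=> i j _ _ [/val_inj].
rewrite /bern_weight -prodEFin big_enum /=; apply: eq_bigr => i _.
by rewrite valK /= X_bern.
Qed.

Lemma hits_event_measurable N (Phi : pred {ffun 'I_N -> bool}) :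
  measurable [set w | Phi (hits N w)].
Proof.
rewrite (_ : [set w | _] = \big[setU/set0]_(e <- enum Phi) hits N @^-1` [set e]).
  by apply: bigsetU_measurable => e _; exact: hits_measurable.
rewrite -bigcup_seq; apply/seteqP; split=> w /=.
  by move=> hw; exists (hits N w) => //=; rewrite mem_enum.
by move=> [e /=]; rewrite mem_enum => he ->.
Qed.

Lemma hits_event_le N (Phi : pred {ffun 'I_N -> bool}) :
  (P [set w | Phi (hits N w)] <= (bern_mean (@density N) (fun e => (Phi e)%:R))%:E)%E.
Proof.
rewrite (_ : [set w | _] = \big[setU/set0]_(e <- enum Phi) hits N @^-1` [set e]).
  apply: le_trans (measure_bigU_le _ _ _) _; first exact: hits_measurable.
  rewrite (eq_bigr _ (fun e _ => hits_law e)) sumEFin lee_fin big_enum /= big_mkcond /=.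
  rewrite /bern_mean; apply: ler_sum => e _; rewrite unfold_in.
  by case: (Phi e); rewrite ?mulr1 // mulr0.
rewrite -bigcup_seq; apply/seteqP; split=> w /=.
  by move=> hw; exists (hits N w) => //=; rewrite mem_enum.
by move=> [e /=]; rewrite mem_enum => he ->.
Qed.

End joint_law.

Lemma flatten_pairs_perm (T : Type) (U : eqType) (f g : T -> U) (s : seq T) :
  perm_eq (flatten [seq [:: f x; g x] | x <- s]) ([seq f x | x <- s] ++ [seq g x | x <- s]).
Proof.
elim: s => //= x s IH; rewrite perm_cons.
by rewrite perm_sym -cat1s perm_catCA cat1s perm_cons perm_sym.
Qed.

Lemma gap_class_uniq v N r k par : (0 < r)%N ->
  uniq (flatten [seq [:: (inord n : 'I_N.+1); inord (n + r)] | n <- gap_class v N.+1 r k par]).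
Proof.
move=> r0; rewrite (perm_uniq (flatten_pairs_perm _ _ _)) cat_uniq.
have mem n : n \in gap_class v N.+1 r k par -> (n + r < N.+1)%N /\ odd (n %/ r) = par.
  rewrite mem_filter mem_iota add0n => /andP[/andP[_ /eqP ->] /=]; split=> //.
  by rewrite addnC -ltn_subRL.
have us : uniq (gap_class v N.+1 r k par) by rewrite filter_uniq // iota_uniq.
have lt1 n : n \in gap_class v N.+1 r k par -> (n < N.+1)%N.
  by move=> /mem[h _]; apply: leq_ltn_trans h; rewrite leq_addr.
rewrite !map_inj_in_uniq ?us /= ?andbT.
- apply/hasPn => _ /mapP[n hn ->]; apply/mapP => -[m hm /(congr1 val)].
  rewrite /= !inordK; [|exact: lt1|by have [] := mem _ hn].
  move=> nm; have [_ h1] := mem _ hn; have [_ h2] := mem _ hm.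
  (* Adding [r] raises the quotient by [r] by one, so a second element of one pair has the wrong
     parity to be the first element of another. *)
  by move: h2; rewrite -nm divnDr // divnn r0 addn1 /= h1; case: (par).
- move=> n m hn hm /(congr1 val); rewrite /= !inordK; [|by have [] := mem _ hm|by have [] := mem _ hn].
  by move/addIn.
- by move=> n m hn hm /(congr1 val); rewrite /= !inordK //; exact: lt1.
Qed.

(** A comparison with an integral, done by induction: the tangent at N + 1 gives p (N+1)^(p-1) <=
    (N+1)^p - N^p. *)
Lemma sum_powR_le (R : realType) (p : R) N : 0 < p < 1 ->
  \sum_(n < N) n.+1%:R `^ (p - 1) <= N%:R `^ p / p.
Proof.
move=> /andP[p0 p1]; rewrite ler_pdivlMr //; elim: N => [|N IH]; first by rewrite big_ord0 mul0r powR_ge0.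
rewrite big_ord_recr /= mulrDl.
have := @powR_le_tangent R p N.+1%:R N%:R; rewrite p0 p1 => /(_ isT (ltr0Sn _ _) (ler0n _ _)).
rewrite -[N.+1%:R in X in _ * X]natr1.
rewrite (_ : N%:R - (N%:R + 1) = -1 :> R); last by ring.
lra.
Qed.

Lemma reim_le (R : realType) part (z : R[i]) : `|z| = 1 -> `|reim part z| <= 1.
Proof.
move=> z1; case: z z1 => x y /(congr1 (@complex.Re R)) /= h.
have h2 : x ^+ 2 + y ^+ 2 = 1.
  by rewrite -(@sqr_sqrtr _ (x ^+ 2 + y ^+ 2)) ?addr_ge0 ?sqr_ge0 // h expr1n.
rewrite -(@expr_le1 _ 2) // real_normK ?num_real // /reim /=.
by case: part; rewrite -h2 ?lerDl ?lerDr sqr_ge0.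
Qed.

(** Raise 1 + x <= e^x to a power m + 1 with e (m + 1) >= 7. Of the exponent 7, four powers meet
    N^4, two the target and one absorbs the constants. *)
Lemma exp_beats_power (R : realType) (C k e : R) : 0 < k -> 0 < e ->
  exists N0, forall N : nat, (N0 <= N)%N ->
    C * N%:R ^+ 4 * expR (- (k * N%:R `^ e)) <= (N.+1 * N.+2)%:R^-1.
Proof.
move=> k0 e0.
have [m hm] : exists m : nat, 7 <= e * m.+1%:R.
  exists (natceil (7 / e)); rewrite mulrC -ler_pdivrMr //.
  apply: (@le_trans _ _ (natceil (7 / e))%:R); last by rewrite ler_nat.
  by apply: natceil_ge; rewrite divr_ge0 // ltW.
pose B : R := (m.+1%:R / k) ^+ m.+1.
have B0 : 0 < B by rewrite exprn_gt0 // divr_gt0.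
exists (natceil (6 * (`|C| * B))).+1 => N hN.
have N0 : (0 < N)%N by apply: leq_trans hN.
have NR : 0 < N%:R :> R by rewrite ltr0n.
have N1 : 1 <= N%:R :> R by rewrite ler1n.
have NB : 6 * (`|C| * B) <= N%:R.
  by rewrite -natceil_le ?mulr_ge0 // ?(ltW B0) // ltnW.
have ex : N%:R ^+ 7 <= B * expR (k * N%:R `^ e).
  have -> : expR (k * N%:R `^ e) = expR (k * N%:R `^ e / m.+1%:R) ^+ m.+1.
    by rewrite -expRM_natl; congr expR; rewrite [RHS]mulrC divfK // pnatr_eq0.
  rewrite /B -exprMn; apply: (@le_trans _ _ ((N%:R `^ e) ^+ m.+1)).
    by rewrite -!powR_mulrn ?powR_ge0 // -powRrM; apply: ler_powR.
  have mk0 : 0 <= m.+1%:R / k by rewrite divr_ge0 // ltW.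
  rewrite lerXn2r ?nnegrE ?powR_ge0 ?(mulr_ge0 mk0) ?expR_ge0 //.
  have := expR_ge1Dx (k * N%:R `^ e / m.+1%:R) => h.
  have : m.+1%:R / k * (k * N%:R `^ e / m.+1%:R) <= m.+1%:R / k * expR (k * N%:R `^ e / m.+1%:R).
    by apply: ler_wpM2l => //; apply: le_trans h; rewrite lerDr.
  apply: le_trans; rewrite le_eqVlt; apply/orP; left; apply/eqP.
  have m0 : m.+1%:R != 0 :> R by [].
  by move: (m.+1%:R : R) m0 => x m0; field; rewrite m0 gt_eqF.
have E0 : 0 < expR (- (k * N%:R `^ e)) by exact: expR_gt0.
have ex2 : N%:R ^+ 7 * expR (- (k * N%:R `^ e)) <= B.
  by rewrite expRN ler_pdivrMr // expR_gt0.
move: (expR _) E0 ex2 => E E0 ex2.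
have NN : (N.+1 * N.+2)%:R <= 6 * N%:R ^+ 2 :> R.
  rewrite natrM -[N.+2%:R]natr1 -[N.+1%:R]natr1; nra.
rewrite -[leRHS]mul1r ler_pdivlMr ?ltr0n //.
apply: (@le_trans _ _ (`|C| * N%:R ^+ 4 * E * (6 * N%:R ^+ 2))).
  apply: (@le_trans _ _ (`|C| * N%:R ^+ 4 * E * (N.+1 * N.+2)%:R)).
    by rewrite !ler_wpM2r ?exprn_ge0 ?(ltW E0) // ler_norm.
  by apply: ler_wpM2l NN; rewrite !mulr_ge0 ?exprn_ge0 // ltW.
rewrite -(ler_pM2l NR) mulr1; apply: le_trans NB.
rewrite (_ : N%:R * _ = 6 * (`|C| * (N%:R ^+ 7 * E))); last by ring.
by rewrite ler_pM2l //; apply: ler_wpM2l.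
Qed.

Section correlations.
Variables (R : realType) (d : measure_display) (Omega : measurableType d) (P : probability Omega R).
Variables (X : nat -> {RV P >-> R}) (a b : R).
Hypothesis X01 : forall n w, (1 <= n)%N -> X n w = 0 \/ X n w = 1.
Hypothesis X_indep : independent_RVs [set n | (1 <= n)%N] X.
Hypotheses (a0 : 0 < a) (b0 : 0 < b) (ab : b + 2 * a < 1 / 2).
Hypothesis X_law : forall n, (1 <= n)%N -> P [set w | X n w = 1] = (n%:R `^ (- a))%:E.
Variable v : nat -> nat.

Let y w n : R := X n.+1 w - n.+1%:R `^ (- a).

Let q N : 'I_N -> R := @density R a N.

Definition correlation N (z : R[i]) r k t par part w : R :=
  \sum_(n <- gap_class v N r k par) y w n * y w (n + r)%N * reim part (z ^+ (t * (v n - n.+1))).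

Let al N z t part (p : 'I_N * 'I_N) : R := reim part (z ^+ (t * (v p.1 - p.1.+1))).

Let pairs N r k par := [seq (inord n : 'I_N.+1, inord (n + r) : 'I_N.+1) | n <- gap_class v N.+1 r k par].

Let gap_class_lt N r k par n : n \in gap_class v N r k par -> (n + r < N)%N.
Proof.
by rewrite mem_filter mem_iota add0n => /andP[_ /=]; rewrite addnC -ltn_subRL.
Qed.

Let correlation_hits N z r k t par part w :
  correlation N.+1 z r k t par part w =
  pair_sum (@q N.+1) (@al N.+1 z t part) (pairs N r k par) (hits X N.+1 w).
Proof.
have center (i : 'I_N.+1) : bern_center (@q N.+1) i (hits X N.+1 w i) = y w i.
  rewrite /bern_center ffunE /y; congr (_ - _).
  by case: (X01 w (ltn0Sn i)) => ->; rewrite ?eqxx // eq_sym oner_eq0.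
rewrite /correlation /pair_sum big_map [LHS]big_seq [RHS]big_seq; apply: eq_bigr => n /gap_class_lt h.
rewrite /al /= !center !inordK //; first by rewrite mulrC.
by apply: leq_ltn_trans h; rewrite leq_addr.
Qed.

Let a12 : 0 < 1 - 2 * a < 1.
Proof. by apply/andP; split; move: a0 b0 ab; lra. Qed.

Let V N : R := N%:R `^ (1 - 2 * a) / (1 - 2 * a).

(** The density decreases, so each product is at most n^(-2a); summing over all [n] instead of one
    class loses a factor that the exponents can afford. *)
Let variance_le N r k par : (0 < r)%N ->
  \sum_(p <- pairs N r k par) @q N.+1 p.1 * @q N.+1 p.2 <= V N.+1.
Proof.
move=> r0; rewrite big_map big_seq.
pose F n : R := n.+1%:R `^ (1 - 2 * a - 1).
have F0 n : 0 <= F n by exact: powR_ge0.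
apply: (@le_trans _ _ (\sum_(n <- gap_class v N.+1 r k par) F n)).
  rewrite [leRHS]big_seq; apply: ler_sum => n /gap_class_lt h.
  rewrite /q /density !inordK //; last by apply: leq_ltn_trans h; rewrite leq_addr.
  have -> : F n = n.+1%:R `^ (- a) * n.+1%:R `^ (- a).
    rewrite -powRD ?pnatr_eq0 ?implybT // /F; congr (_ `^ _); ring.
  apply: ler_wpM2l; first exact: powR_ge0.
  rewrite !powRN lef_pV2 ?posrE ?powR_gt0 //.
  by apply: ge0_ler_powR; rewrite ?nnegrE ?ler_nat ?(ltW a0) // ltnS leq_addr.
rewrite big_filter; apply: (@le_trans _ _ (\sum_(n < N.+1) F n)); last exact: sum_powR_le.
rewrite -(big_mkord predT F) /index_iota subn0.
have h : (N.+1 - r <= N.+1)%N by exact: leq_subr.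
rewrite -{2}(subnK h) addnC iotaD big_cat /=.
apply: ler_wpDr; first by apply: sumr_ge0 => n _.
by rewrite big_mkcond; apply: ler_sum => n _; case: ifP.
Qed.

Lemma correlation_event_measurable N z r k t par part (u : R) :
  measurable [set w | u < `|correlation N.+1 z r k t par part w|].
Proof.
rewrite (_ : [set w | _] = [set w | (fun e =>
    u < `|pair_sum (@q N.+1) (@al N.+1 z t part) (pairs N r k par) e|) (hits X N.+1 w)]).
  exact: (hits_event_measurable X01 (fun e =>
    u < `|pair_sum (@q N.+1) (@al N.+1 z t part) (pairs N r k par) e|)).
by apply/seteqP; split => w /=; rewrite correlation_hits.
Qed.

Lemma correlation_tail N z r k t par part : `|z| = 1 -> (0 < r)%N ->
  (P [set w | (corr_bound a b N.+1 < `|correlation N.+1 z r k t par part w|)%R] <=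
    (2 * expR (- ((1 - 2 * a) / 8 * N.+1%:R `^ (4 * slack a b))))%:E)%E.
Proof.
move=> z1 r0; set u := corr_bound a b N.+1.
rewrite (_ : [set w | _] = [set w | (fun e =>
    u < `|pair_sum (@q N.+1) (@al N.+1 z t part) (pairs N r k par) e|) (hits X N.+1 w)]); last first.
  by apply/seteqP; split => w /=; rewrite correlation_hits.
apply: le_trans (hits_event_le X01 X_indep X_law (fun e =>
    u < `|pair_sum (@q N.+1) (@al N.+1 z t part) (pairs N r k par) e|)) _.
have /andP[p0 p1] := a12.
have u0 : 0 < u by exact: powR_gt0.
have V0 : 0 < V N.+1 by rewrite divr_gt0 // powR_gt0.
have s0 := slack_gt0 ab.
have PP e f : N.+1%:R `^ e * N.+1%:R `^ f = N.+1%:R `^ (e + f) :> R.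
  by rewrite powRD // pnatr_eq0 implybT.
(* The minimiser of 2 l^2 V - l u, with value - u^2 / (8V); it is at most 1/2 because u <= 2V. *)
pose l := u / (4 * V N.+1).
have l01 : 0 <= l <= 1 / 2.
  apply/andP; split; first by apply: divr_ge0; [exact: ltW|rewrite mulr_ge0 // ltW].
  have V4 : 0 < 4 * V N.+1 by rewrite pmulr_rgt0.
  rewrite ler_pdivrMr //.
  rewrite mulrA (_ : 1 / 2 * 4 = 2); last by field.
  apply: (@le_trans _ _ (N.+1%:R `^ (1 - 2 * a))).
    by apply: ler_powR; rewrite ?ler1n //; move: a0 b0; lra.
  rewrite /V mulrA ler_pdivlMr // mulrC; apply: ler_wpM2r; first exact: powR_ge0.
  lra.
have us : uniq (flatten [seq [:: p.1; p.2] | p <- pairs N r k par]).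
  by rewrite /pairs -map_comp; exact: gap_class_uniq.
have al1 (p : 'I_N.+1 * 'I_N.+1) : `|@al N.+1 z t part p| <= 1.
  by apply: reim_le; rewrite normrX z1 expr1n.
have q01 (i : 'I_N.+1) : 0 <= @q N.+1 i <= 1 by exact: density01.
rewrite lee_fin; apply: le_trans (pair_sum_tail q01 u us al1 l01 (@variance_le _ _ _ _ r0)) _.
rewrite ler_pM2l // ler_expR.
have -> : 2 * l ^+ 2 * V N.+1 - l * u = - (u ^+ 2 / (8 * V N.+1)).
  by rewrite /l; field; rewrite gt_eqF.
have V8 : 0 < 8 * V N.+1 by rewrite pmulr_rgt0.
rewrite lerN2 ler_pdivlMr // /V.
rewrite (_ : _ * (8 * _) = N.+1%:R `^ (4 * slack a b) * N.+1%:R `^ (1 - 2 * a)); last first.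
  by field; rewrite gt_eqF.
rewrite expr2 /u /corr_bound !PP; apply: ler_powR; first by rewrite ler1n.
rewrite /slack; lra.
Qed.

End correlations.

Section almost_sure.
Variables (R : realType) (d : measure_display) (Omega : measurableType d) (P : probability Omega R).
Variables (X : nat -> {RV P >-> R}) (a b : R).
Hypothesis X01 : forall n w, (1 <= n)%N -> X n w = 0 \/ X n w = 1.
Hypothesis X_indep : independent_RVs [set n | (1 <= n)%N] X.
Hypotheses (a0 : 0 < a) (b0 : 0 < b) (ab : b + 2 * a < 1 / 2).
Hypothesis X_law : forall n, (1 <= n)%N -> P [set w | X n w = 1] = (n%:R `^ (- a))%:E.

Let v n : nat := fast b (1 : R) n.+1.

Lemma almost_surely_typical : {ae P, forall w, typical a b (fun n => X n w)}.
Proof.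
have [z zP] : exists z : nat -> R[i], forall N, (N.+1 * N.+1 + N.+1 * N.+1)%N.-primitive_root (z N).
  have zE N : exists z : R[i], (N.+1 * N.+1 + N.+1 * N.+1)%N.-primitive_root z.
    exact: primitive_root_exists.
  by have [z zP] := choice zE; exists z.
have z1 N : `|z N| = 1 by apply: norm_prim_root (zP N).
pose I N : finType := ('I_(vdc_length a b N.+1) * 'I_(gap_bound a b N.+1) *
  'I_(N.+1 * N.+1 + N.+1 * N.+1) * bool * bool)%type.
pose bad N (i : I N) := let: (r, k, t, par, part) := i in
  [set w | corr_bound a b N.+1 < `|correlation X a v N.+1 (z N) r.+1 k t par part w|].
pose F N := \big[setU/set0]_(i <- index_enum (I N)) bad N i.
have mbad N i : measurable (bad N i).
  by case: i => [[[[r k] t] par] part]; exact: correlation_event_measurable.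
have mF N : measurable (F N) by exact: bigsetU_measurable.
have s0 := slack_gt0 ab.
have k0 : 0 < (1 - 2 * a) / 8 by rewrite divr_gt0 //; move: b0 ab; lra.
(* Number of events times the tail constant: 3N distances, 7N gaps, 2N^2 characters, two parities,
   two parts and the 2 of the tail bound, so 336 N^4. *)
have [N0 hN0] := exp_beats_power 336 k0 (mulr_gt0 (ltr0Sn R 3) s0).
have FN N : (N0 <= N)%N -> (P (F N) <= ((N.+1 * N.+2)%:R^-1)%:E)%E.
  move=> hN; apply: le_trans (measure_bigU_le _ _ (@mbad N)) _.
  set p := 2 * expR (- ((1 - 2 * a) / 8 * N.+1%:R `^ (4 * slack a b))).
  have p0 : 0 <= p by rewrite mulr_ge0 // expR_ge0.
  apply: (@le_trans _ _ (\sum_(i : I N) p%:E)%E).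
    by apply: lee_sum => -[[[[r k] t] par] part] _; exact: correlation_tail.
  rewrite sumEFin lee_fin sumr_const; 
  apply: (@le_trans _ _ (N.+2 * N.+3)%:R^-1); last first.
    by rewrite lef_pV2 ?posrE ?ltr0n // ler_nat leq_mul.
  apply: le_trans (hN0 N.+1 (leqW hN)).
  rewrite -[X in X <= _]mulr_natl /p.
  have E0 : 0 <= expR (- ((1 - 2 * a) / 8 * N.+1%:R `^ (4 * slack a b))) by exact: expR_ge0.
  rewrite mulrA; apply: ler_wpM2r => //.
  rewrite !card_prod !card_ord card_bool.
  have H3 := vdc_length_small a0 b0 ab (ltn0Sn N).
  have K3 : (gap_bound a b N.+1)%:R <= 7 * N.+1%:R :> R.
    apply: le_trans (gap_bound_le a0 b0 ab (ltn0Sn N)) _; rewrite ler_pM2l //.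
    rewrite -[leRHS]powRr1 //; apply: ler_powR; first by rewrite ler1n.
    by rewrite /slack; move: a0 b0 ab; lra.
  rewrite !natrM natrD natrM.
  move: ((vdc_length a b N.+1)%:R) ((gap_bound a b N.+1)%:R) (N.+1%:R : R) H3 K3 (ler0n R (vdc_length a b N.+1)) (ler0n R (gap_bound a b N.+1)) (ler0n R N.+1) => h k n hn kn h0' k0' n0.
  have -> : 336 * n ^+ 4 = (3 * n) * (7 * n) * (n * n + n * n) * 2 * 2 * 2 by ring.
  do 3 apply: ler_wpM2r => //; apply: ler_wpM2r; first by rewrite addr_ge0 ?mulr_ge0.
  exact: ler_pM.
have [M [mM M0 Msub]] := borel_cantelli_eventually mF FN.
exists M; split=> // w nt; apply: Msub => /= -[N1 hN1]; apply: nt.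
apply: (typical_of_small a0 _ b0 ab) => [|n|]; [by move: b0 ab; lra|exact: X01|].
exists N1.+1 => -[//|N] hN; exists (z N) => // r hr k hk t ht par part.
rewrite leNgt; apply/negP => bd; apply: (hN1 N hN).
case: r hr bd => [//|r] /andP[_ rH] bd.
rewrite /F -bigcup_seq /=.
exists (Ordinal (ltnW rH), Ordinal hk, Ordinal ht, par, part) => //=.
by rewrite mem_index_enum.
Qed.
End almost_sure.

(** * Convergence in mean square *)

Section measure_system.
Variables (R : realType) (d : measure_display) (S : measurableType d) (mu : probability S R).
Implicit Types F G : S -> R.

Definition bounded_measurable F := measurable_fun setT F /\ exists C, forall x, `|F x| <= C.

Lemma bounded_measurable_integrable F :
  bounded_measurable F -> mu.-integrable setT (EFin \o F).
Proof.
move=> [mF [C FC]]; apply: measurable_bounded_integrable => //.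
  by have : (mu setT < +oo)%E by rewrite probability_setT ltry.
by exists C; split=> [|y Cy x _]; [exact: num_real|apply: le_trans (FC x) (ltW Cy)].
Qed.

Lemma bounded_measurable_cst c : bounded_measurable (fun=> c).
Proof. by split; [exact: measurable_cst|exists `|c|]. Qed.

Lemma bounded_measurableD F G : bounded_measurable F -> bounded_measurable G ->
  bounded_measurable (fun x => F x + G x).
Proof.
move=> [mF [C FC]] [mG [D GD]]; split; first exact: measurable_funD.
by exists (C + D) => x; apply: le_trans (ler_normD _ _) (lerD (FC x) (GD x)).
Qed.

Lemma bounded_measurableM F G : bounded_measurable F -> bounded_measurable G ->
  bounded_measurable (fun x => F x * G x).
Proof.
move=> [mF [C FC]] [mG [D GD]]; split; first exact: measurable_funM.
by exists (C * D) => x; rewrite normrM; apply: ler_pM.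
Qed.

Variable T : S -> S.
Hypothesis mpT : measure_preserving mu T.

Lemma bounded_measurable_comp F : bounded_measurable F -> bounded_measurable (fun x => F (T x)).
Proof.
move=> [mF [C FC]]; split; last by exists C.
by apply: (measurableT_comp mF); exact: mpT.1.
Qed.

Lemma Rintegral_comp F : bounded_measurable F -> \int[mu]_x F (T x) = \int[mu]_x F x.
Proof.
move=> bF; have mT := mpT.1; have [mF _] := bF; rewrite /Rintegral; congr fine.
have iF := bounded_measurable_integrable (bounded_measurable_comp bF).
rewrite -[LHS](@integral_pushforward _ _ _ _ _ _ mT mu setT (EFin \o F)) //.
- by apply: eq_measure_integral => A mA _; exact: mpT.2.
- exact/measurable_EFinP.
Qed.

Definition measure_system : system R.
Proof.
refine (@System R S bounded_measurable (fun F => \int[mu]_x F x) T _ _ _ _ _ _ _ _ _).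
- exact: bounded_measurable_cst.
- exact: bounded_measurableD.
- exact: bounded_measurableM.
- exact: bounded_measurable_comp.
- by move=> F G bF bG; apply: RintegralD => //; exact: bounded_measurable_integrable.
- by move=> c F bF; apply: RintegralZl => //; exact: bounded_measurable_integrable.
- by move=> F _ F0; apply: Rintegral_ge0 => x _.
- exact: Rintegral_comp.
- rewrite /Rintegral integral_cst //.
  by have -> : (1%:E * mu setT)%E = 1%E by rewrite probability_setT mul1e.
Defined.

Lemma integral_mean (F : measure_system -> R) : adm F -> (\int[mu]_x (F x)%:E)%E = (mean F)%:E.
Proof.
move=> aF; rewrite fineK //; apply: integrable_fin_num => //.
exact: bounded_measurable_integrable.
Qed.

(** The increments are summable in L^1, so their sum is finite almost everywhere and [psi] converges
    there; boundedness upgrades this to square mean by dominated convergence. *)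
Lemma fast_cauchy_limit (psi : nat -> S -> R) :
  (forall k, measurable_fun setT (psi k)) -> (forall k x, `|psi k x| <= 1) ->
  (forall k, \int[mu]_x `|psi k.+1 x - psi k x| <= 5 * 2^-1 ^+ k) ->
  exists2 h : S -> R, measurable_fun setT h /\ (forall x, `|h x| <= 1) &
    \int[mu]_x ((psi k x - h x) ^+ 2) @[k --> \oo] --> 0.
Proof.
move=> mpsi psi1 dpsi.
have bpsi k : bounded_measurable (psi k) by split=> //; exists 1.
pose D k x := psi k.+1 x - psi k x.
have bD k : bounded_measurable (fun x => `|D k x|).
  split; first by apply: measurableT_comp => //; exact: measurable_funB.
  exists 2 => x; rewrite normr_id; apply: le_trans (ler_normB _ _) _.
  by rewrite (_ : 2 = 1 + 1) //; exact: lerD.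
pose G x := (\sum_(k <oo) `|D k x|%:E)%E.
have mG : measurable_fun setT G.
  by apply: ge0_emeasurable_sum => // k _; [exact/measurable_EFinP/(bD k).1].
have iG : mu.-integrable setT G.
  apply/integrableP; split=> //.
  have G0 x : (0 <= G x)%E by apply: nneseries_ge0 => k _ _; rewrite lee_fin.
  under eq_integral do rewrite gee0_abs //.
  rewrite integral_nneseries //; last first.
    by move=> k; exact/measurable_EFinP/(bD k).1.
    apply: (@le_lt_trans _ _ 10%:E%E); last exact: ltry.
    apply: lime_le.
      by apply: is_cvg_nneseries => k _ _; apply: integral_ge0 => x _; rewrite lee_fin.
    apply: nearW => n.
    apply: (@le_trans _ _ (\sum_(0 <= k < n) (5 * 2^-1 ^+ k)%:E)%E).
      apply: lee_sum => k _; rewrite -[leLHS]fineK; first by rewrite lee_fin; exact: dpsi.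
      by apply: integrable_fin_num => //; exact: (bounded_measurable_integrable (bD k)).
    rewrite sumEFin lee_fin.
    have -> : \sum_(0 <= k < n) 5 * 2^-1 ^+ k = 10 * (1 - 2^-1 ^+ n) :> R.
      elim: n => [|n IH]; first by rewrite big_nil subrr mulr0.
      by rewrite big_nat_recr //= IH exprS; field.
    by rewrite ler_piMr // gerBl exprn_ge0.
have [Z [mZ Z0 subZ]] := integrable_ae measurableT iG.
(* Killing a measurable null set makes the sequence converge at every point, so the limit is
   measurable and bounded everywhere. *)
pose phi k x := psi k x * \1_(~` Z) x.
have cvgphi x : cvgn (phi ^~ x).
  have [xZ|xZ] := pselect (Z x).
    have -> : phi ^~ x = cst 0.
      by apply/funext => k; rewrite /phi indicE memNset ?mulr0 //= => nZ; exact: nZ.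
    exact: is_cvg_cst.
  have -> : phi ^~ x = psi ^~ x.
    by apply/funext => k; rewrite /phi indicE mem_set ?mulr1.
  have Gx : G x \is a fin_num by apply: contrapT => h; apply: xZ; apply: subZ => /(_ I).
  have cn : cvgn (series (telescope (psi ^~ x))).
    apply: normed_cvg; apply: nondecreasing_is_cvgn.
      by apply: nondecreasing_series => k _ /=.
    exists (fine (G x)) => _ [n _ <-].
    rewrite -lee_fin fineK // /G /series /= -sumEFin.
    by apply: nneseries_lim_ge => k _ _; rewrite lee_fin.
  have -> : psi ^~ x = (fun n => psi 0%N x + series (telescope (psi ^~ x)) n).
    by apply/funext => n; exact: (eq_sum_telescope (psi ^~ x)).
  by apply: is_cvgD => //; exact: is_cvg_cst.
pose h x := limn (phi ^~ x).
have mphi k : measurable_fun setT (phi k).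
  by apply: measurable_funM => //; apply: measurable_indic; exact: measurableC.
have phi1 k x : `|phi k x| <= 1.
  rewrite /phi normrM -[leRHS]mulr1; apply: ler_pM => //.
  by rewrite indicE; case: (_ \in _); rewrite ?normr1 ?normr0.
have mh : measurable_fun setT h.
  by apply: (measurable_fun_cvg mphi) => x _; exact: cvgphi.
have h1 x : `|h x| <= 1.
  rewrite ler_norml; apply/andP; split.
    by apply: limr_ge; [exact: cvgphi|apply: nearW => k; have := phi1 k x; rewrite ler_norml => /andP[]].
  by apply: limr_le; [exact: cvgphi|apply: nearW => k; have := phi1 k x; rewrite ler_norml => /andP[]].
exists h => //.
have bF4 k x : `|(psi k x - h x) ^+ 2| <= 4.
  rewrite normrX (_ : 4 = 2 ^+ 2); last by ring.
  rewrite lerXn2r ?nnegrE //; apply: le_trans (ler_normB _ _) _.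
  by rewrite (_ : 2 = 1 + 1) //; exact: lerD.
have bF k : bounded_measurable (fun x => (psi k x - h x) ^+ 2).
  by split; [apply: measurable_funX; exact: measurable_funB|exists 4].
have [] := @dominated_convergence _ _ _ mu setT measurableT
  (fun k x => ((psi k x - h x) ^+ 2)%:E) (cst 0%E) (cst 4%:E).
- by move=> k; exact/measurable_EFinP/(bF k).1.
- exact: measurable_cst.
- exists Z; split=> // x nc; apply: contrapT => nZ; apply: nc => _.
  apply: cvg_EFin; first by apply: nearW.
  have px : psi k x @[k --> \oo] --> h x.
    suff <- : phi ^~ x = psi ^~ x by exact: cvgphi.
    by apply/funext => k; rewrite /phi indicE mem_set ?mulr1.
  rewrite (_ : 0 = (h x - h x) ^+ 2); last by rewrite subrr expr0n.
  have dx : psi k x - h x @[k --> \oo] --> h x - h x by apply: cvgB => //; exact: cvg_cst.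
  exact: (cvgM dx dx).
- exact: (bounded_measurable_integrable (bounded_measurable_cst 4)).
- by apply: aeW => x k _; rewrite lee_fin; exact: bF4.
move=> _ _; rewrite integral0 => /fine_cvg.
exact.
Qed.


(** Approximants with errors 4^(-k) are compared with each other through a common late [Phi N]; this
    makes them a fast Cauchy sequence, and its limit is the limit of [Phi]. *)
Lemma approximable_limit (Phi : nat -> measure_system -> R) :
  (forall N, adm (Phi N)) -> approximable Phi ->
  exists2 h : measure_system -> R, adm h /\ (forall x, `|h x| <= 1) &
    forall e : R, 0 < e -> exists N0, forall N, (N0 <= N)%N ->
      mean (fun x => (Phi N x - h x) ^+ 2) <= e.
Proof.
move=> aPhi ap.
have e0 k : 0 < 4^-1 ^+ k :> R by rewrite exprn_gt0.
have [psi psiP] := choice (fun k => ap _ (e0 k)).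
have apsi k : adm (psi k) by have [] := psiP k.
have sqrB (F G H : measure_system -> R) (s t : R) : adm F -> adm G -> adm H ->
    mean (fun x => (H x - F x) ^+ 2) <= s -> mean (fun x => (H x - G x) ^+ 2) <= t ->
    mean (fun x => (F x - G x) ^+ 2) <= 2 * s + 2 * t.
  move=> aF aG aH hF hG.
  have -> : (fun x => (F x - G x) ^+ 2) = (fun x => ((F x - H x) + (H x - G x)) ^+ 2).
    by apply/funext => x; rewrite addrA subrK.
  apply: le_trans (mean_sqrD _ _) _; try by admt.
  apply: lerD; rewrite ler_pM2l //.
  by have <- : (fun x => (H x - F x) ^+ 2) = (fun x => (F x - H x) ^+ 2)
    by apply/funext => x; ring.
have dpsi k : \int[mu]_x `|psi k.+1 x - psi k x| <= 5 * 2^-1 ^+ k.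
  have [_ _ [N0 h0]] := psiP k; have [_ _ [N1 h1]] := psiP k.+1.
  have d2 : mean (fun x => (psi k.+1 x - psi k x) ^+ 2) <= 2 * 4^-1 ^+ k.+1 + 2 * 4^-1 ^+ k.
    by apply: (sqrB _ _ (Phi (N0 + N1)%N)) => //; [apply: h1; rewrite leq_addl|apply: h0; rewrite leq_addr].
  have ad : adm (fun x : measure_system => `|psi k.+1 x - psi k x|).
    split; first by apply: measurableT_comp => //; apply: measurable_funB; exact: (apsi _).1.
    have [_ [C hC]] : adm (fun x : measure_system => psi k.+1 x - psi k x) by admt.
    by exists C => x; rewrite normr_id.
  (* From |z| <= 2^(-k) + 2^k z^2, balanced for a square mean of order 4^(-k); the total is 7/2
     times 2^(-k). *)
  apply: (@le_trans _ _ (mean (fun x : measure_system => 2^-1 ^+ k + 2 ^+ k * (psi k.+1 x - psi k x) ^+ 2))).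
    apply: (@le_mean R measure_system (fun x => `|psi k.+1 x - psi k x|)) => //; first by admt.
    move=> x; set z := psi k.+1 x - psi k x.
    have q0 : 0 < 2 ^+ k :> R by rewrite exprn_gt0.
    rewrite -(ler_pM2l q0) mulrDr -exprMn divff // expr1n mulrA -expr2 -[z ^+ 2]real_normK ?num_real //.
    rewrite -exprMn; move: (2 ^+ k * `|z|) => y; nra.
  rewrite meanD ?mean_cst ?meanZ; try by admt.
  have q0 : 0 <= 2 ^+ k :> R by rewrite exprn_ge0.
  have q1 : 2 ^+ k * 4^-1 ^+ k = 2^-1 ^+ k :> R by rewrite -exprMn; congr (_ ^+ _); field.
  have := ler_wpM2l q0 d2; rewrite exprS mulrDr !(mulrCA (2 ^+ k)) q1.
  have : 0 < 2^-1 ^+ k :> R by rewrite exprn_gt0.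
  lra.
have [h [mh h1] ch] := fast_cauchy_limit (fun k => (apsi k).1)
  (fun k => let: And3 _ p _ := psiP k in p) dpsi.
have ah : adm (h : measure_system -> R) by split=> //; exists 1.
exists h => // e e_gt0.
have e4 : 0 < e / 4 by rewrite divr_gt0.
have c4 : (fun k => 4^-1 ^+ k : R) @ \oo --> 0 by apply: cvg_expr; rewrite ger0_norm //; lra.
have [k [hk1 hk2]] : exists k, \int[mu]_x (psi k x - h x) ^+ 2 <= e / 4 /\ 4^-1 ^+ k <= e / 4.
  have n1 : \forall k \near \oo, \int[mu]_x (psi k x - h x) ^+ 2 <= e / 4.
    by move: ch => /cvgrPdist_le/(_ _ e4); apply: filterS => k; rewrite sub0r normrN => /(le_trans (ler_norm _)).
  have n2 : \forall k \near \oo, (4^-1 ^+ k : R) <= e / 4.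
    by move: c4 => /cvgrPdist_le/(_ _ e4); apply: filterS => k; rewrite sub0r normrN => /(le_trans (ler_norm _)).
  have [k _ hk] := filterI n1 n2; exists k; exact: (hk k (leqnn k)).
have [_ _ [N0 hN0]] := psiP k; exists N0 => N /hN0 hN.
have -> : e = 2 * (e / 4) + 2 * (e / 4) by field.
apply: (sqrB _ _ (psi k)) => //.
have -> : (fun x => (psi k x - Phi N x) ^+ 2) = (fun x => (Phi N x - psi k x) ^+ 2).
  by apply/funext => x; ring.
exact: le_trans hN hk2.
Qed.

End measure_system.

Section complex_functions.
Variables (R : realType) (d : measure_display) (S : measurableType d) (mu : probability S R).

Lemma complex_Lnorm2E (F : S -> R[i]) : complex_Lnorm mu 2%:E F =
  ((\int[mu]_x ((complex.Re (F x)) ^+ 2 + (complex.Im (F x)) ^+ 2)%:E) `^ 2^-1)%E.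
Proof.
rewrite /complex_Lnorm unlock; congr (_ `^ _)%E; apply: eq_integral => x _.
case: (F x) => u v /=; rewrite ger0_norm ?sqrtr_ge0 // powR_mulrn ?sqrtr_ge0 //.
by rewrite sqr_sqrtr // addr_ge0 ?sqr_ge0.
Qed.

Lemma complex_Lnorm2_le (F : S -> R[i]) (e : R) : 0 <= e ->
  (\int[mu]_x ((complex.Re (F x)) ^+ 2 + (complex.Im (F x)) ^+ 2)%:E <= (e ^+ 2)%:E)%E ->
  (complex_Lnorm mu 2%:E F <= e%:E)%E.
Proof.
move=> e0 h; rewrite complex_Lnorm2E.
have -> : e%:E = ((e ^+ 2)%:E `^ 2^-1)%E.
  by rewrite poweR_EFin -powR_mulrn // -powRrM divff // powRr1.
apply: gt0_ler_poweR => //; rewrite in_itv /= leey andbT.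
  by apply: integral_ge0 => x _; rewrite lee_fin addr_ge0 ?sqr_ge0.
by rewrite lee_fin exprn_ge0.
Qed.

(** The essential bound holds only almost everywhere while the abstract estimates want it at every
    point, so both coordinates are truncated. The maximum with 1 keeps the scaling constant
    positive. *)
Lemma complex_Linfty_decomposition (f : S -> R[i]) : complex_Lfun mu +oo%E f ->
  exists (M : R) (f1 f2 : S -> R), [/\ 0 < M, measurable_fun setT f1 /\ measurable_fun setT f2,
    forall x, `|f1 x| <= 1, forall x, `|f2 x| <= 1 &
    {ae mu, forall x, f x = (M * f1 x +i* (M * f2 x))%C}].
Proof.
move=> [mRe mIm]; rewrite /complex_Lnorm unlock.
have mu0 : (0 < mu setT)%E by rewrite probability_setT.
rewrite mu0 => fin.
pose M : R := Num.max 1 (fine (ess_sup mu (abse \o (fun x => (ComplexField.Normc.normc (f x))%:E)))).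
have M0 : 0 < M by rewrite lt_max ltr01.
have : (ess_sup mu (abse \o (fun x => (ComplexField.Normc.normc (f x))%:E)) <= M%:E)%E.
  rewrite /M; case: (ess_sup _ _) fin => [r _| //|_] /=; last exact: leNye.
  by rewrite lee_fin le_max lexx orbT.
move=> /ess_supP fM.
pose tr (u : S -> R) x := Num.max (-1) (Num.min 1 (M^-1 * u x)).
have mtr u : measurable_fun setT u -> measurable_fun setT (tr u).
  move=> mf; apply: measurable_maxr => //; apply: measurable_minr => //.
  exact: measurable_funM.
have tr1 u x : `|tr u x| <= 1.
  by rewrite ler_norml /tr le_max lexx /= ge_max ge_min lexx /= andbT; lra.
have trE u x : `|u x| <= M -> M * tr u x = u x.
  rewrite ler_norml => /andP[h1 h2].
  have l1 : M^-1 * u x <= 1 by rewrite mulrC ler_pdivrMr // mul1r.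
  have l2 : -1 <= M^-1 * u x by rewrite mulrC ler_pdivlMr // mulN1r.
  by rewrite /tr (min_idPr l1) (max_idPr l2) mulrA divff ?mul1r // gt_eqF.
exists M, (tr (fun x => complex.Re (f x))), (tr (fun x => complex.Im (f x))); split=> //.
  by split; exact: mtr.
apply: filterS fM => x /=.
rewrite lee_fin ger0_norm ?sqrtr_ge0; last by case: (f x) => u v; exact: sqrtr_ge0.
move=> fx.
have Re_le : `|complex.Re (f x)| <= M.
  apply: le_trans fx; case: (f x) => u v /=; rewrite -sqrtr_sqr ler_wsqrtr // lerDl sqr_ge0 //.
have Im_le : `|complex.Im (f x)| <= M.
  apply: le_trans fx; case: (f x) => u v /=; rewrite -sqrtr_sqr ler_wsqrtr // lerDr sqr_ge0 //.
by rewrite !trE //; case: (f x).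
Qed.

Lemma complex_average (I : Type) (s : seq I) (N : nat) (u v : I -> R) :
  (N%:R^-1 : R[i]) * \sum_(n <- s) (u n +i* v n)%C =
  (N%:R^-1 * (\sum_(n <- s) u n) +i* (N%:R^-1 * (\sum_(n <- s) v n)))%C.
Proof.
have -> : \sum_(n <- s) (u n +i* v n)%C = ((\sum_(n <- s) u n) +i* (\sum_(n <- s) v n))%C.
  elim: s => [|n s IH]; first by rewrite !big_nil.
  by rewrite !big_cons IH.
have -> : (N%:R^-1 : R[i]) = real_complex R (N%:R^-1) by rewrite fmorphV rmorph_nat.
by rewrite /=; simpc.
Qed.

Lemma cvge0_of_le (u : nat -> \bar R) : (forall N, (0 <= u N)%E) ->
  (forall e : R, 0 < e -> exists N0, forall N, (N0 <= N)%N -> (u N <= e%:E)%E) ->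
  u N @[N --> \oo] --> 0%E.
Proof.
move=> u0 ue; apply/fine_cvgP; split.
  have [N0 h] := ue 1 ltr01; exists N0 => // N /= /h hN.
  by rewrite ge0_fin_numE //; apply: le_lt_trans hN (ltry _).
apply/cvgrPdist_le => e e0; have [N0 h] := ue e e0; exists N0 => // N /= /h hN.
have fN : u N \is a fin_num by rewrite ge0_fin_numE //; apply: le_lt_trans hN (ltry _).
by rewrite sub0r normrN ger0_norm ?fine_ge0 // -lee_fin fineK.
Qed.

End complex_functions.

Section ergodic_averages.
Variables (R : realType) (d : measure_display) (S : measurableType d) (mu : probability S R).
Variable T : S -> S.
Hypothesis mpT : measure_preserving mu T.

Lemma measurable_iter k : measurable_fun setT (iter k T).
Proof.
elim: k => [|k IH]; first exact: measurable_id.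
exact: (measurableT_comp mpT.1 IH).
Qed.

(** Preimages of null sets are null, and there are countably many times. This carries the
    almost-everywhere equality with the truncated functions over to the ergodic averages. *)
Lemma ae_orbit (Q : S -> Prop) : {ae mu, forall x, Q x} -> {ae mu, forall x, forall k, Q (iter k T x)}.
Proof.
move=> aeQ; apply/ae_foralln => k; elim: k => [//|k [Z [mZ Z0 subZ]]].
exists (T @^-1` Z); split.
- by rewrite -[X in measurable X]setTI; exact: mpT.1.
- by rewrite -Z0; exact: mpT.2.
- by move=> x /= nQ; apply: subZ => /= QT; apply: nQ; rewrite -iterS iterSr.
Qed.

Lemma ergodic_average_parts (u v : nat -> nat) (f g : S -> R[i]) (p q p' q' : nat -> R) N x :
  (forall k, f (iter k T x) = (p k +i* q k)%C) -> (forall k, g (iter k T x) = (p' k +i* q' k)%C) ->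
  ergodic_average T u v f g N x =
  (N%:R^-1 * (\sum_(1 <= n < N.+1) (p (u n) * p' (v n) - q (u n) * q' (v n))) +i*
   (N%:R^-1 * (\sum_(1 <= n < N.+1) (p (u n) * q' (v n) + q (u n) * p' (v n)))))%C.
Proof.
move=> fE gE; rewrite -complex_average /ergodic_average; congr (_ * _).
by apply: eq_bigr => n _; rewrite fE gE; simpc.
Qed.

Variables (b : R) (an : nat -> nat).

Let Phi (f g : measure_system mpT -> R) N x :=
  N%:R^-1 * \sum_(1 <= n < N.+1) two_term b f g (an n) x.

Hypothesis approx : forall f g : measure_system mpT -> R, adm f -> adm g ->
  (forall x, `|f x| <= 1) -> (forall x, `|g x| <= 1) -> approximable (Phi f g).

Lemma cvg_ergodic_average (f g : S -> R[i]) :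
  complex_Lfun mu +oo%E f -> complex_Lfun mu +oo%E g ->
  cvg_in_L2 mu (ergodic_average T an (fun n => Num.truncn ((an n)%:R `^ (1 + b) : R)) f g).
Proof.
move=> Lf Lg; set vn := fun n => Num.truncn _.
have [M [f1 [f2 [M0 [mf1 mf2] f11 f21 fE]]]] := complex_Linfty_decomposition Lf.
have [M' [g1 [g2 [M'0 [mg1 mg2] g11 g21 gE]]]] := complex_Linfty_decomposition Lg.
have af1 : adm (f1 : measure_system mpT -> R) by split=> //; exists 1.
have af2 : adm (f2 : measure_system mpT -> R) by split=> //; exists 1.
have ag1 : adm (g1 : measure_system mpT -> R) by split=> //; exists 1.
have ag2 : adm (g2 : measure_system mpT -> R) by split=> //; exists 1.
have aPhi (p q : measure_system mpT -> R) N : adm p -> adm q -> adm (Phi p q N).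
  by move=> ap aq; rewrite /Phi /two_term; admt.
have lim (p q : measure_system mpT -> R) : adm p -> adm q -> (forall x, `|p x| <= 1) ->
    (forall x, `|q x| <= 1) -> exists2 h : measure_system mpT -> R, adm h &
    forall e : R, 0 < e -> exists N0, forall N, (N0 <= N)%N ->
      mean (fun x => (Phi p q N x - h x) ^+ 2) <= e.
  move=> ap aq p1 q1.
  have [h [ah _] hP] := approximable_limit (fun N => aPhi p q N ap aq) (approx ap aq p1 q1).
  by exists h.
have [h11 a11 c11] := lim _ _ af1 ag1 f11 g11; have [h22 a22 c22] := lim _ _ af2 ag2 f21 g21.
have [h12 a12 c12] := lim _ _ af1 ag2 f11 g21; have [h21 a21 c21] := lim _ _ af2 ag1 f21 g11.
pose C := M * M'; have C0 : 0 < C by rewrite mulr_gt0.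
pose hr : measure_system mpT -> R := fun x => C * (h11 x - h22 x).
pose hi : measure_system mpT -> R := fun x => C * (h12 x + h21 x).
have ahr : adm hr by rewrite /hr; admt.
have ahi : adm hi by rewrite /hi; admt.
exists (fun x => (hr x +i* hi x)%C); split.
  split; [exact: ahr.1|exact: ahi.1|].
  rewrite complex_Lnorm2E /= poweR_lty //.
  have as2 : adm (fun x : measure_system mpT => hr x ^+ 2 + hi x ^+ 2) by admt.
  by rewrite (integral_mean as2) ltry.
apply: cvge0_of_le => [N|e e0]; first by rewrite complex_Lnorm2E poweR_ge0.
(* Expanding the complex product gives four real averages, and (x + y)^2 <= 2x^2 + 2y^2 gives each
   the factor 2C^2; together 8 C^2 times [dl] is [e ^+ 2]. *)
pose dl := e ^+ 2 / (8 * C ^+ 2).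
have dl0 : 0 < dl by rewrite divr_gt0 ?exprn_gt0 // mulr_gt0 // exprn_gt0.
have [N1 k1] := c11 _ dl0; have [N2 k2] := c22 _ dl0.
have [N3 k3] := c12 _ dl0; have [N4 k4] := c21 _ dl0.
exists (N1 + N2 + N3 + N4)%N => N hN.
have {k1} k1 := k1 N (leq_trans (leq_trans (leq_addr _ _) (leq_trans (leq_addr _ _) (leq_addr _ _))) hN).
have {k2} k2 := k2 N (leq_trans (leq_trans (leq_addl _ _) (leq_trans (leq_addr _ _) (leq_addr _ _))) hN).
have {k3} k3 := k3 N (leq_trans (leq_trans (leq_addl _ _) (leq_addr _ _)) hN).
have {k4} k4 := k4 N (leq_trans (leq_addl _ _) hN).
apply: complex_Lnorm2_le; first exact: ltW.
have := aPhi f1 g1 N af1 ag1; have := aPhi f2 g2 N af2 ag2.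
have := aPhi f1 g2 N af1 ag2; have := aPhi f2 g1 N af2 ag1.
set P11 := Phi f1 g1 N in k1 *; set P22 := Phi f2 g2 N in k2 *.
set P12 := Phi f1 g2 N in k3 *; set P21 := Phi f2 g1 N in k4 * => b21 b12 b22 b11.
pose B : measure_system mpT -> R := fun x => 2 * C ^+ 2 *
  ((P11 x - h11 x) ^+ 2 + (P22 x - h22 x) ^+ 2 + ((P12 x - h12 x) ^+ 2 + (P21 x - h21 x) ^+ 2)).
have aB : adm B by rewrite /B; admt.
apply: (@le_trans _ _ (\int[mu]_x (B x)%:E)%E); last first.
  rewrite (integral_mean aB) lee_fin /B meanZ; last by admt.
  rewrite meanD ?meanD; try by admt.
  have C2 : 0 < C ^+ 2 by rewrite exprn_gt0.
  have -> : e ^+ 2 = 2 * C ^+ 2 * (dl + dl + (dl + dl)) by rewrite /dl; field; rewrite gt_eqF.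
  by rewrite ler_pM2l ?mulr_gt0 //; do 2 apply: lerD => //.
have parts (u : S -> R[i]) k x : u (iter k T x) =
    (complex.Re (u (iter k T x)) +i* complex.Im (u (iter k T x)))%C by case: (u _).
have meas (u v w z : S -> R) (c : R) : measurable_fun setT u -> measurable_fun setT v ->
    measurable_fun setT w -> measurable_fun setT z ->
    measurable_fun setT (fun x => N%:R^-1 *
      \sum_(1 <= n < N.+1) (u (iter (an n) T x) * v (iter (vn n) T x) +
        c * (w (iter (an n) T x) * z (iter (vn n) T x)))).
  move=> mu' mv mw mz; apply: measurable_funM => //; apply: measurable_sum => n.
  apply: measurable_funD; last apply: measurable_funM => //; apply: measurable_funM;
    by apply: measurableT_comp => //; exact: measurable_iter.
have [mfr mfi _] := Lf; have [mgr mgi _] := Lg.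
have avgE x := ergodic_average_parts an vn N (fun k => parts f k x) (fun k => parts g k x).
(* The left integrand involves the original functions, so its measurability is shown from their own
   coordinates; the comparison with [B] holds only where the orbit avoids the exceptional null
   sets. *)
apply: ae_ge0_le_integral => //.
- by move=> x _; rewrite lee_fin addr_ge0 ?sqr_ge0.
- apply/measurable_EFinP; apply: measurable_funD; apply: measurable_funX.
    rewrite (_ : (fun x => _) = (fun x => N%:R^-1 * \sum_(1 <= n < N.+1)
      (complex.Re (f (iter (an n) T x)) * complex.Re (g (iter (vn n) T x)) +
       -1 * (complex.Im (f (iter (an n) T x)) * complex.Im (g (iter (vn n) T x)))) - hr x)).
      by apply: measurable_funB; [exact: (meas _ _ _ _ (-1) mfr mgr mfi mgi)|exact: ahr.1].
    apply/funext => x; rewrite avgE /=; congr (_ * _ - _).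
    by apply: eq_bigr => n _; rewrite mulN1r.
  rewrite (_ : (fun x => _) = (fun x => N%:R^-1 * \sum_(1 <= n < N.+1)
      (complex.Re (f (iter (an n) T x)) * complex.Im (g (iter (vn n) T x)) +
       1 * (complex.Im (f (iter (an n) T x)) * complex.Re (g (iter (vn n) T x)))) - hi x)).
    by apply: measurable_funB; [exact: (meas _ _ _ _ 1 mfr mgi mfi mgr)|exact: ahi.1].
  apply/funext => x; rewrite avgE /=; congr (_ * _ - _).
  by apply: eq_bigr => n _; rewrite mul1r.
- by move=> x _; rewrite lee_fin; apply: mulr_ge0; [rewrite mulr_ge0 ?sqr_ge0|rewrite !addr_ge0 ?sqr_ge0].
- exact/measurable_EFinP/aB.1.
have := ae_orbit gE; apply: filterS2 (ae_orbit fE) => x fx gx _.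
rewrite lee_fin (ergodic_average_parts an vn N fx gx) /=.
have scale (p q p' q' : S -> R) (c : R) : N%:R^-1 * \sum_(1 <= n < N.+1)
     (M * p (iter (an n) T x) * (M' * q (iter (vn n) T x)) +
      c * (M * p' (iter (an n) T x) * (M' * q' (iter (vn n) T x)))) =
    C * (Phi p q N x + c * Phi p' q' N x).
  have fastE n : fast b 1 n = Num.truncn (n%:R `^ (1 + b)) by rewrite /fast mul1r.
  rewrite /Phi /two_term !mulr_sumr -big_split /= !mulr_sumr; apply: eq_bigr => n _.
  rewrite /koop !fastE /C /vn /=; ring.
have -> : N%:R^-1 * \sum_(1 <= n < N.+1)
     (M * f1 (iter (an n) T x) * (M' * g1 (iter (vn n) T x)) -
      M * f2 (iter (an n) T x) * (M' * g2 (iter (vn n) T x))) = C * (P11 x - P22 x).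
  by rewrite -[- P22 x]mulN1r -scale; congr (_ * _); apply: eq_bigr => n _; rewrite mulN1r.
have -> : N%:R^-1 * \sum_(1 <= n < N.+1)
     (M * f1 (iter (an n) T x) * (M' * g2 (iter (vn n) T x)) +
      M * f2 (iter (an n) T x) * (M' * g1 (iter (vn n) T x))) = C * (P12 x + P21 x).
  by rewrite -[P21 x]mul1r -scale; congr (_ * _); apply: eq_bigr => n _; rewrite mul1r.
rewrite /hr /hi /B.
move: (P11 x) (P22 x) (P12 x) (P21 x) (h11 x) (h22 x) (h12 x) (h21 x) => p q r s p' q' r' s'.
rewrite -subr_ge0 [X in 0 <= X](_ : _ = C ^+ 2 *
  (((p - p') + (q - q')) ^+ 2 + ((r - r') - (s - s')) ^+ 2)); last by ring.
by rewrite mulr_ge0 ?sqr_ge0 // addr_ge0 ?sqr_ge0.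
Qed.

End ergodic_averages.

Theorem theoremD (R : realType) (d : measure_display)
    (Omega : measurableType d) (P : probability Omega R)
    (X : nat -> {RV P >-> R}) (a b : R)
    (X01 : forall n w, (1 <= n)%N -> X n w = 0 \/ X n w = 1)
    (X_indep : independent_RVs [set n | (1 <= n)%N] X)
    (a_gt0 : 0 < a) (a_lt : a < 1 / 2)
    (X_law : forall n, (1 <= n)%N ->
       P [set w | X n w = 1] = (n%:R `^ (- a))%:E)
    (b_gt0 : 0 < b) (ab_lt : b + 2 * a < 1 / 2) :
  {ae P, forall w : Omega,
    let an := generated_seq (fun n => X n w) in
    forall (d' : measure_display) (S : measurableType d')
      (mu : probability S R) (T : S -> S),
    measure_preserving mu T ->
    forall f g : S -> R[i],
    complex_Lfun mu +oo%E f -> complex_Lfun mu +oo%E g ->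
    cvg_in_L2 mu
      (ergodic_average T an (fun n => Num.truncn ((an n)%:R `^ (1 + b) : R)) f g)}.
Proof.
have := almost_surely_typical X01 X_indep a_gt0 b_gt0 ab_lt X_law.
apply: filterS => w tw d' S mu T mpT f g Lf Lg.
have a1 : a < 1 by lra.
have b1 : b < 1 by lra.
apply: (cvg_ergodic_average (mpT := mpT) _ Lf Lg) => p q ap aq p1 q1.
exact: (random_average_approximable a_gt0 a1 b_gt0 b1 (fun n => @X01 n w) tw ap aq p1 q1).
Qed.
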